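(* Let $X$ be a noetherian scheme having an ample line bundle, and regard $X$ as a non-commutative space with $\mathrm{Mod}\,X := \mathrm{Qcoh}\,X$, the category of quasi-coherent $\mathcal{O}_X$-modules. Then closed subschemes and closed subspaces of $X$ are the same things: sending a closed subscheme $\iota: Z \hookrightarrow X$ to the full subcategory $\iota_*(\mathrm{Qcoh}\,Z)$ (closed under isomorphism) of $\mathrm{Qcoh}\,X$ is a bijection from the set of closed subschemes of $X$ to the set of closed subspaces of $X$.
   Context: A (non-commutative) space $X$ is a Grothendieck category $\mathrm{Mod}\,X$. A weakly closed subspace $W$ of $X$ is a full subcategory $\mathrm{Mod}\,W$ of $\mathrm{Mod}\,X$ that is closed under subquotients (hence under isomorphisms) and for which the inclusion functor $\alpha_*:\mathrm{Mod}\,W\to\mathrm{Mod}\,X$ has a right adjoint. It is called closed if $\alpha_*$ also has a left adjoint. *)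

(* Defs.v *)
From HB Require Import structures.
From mathcomp Require Import all_boot all_algebra.
From mathcomp Require Import boolp classical_sets functions topology.

Set Implicit Arguments.
Unset Strict Implicit.
Unset Printing Implicit Defensive.

Import GRing.Theory.

Local Open Scope classical_set_scope.
Local Open Scope ring_scope.

Record category := Category {
  Ob :> Type;
  Hom : Ob -> Ob -> Type;
  idm : forall A, Hom A A;
  cmp : forall A B C, Hom B C -> Hom A B -> Hom A C;
  cmp1m : forall A B (f : Hom A B), cmp (idm B) f = f;
  cmpm1 : forall A B (f : Hom A B), cmp f (idm A) = f;
  cmpA : forall A B C D (h : Hom C D) (g : Hom B C) (f : Hom A B),
    cmp h (cmp g f) = cmp (cmp h g) f }.

Arguments Hom {c} A B.
Arguments idm {c} A.
Arguments cmp {c A B C} g f.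

Record functor (C D : category) := Functor {
  fob :> C -> D;
  fhom : forall A B : C, Hom A B -> Hom (fob A) (fob B);
  fhom1 : forall A, fhom (idm A) = idm (fob A);
  fhomM : forall A B E (g : Hom B E) (f : Hom A B),
    fhom (cmp g f) = cmp (fhom g) (fhom f) }.

Definition adjoint (C D : category) (F : functor C D) (G : functor D C) : Prop :=
  exists phi : forall (c : C) (d : D), Hom (F c) d -> Hom c (G d),
    (forall c d, bijective (@phi c d)) /\
    (forall c c' d d' (u : Hom c' c) (v : Hom d d') (h : Hom (F c) d),
       phi c' d' (cmp v (cmp h (fhom F u))) = cmp (fhom G v) (cmp (phi c d h) u)).

Definition has_right_adjoint (C D : category) (F : functor C D) : Prop :=
  exists G : functor D C, adjoint F G.

Definition has_left_adjoint (C D : category) (F : functor C D) : Prop :=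
  exists G : functor D C, adjoint G F.

Definition monic (C : category) (A B : C) (f : Hom A B) : Prop :=
  forall (T : C) (u v : Hom T A), cmp f u = cmp f v -> u = v.

Definition epic (C : category) (A B : C) (f : Hom A B) : Prop :=
  forall (T : C) (u v : Hom B T), cmp u f = cmp v f -> u = v.

Definition isomorphic (C : category) (A B : C) : Prop :=
  exists (f : Hom A B) (g : Hom B A), cmp g f = idm A /\ cmp f g = idm B.

Definition subquotient (C : category) (N M : C) : Prop :=
  exists (S : C) (i : Hom S M) (p : Hom S N), monic i /\ epic p.

Section FullSubcategory.
Variables (C : category) (W : C -> Prop).

Definition full_subcategory : category :=
  @Category {A : C | W A} (fun A B => Hom (sval A) (sval B))
    (fun A => idm (sval A)) (fun A B E g f => cmp g f)
    (fun A B f => cmp1m f) (fun A B f => cmpm1 f)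
    (fun A B E F h g f => cmpA h g f).

Definition inclusion : functor full_subcategory C :=
  @Functor full_subcategory C (fun A => sval A) (fun A B f => f)
    (fun A => erefl) (fun A B E g f => erefl).

Definition weakly_closed_subspace : Prop :=
  (forall N M : C, W M -> subquotient N M -> W N) /\ has_right_adjoint inclusion.

Definition closed_subspace : Prop :=
  weakly_closed_subspace /\ has_left_adjoint inclusion.

End FullSubcategory.

Record opens (T : topologicalType) := Opens {
  oset :> set T;
  oset_open : open oset }.

Definition opensT (T : topologicalType) : opens T := Opens openT.

Definition opensI (T : topologicalType) (U V : opens T) : opens T :=
  Opens (openI (oset_open U) (oset_open V)).

Lemma preimage_is_open (S T : topologicalType) (f : S -> T) (cf : continuous f)
  (U : opens T) : open (f @^-1` U).
Proof. by move/continuousP: cf; apply; exact: oset_open. Qed.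

Definition preimage_opens (S T : topologicalType) (f : S -> T)
  (cf : continuous f) (U : opens T) : opens S := Opens (preimage_is_open cf U).

(* Agreement on V i `&` V j is expressed on all the open sets it contains. *)
Definition is_sheaf (T : topologicalType) (F : opens T -> Type)
    (res : forall U V : opens T, V `<=` U -> F U -> F V) : Prop :=
  forall (U : opens T) (I : Type) (V : I -> opens T) (VU : forall i, V i `<=` U),
    (forall x, oset U x -> exists i, oset (V i) x) ->
  forall s : forall i, F (V i),
    (forall i j (W : opens T) (Wi : W `<=` V i) (Wj : W `<=` V j),
       res _ _ Wi (s i) = res _ _ Wj (s j)) ->
  exists! t : F U, forall i, res _ _ (VU i) t = s i.

(* Rings of sections may be zero (over the empty set they are), hence the
   use of comPzRingType. *)
Record ringedSpace := RingedSpace {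
  rs_top :> topologicalType;
  sec : opens rs_top -> comPzRingType;
  rres : forall U V : opens rs_top, V `<=` U -> {rmorphism sec U -> sec V};
  rres_id : forall (U : opens _) (h : U `<=` U) (s : sec U), rres h s = s;
  rres_comp : forall (U V W : opens _) (h : V `<=` U) (k : W `<=` V) (l : W `<=` U)
    (s : sec U), rres k (rres h s) = rres l s;
  rres_sheaf : is_sheaf (fun U V h => rres h) }.

Arguments sec : clear implicits.
Arguments rres {r U V} h.

Definition is_unit (R : comPzRingType) (a : R) : Prop := exists b, a * b = 1.

(* The germ of [s] at [x] is invertible. *)
Definition germ_unit (X : ringedSpace) (U : opens X) (s : sec X U) (x : X) : Prop :=
  exists (V : opens X) (h : V `<=` U), oset V x /\ is_unit (rres h s).

Record is_ideal (A : comPzRingType) (I : set A) : Prop := IsIdeal {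
  ideal0 : I 0;
  idealD : forall a b, I a -> I b -> I (a + b);
  idealM : forall a b, I b -> I (a * b) }.

Record spec (A : comPzRingType) := Spec {
  prime_set :> set A;
  prime_is_ideal : is_ideal prime_set;
  prime_proper : ~ prime_set 1;
  prime_mul : forall a b, prime_set (a * b) -> prime_set a \/ prime_set b }.

Section Zariski.
Variable A : comPzRingType.

Definition zariski_open (U : set (spec A)) : Prop :=
  exists E : set A, U = [set p | ~ (E `<=` p)].

Lemma zariski_openT : zariski_open setT.
Proof.
exists setT; apply/seteqP; split => p //= _ Ep.
by apply: (@prime_proper _ p); apply: Ep.
Qed.

Lemma zariski_openI (U V : set (spec A)) :
  zariski_open U -> zariski_open V -> zariski_open (U `&` V).
Proof.
move=> [E ->] [F ->]; exists [set c | exists a b, [/\ E a, F b & c = a * b]].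
apply/seteqP; split => p /=.
  move=> [nE nF] EF; apply: nE => a Ea; apply: contrapT => npa.
  apply: nF => b Fb.
  by have [//| //|] := @prime_mul _ p a b; first by apply: EF; exists a, b.
move=> nEF; split=> [Ep|Fp]; apply: nEF => _ [a [b [Ea Fb ->]]].
  by rewrite mulrC; apply: (idealM (prime_is_ideal p)); apply: Ep.
by apply: (idealM (prime_is_ideal p)); apply: Fp.
Qed.

Lemma zariski_open_bigU (I : Type) (f : I -> set (spec A)) :
  (forall i, zariski_open (f i)) -> zariski_open (\bigcup_i f i).
Proof.
move=> /choice [E fE]; exists (\bigcup_i E i).
apply/seteqP; split => p /=.
  by move=> [i _]; rewrite fE /= => nE Ep; apply: nE => a Ea; apply: Ep; exists i.
move=> nE; apply: contrapT => nf; apply: nE => a [i _ Ea].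
by apply: contrapT => npa; apply: nf; exists i => //; rewrite fE /= => /(_ _ Ea).
Qed.

HB.instance Definition _ := gen_eqMixin (spec A).
HB.instance Definition _ := gen_choiceMixin (spec A).
HB.instance Definition _ := isOpenTopological.Build (spec A)
  zariski_openT zariski_openI zariski_open_bigU.

Definition basic_open (f : A) : set (spec A) := [set p | ~ prime_set p f].

End Zariski.

(* [phi] identifies [B] with the localization A_f. *)
Definition is_localization (A B : comPzRingType) (f : A) (phi : A -> B) : Prop :=
  [/\ is_unit (phi f),
      forall b, exists a n, phi f ^+ n * b = phi a &
      forall a, phi a = 0 -> exists n, f ^+ n * a = 0].

(* An open immersion of Spec A in X with image [chart_open].  The structure
   sheaf of Spec A is the sheaf whose sections over the basic open set D(f) are
   A_f, with the canonical maps as restrictions; as the D(f) form a basis, an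
   isomorphism of ringed spaces from Spec A to [chart_open] is a homeomorphism
   together with a ring morphism from A to O_X([chart_open]) which makes
   O_X(D(f)) the localization A_f for all f. *)
Record affine_chart (X : ringedSpace) := AffineChart {
  chart_ring : comPzRingType;
  chart_map : spec chart_ring -> X;
  chart_open : opens X;
  chart_hom : {rmorphism chart_ring -> sec X chart_open};
  chart_inj : injective chart_map;
  chart_continuous : continuous chart_map;
  chart_open_map : forall V, open V -> open (chart_map @` V);
  chart_range : range chart_map = chart_open;
  chart_localization :
    forall (f : chart_ring) (V : opens X) (h : V `<=` chart_open),
      oset V = chart_map @` basic_open f ->
      is_localization f (fun a => rres h (chart_hom a)) }.

Definition affine_open (X : ringedSpace) (U : set X) : Prop :=
  exists c : affine_chart X, U = chart_open c.

(* Stalks of a space covered by charts are local rings, so this agrees with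
   the definition by locally ringed spaces. *)
Record scheme := Scheme {
  scheme_space :> ringedSpace;
  scheme_cover : forall x : scheme_space,
    exists c : affine_chart scheme_space, oset (chart_open c) x }.

Definition noetherian_ring (A : comPzRingType) : Prop :=
  forall I : set A, is_ideal I -> exists (n : nat) (e : 'I_n -> A),
    (forall i, I (e i)) /\
    (forall a, I a -> exists c : 'I_n -> A, a = \sum_(i < n) c i * e i).

Definition noetherian_scheme (X : scheme) : Prop :=
  exists (n : nat) (c : 'I_n -> affine_chart X),
    (forall x : X, exists i, oset (chart_open (c i)) x) /\
    (forall i, noetherian_ring (chart_ring (c i))).

Record omod (X : ringedSpace) := OMod {
  msec : forall U : opens X, lmodType (sec X U);
  mres : forall U V : opens X, V `<=` U -> msec U -> msec V;
  mresP : forall (U V : opens _) (h : V `<=` U) (a : sec X U) (m n : msec U),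
    mres h (a *: m + n) = rres h a *: mres h m + mres h n;
  mres_id : forall (U : opens _) (h : U `<=` U) (m : msec U), mres h m = m;
  mres_comp : forall (U V W : opens _) (h : V `<=` U) (k : W `<=` V) (l : W `<=` U)
    (m : msec U), mres k (mres h m) = mres l m;
  mres_sheaf : is_sheaf mres }.

Arguments msec {X} o U.
Arguments mres {X} o {U V} h m.

Record ohom (X : ringedSpace) (M N : omod X) := OHom {
  ohom_fun :> forall U, msec M U -> msec N U;
  ohom_linear : forall U, linear (@ohom_fun U);
  ohom_res : forall (U V : opens _) (h : V `<=` U) (m : msec M U),
    ohom_fun (mres M h m) = mres N h (ohom_fun m) }.

Arguments ohom_fun {X M N} o U m.

Lemma ohom_eq (X : ringedSpace) (M N : omod X) (f g : ohom M N) :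
  (forall U m, f U m = g U m) -> f = g.
Proof.
case: f g => [f fl fr] [g gl gr] /= fg.
have e : f = g by apply: functional_extensionality_dep => U; apply: funext.
by subst g; rewrite (Prop_irrelevance fl gl) (Prop_irrelevance fr gr).
Qed.

Definition ohom_id (X : ringedSpace) (M : omod X) : ohom M M.
Proof. by exists (fun U m => m). Defined.

Definition ohom_comp (X : ringedSpace) (M N P : omod X)
  (g : ohom N P) (f : ohom M N) : ohom M P.
Proof.
exists (fun U m => g U (f U m)) => [U a m n|U V h m].
  by rewrite !ohom_linear.
by rewrite !ohom_res.
Defined.

Definition omod_cat (X : ringedSpace) : category :=
  @Category (omod X) (@ohom X) (@ohom_id X) (@ohom_comp X)
    (fun M N f => @ohom_eq X M N (ohom_comp (ohom_id N) f) f (fun U m => erefl))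
    (fun M N f => @ohom_eq X M N (ohom_comp f (ohom_id M)) f (fun U m => erefl))
    (fun M N P Q h g f => @ohom_eq X M Q (ohom_comp h (ohom_comp g f))
      (ohom_comp (ohom_comp h g) f) (fun U m => erefl)).

(* Locally, M restricted to an affine open set Spec A is the sheaf associated
   to an A-module N, i.e. the sheaf with sections N_f over D(f); taking f = 1,
   N has to be the module of sections of M over Spec A.  That f acts
   bijectively on M(D(f)) is automatic, f being a unit in O_X(D(f)). *)
Definition quasi_coherent (X : ringedSpace) (M : omod X) : Prop :=
  forall x : X, exists c : affine_chart X, oset (chart_open c) x /\
    forall (f : chart_ring c) (V : opens X) (h : V `<=` chart_open c),
      oset V = @chart_map _ c @` basic_open f ->
      (forall m : msec M V, exists (m0 : msec M (chart_open c)) (n : nat),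
         rres h (chart_hom c f) ^+ n *: m = mres M h m0) /\
      (forall m0 : msec M (chart_open c), mres M h m0 = 0 ->
         exists n : nat, chart_hom c f ^+ n *: m0 = 0).

Definition Qcoh (X : ringedSpace) : category :=
  full_subcategory (C := omod_cat X) (@quasi_coherent X).

Definition line_bundle (X : ringedSpace) (L : omod X) : Prop :=
  forall x : X, exists (U : opens X) (e : msec L U), oset U x /\
    forall (V : opens X) (h : V `<=` U),
      bijective (fun a : sec X V => a *: mres L h e).

Record obilinear (X : ringedSpace) (M N P : omod X) := OBilinear {
  obil_fun :> forall U, msec M U -> msec N U -> msec P U;
  obil_linearl : forall U n, linear (fun m => @obil_fun U m n);
  obil_linearr : forall U m, linear (@obil_fun U m);
  obil_res : forall (U V : opens _) (h : V `<=` U) (m : msec M U) (n : msec N U),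
    obil_fun (mres M h m) (mres N h n) = mres P h (obil_fun m n) }.

Arguments obil_fun {X M N P} o U m n.

Definition is_tensor (X : ringedSpace) (M N T : omod X) : Prop :=
  exists beta : obilinear M N T, forall (P : omod X) (b : obilinear M N P),
    exists! h : ohom T P, forall U m n, h U (beta U m n) = b U m n.

(* [tensor_power L n P]: P is an n-th tensor power of L, for n >= 1. *)
Inductive tensor_power (X : ringedSpace) (L : omod X) : nat -> omod X -> Prop :=
| TensorPower1 : tensor_power L 1%N L
| TensorPowerS n P Q :
    tensor_power L n P -> is_tensor P L Q -> tensor_power L n.+1 Q.

(* X_s: the points at which the germ of [s] generates the stalk of [P]. *)
Definition nonvanishing (X : ringedSpace) (P : omod X)
    (s : msec P (opensT X)) : set X :=
  [set x | forall (U : opens X) (t : msec P U), oset U x ->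
     exists (V : opens X) (h : V `<=` U) (k : V `<=` opensT X) (a : sec X V),
       oset V x /\ mres P h t = a *: mres P k s].

(* Ampleness on a quasi-compact X, as in EGA II and the Stacks project. *)
Definition ample (X : ringedSpace) (L : omod X) : Prop :=
  line_bundle L /\
  forall x : X, exists (n : nat) (P : omod X) (s : msec P (opensT X)),
    [/\ (0 < n)%N, tensor_power L n P, nonvanishing s x &
        affine_open (nonvanishing s)].

Record morphism (Z X : ringedSpace) := Morphism {
  mor_map :> Z -> X;
  mor_continuous : continuous mor_map;
  mor_sec : forall U : opens X,
    {rmorphism sec X U -> sec Z (preimage_opens mor_continuous U)};
  mor_res : forall (U V : opens X) (h : V `<=` U)
    (k : preimage_opens mor_continuous V `<=` preimage_opens mor_continuous U)
    (s : sec X U), mor_sec V (rres h s) = rres k (mor_sec U s);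
  mor_local : forall (U : opens X) (s : sec X U) (z : Z), oset U (mor_map z) ->
    germ_unit (mor_sec U s) z -> germ_unit s (mor_map z) }.

Definition mor_preimage (Z X : ringedSpace) (f : morphism Z X) (U : opens X) :
  opens Z := preimage_opens (@mor_continuous _ _ f) U.

Definition mor_iso (Y Z : ringedSpace) (f : morphism Y Z) : Prop :=
  (exists g : Z -> Y, [/\ continuous g, cancel f g & cancel g f]) /\
  (forall U, bijective (mor_sec f U)).

(* f o phi = g as morphisms; the two comorphisms take values in sections over
   f^-1 and g^-1 of U, compared on the common open subsets. *)
Definition mor_triangle (Y Z X : ringedSpace) (phi : morphism Y Z)
    (f : morphism Z X) (g : morphism Y X) : Prop :=
  (forall y, f (phi y) = g y) /\
  (forall (U : opens X) (s : sec X U) (W : opens Y)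
     (h : W `<=` mor_preimage phi (mor_preimage f U))
     (k : W `<=` mor_preimage g U),
     rres h (mor_sec phi _ (mor_sec f U s)) = rres k (mor_sec g U s)).

Definition closed_immersion (Z X : ringedSpace) (i : morphism Z X) : Prop :=
  [/\ injective i,
      closed (range i),
      (forall V : set Z, open V -> exists2 U : set X, open U & V = i @^-1` U) &
      (* surjectivity of O_X -> i_* O_Z *)
      forall (U : opens X) (t : sec Z (mor_preimage i U)) (x : X), oset U x ->
        exists (V : opens X) (s : sec X V)
          (k : mor_preimage i V `<=` mor_preimage i U),
          oset V x /\ mor_sec i V s = rres k t].

(* A closed subscheme of X is one of these up to [same_subscheme]. *)
Record closed_subscheme (X : scheme) := ClosedSubscheme {
  sub_scheme : scheme;
  sub_mor : morphism sub_scheme X;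
  sub_closed : closed_immersion sub_mor }.

Definition same_subscheme (X : scheme) (Y Z : closed_subscheme X) : Prop :=
  exists phi : morphism (sub_scheme Y) (sub_scheme Z),
    mor_iso phi /\ mor_triangle phi (sub_mor Z) (sub_mor Y).

Definition restrict_scalars (R S : pzRingType) (phi : {rmorphism R -> S})
  (M : lmodType S) : Type := M.

Section RestrictScalars.
Variables (R S : pzRingType) (phi : {rmorphism R -> S}) (M : lmodType S).
Local Notation M' := (restrict_scalars phi M).

HB.instance Definition _ := GRing.Zmodule.on M'.

Let scale (a : R) (m : M') : M' := phi a *: (m : M).

Fact restrict_scalerA a b m : scale a (scale b m) = scale (a * b) m.
Proof. by rewrite /scale scalerA rmorphM. Qed.
Fact restrict_scale1r : left_id 1 scale.
Proof. by move=> m; rewrite /scale rmorph1 scale1r. Qed.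
Fact restrict_scalerDr : right_distributive scale +%R.
Proof. by move=> a m n; rewrite /scale scalerDr. Qed.
Fact restrict_scalerDl m : {morph scale^~ m : a b / a + b}.
Proof. by move=> a b; rewrite /scale rmorphD scalerDl. Qed.

HB.instance Definition _ := GRing.Zmodule_isLmodule.Build R M'
  restrict_scalerA restrict_scale1r restrict_scalerDr restrict_scalerDl.
End RestrictScalars.

Section Pushforward.
Variables (Z X : ringedSpace) (f : morphism Z X) (M : omod Z).

Definition push_sec (U : opens X) : lmodType (sec X U) :=
  restrict_scalars (mor_sec f U) (msec M (mor_preimage f U)).

Lemma mor_preimageS (U V : opens X) :
  V `<=` U -> mor_preimage f V `<=` mor_preimage f U.
Proof. by move=> VU z; apply: VU. Qed.

Definition push_res (U V : opens X) (h : V `<=` U) (m : push_sec U) :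
  push_sec V := mres M (mor_preimageS h) m.

Lemma push_resP (U V : opens X) (h : V `<=` U) (a : sec X U) (m n : push_sec U) :
  push_res h (a *: m + n) = rres h a *: push_res h m + push_res h n.
Proof.
rewrite /push_res; etransitivity; first exact: mresP.
by rewrite -mor_res.
Qed.

Lemma push_res_id (U : opens X) (h : U `<=` U) (m : push_sec U) : push_res h m = m.
Proof. exact: mres_id. Qed.

Lemma push_res_comp (U V W : opens X) (h : V `<=` U) (k : W `<=` V) (l : W `<=` U)
  (m : push_sec U) : push_res k (push_res h m) = push_res l m.
Proof. exact: mres_comp. Qed.

Lemma push_sheaf : is_sheaf push_res.
Proof.
move=> U I V VU cov s ss.
apply: (@mres_sheaf _ M (mor_preimage f U) I (fun i => mor_preimage f (V i))
  (fun i => mor_preimageS (VU i))).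
  by move=> z /cov.
move=> i j W Wi Wj.
have Ii : opensI (V i) (V j) `<=` V i by move=> x [].
have Ij : opensI (V i) (V j) `<=` V j by move=> x [].
have WI : W `<=` mor_preimage f (opensI (V i) (V j)).
  by move=> z Wz; split; [exact: Wi | exact: Wj].
have := ss i j _ Ii Ij; rewrite /push_res => /(congr1 (mres M WI)).
by rewrite (mres_comp _ _ Wi) (mres_comp _ _ Wj).
Qed.

Definition pushforward : omod X :=
  OMod push_resP push_res_id push_res_comp push_sheaf.

End Pushforward.

(* The full subcategory i_*(Qcoh Z) of Qcoh X, closed under isomorphism. *)
Definition qcoh_image (X : scheme) (Z : closed_subscheme X) (N : Qcoh X) : Prop :=
  exists M : Qcoh (sub_scheme Z),
    isomorphic (C := omod_cat X) (sval N) (pushforward (sub_mor Z) (sval M)).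

(* Main.v *)
(** Both sides are classified by quasi-coherent ideals I of O_X: to a closed
    subscheme Z corresponds I = ker (O_X -> i_* O_Z), and i_*(Qcoh Z) consists
    of the quasi-coherent modules N with I N = 0.  That category is a closed
    subspace: the adjoints of its inclusion are N |-> N / I N and
    N |-> {n | I n = 0}, the latter being quasi-coherent because I is locally
    finitely generated.

    Conversely let C be a closed subspace, with O_X -> E the unit of the left
    adjoint at O_X and I its kernel.  A power of the ample bundle has sections
    s_l whose nonvanishing loci U_l are affine and cover X.  If N is in C then
    so are its twists N(k), k >= 0, since the maps s_l^k : N -> N(k) factor
    through the coreflection of N(k) in C and are jointly epic, and N(-k),
    since the maps s_l^k : N(-k) -> N factor through the reflection of N(-k)
    in C and are jointly monic.  Every section n of N over U_l becomes a global
    section of some N(k) after multiplication by s_l^k.  If N is in C, the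
    resulting map O_X -> N(k) factors through E, so that I n = 0.  If I N = 0,
    it induces a map E(-k) -> N whose image contains n; hence the counit of
    the right adjoint at N is epic, and N is in C. *)
From HB Require Import structures.
From mathcomp Require Import all_boot all_algebra.
From mathcomp Require Import boolp classical_sets functions topology.
Require Import Defs.

Set Implicit Arguments.
Unset Strict Implicit.
Unset Printing Implicit Defensive.

Import GRing.Theory.

Local Open Scope classical_set_scope.
Local Open Scope ring_scope.

(** * Sheaves of modules *)

(** Twists, quotients and modules on closed subsets are built without tensor products,
    sheafification or stalks. The modules N(k) and N(-k) are families of sections over the members
    U_i of a finite atlas, glued by powers of the ratios s_j / s_i, which are all that is kept of
    the ample bundle. A section of a quotient is a torsor inside the module above it. A module that
    is zero off a closed subset is evaluated at the largest open set with a given trace on that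
    subset. Affineness enters through [aff], a condition on the ring O(U) which passes to basic open
    subsets; a chart is constructed only once, for the closed subscheme of an ideal. Quasi-coherence
    becomes the condition [good] on these open sets, and each argument there consists in clearing
    denominators. The noetherian hypothesis serves twice: the annihilator of I in a module is
    quasi-coherent because I is finitely generated on charts, and the atlas can be taken finite, so
    that finitely many exponents have a common bound. *)

Lemma opens_eq (T : topologicalType) (U V : opens T) : oset U = oset V -> U = V.
Proof.
case: U V => [U oU] [V oV] /= UV; subst V; by rewrite (Prop_irrelevance oU oV).
Qed.

Lemma opensIl (T : topologicalType) (U V : opens T) : opensI U V `<=` U.
Proof. by move=> x []. Qed.

Lemma opensIr (T : topologicalType) (U V : opens T) : opensI U V `<=` V.
Proof. by move=> x []. Qed.

Local Notation capl := (@opensIl _ _ _).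
Local Notation capr := (@opensIr _ _ _).
Local Notation "h >=> k" := (subset_trans h k) (at level 40).
Local Notation sub_rfl := (@subset_refl _ _).

Section Sheaf.
Variables (T : topologicalType) (F : opens T -> Type).
Variable res : forall U V : opens T, V `<=` U -> F U -> F V.
Hypothesis res_comp : forall (U V W : opens T) (h : V `<=` U) (k : W `<=` V)
  (l : W `<=` U) (s : F U), res k (res h s) = res l s.
Hypothesis sheafF : is_sheaf res.

Lemma sheaf_ext (U : opens T) (s t : F U) :
  (forall x, oset U x -> exists (V : opens T) (h : V `<=` U),
     oset V x /\ res h s = res h t) -> s = t.
Proof.
move=> st.
pose I := {x : T | oset U x}.
have /choice [V hV] : forall i : I, exists V : opens T, exists h : V `<=` U,
    oset V (sval i) /\ res h s = res h t by move=> [x Ux]; exact: st.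
have VU i : V i `<=` U by have [h _] := hV i.
have [||t' [_ t'P]] := @sheafF U I V VU _ (fun i => res (VU i) t) _.
- by move=> x Ux; exists (exist _ x Ux); have [h [Vx _]] := hV (exist _ x Ux).
- move=> i j W Wi Wj.
  by rewrite (res_comp _ _ (Wi >=> (VU i))) -(res_comp (VU j) Wj).
have <- : t' = s.
  apply: t'P => i; have [h [_ e]] := hV i.
  by rewrite (Prop_irrelevance (VU i) h).
by apply: t'P.
Qed.

(** Gluing by a predicate: P V s describes the section wanted over V. Since it determines s,
    agreement on overlaps is automatic, and only local existence is left to check. *)
Lemma sheaf_glue (U : opens T) (P : forall V, F V -> Prop) :
  (forall (V W : opens T) (h : V `<=` U) (k : W `<=` V) s, P V s -> P W (res k s)) ->
  (forall (V : opens T) (h : V `<=` U) s t, P V s -> P V t -> s = t) ->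
  (forall x, oset U x -> exists (V : opens T) (h : V `<=` U) (s : F V), oset V x /\ P V s) ->
  exists s : F U, forall (V : opens T) (h : V `<=` U) t, P V t -> res h s = t.
Proof.
move=> Pres Puniq Pex.
pose I := {x : T | oset U x}.
have /choice [V hV] : forall i : I, exists V : opens T,
    exists h : V `<=` U, exists s : F V, oset V (sval i) /\ P V s.
  by move=> [x Ux]; exact: Pex.
have VU i : V i `<=` U by have [h _] := hV i.
have sP i : {s : F (V i) | oset (V i) (sval i) /\ P (V i) s}.
  by apply: cid; have [h [s ?]] := hV i; exists s.
have [||t [tP _]] := @sheafF U I V VU _ (fun i => sval (sP i)) _.
- move=> x Ux; exists (exist _ x Ux); by case: (sP (exist _ x Ux)) => ? [].
- move=> i j W Wi Wj; apply: (Puniq W (Wi >=> (VU i))).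
    by apply: Pres => //; case: (sP i) => ? [].
  by apply: Pres => //; case: (sP j) => ? [].
exists t => W h u Pu; apply: sheaf_ext => y Wy.
pose i : I := exist _ y (h _ Wy).
have Wi : opensI W (V i) `<=` W by exact: opensIl.
have Vi : opensI W (V i) `<=` V i by exact: opensIr.
exists (opensI W (V i)), Wi; split.
  by split=> //; case: (sP i) => ? [].
rewrite (res_comp _ _ (Wi >=> h)).
apply: (Puniq _ (Wi >=> h)); last exact: Pres.
rewrite -(res_comp (VU i) Vi) tP; apply: Pres => //.
by case: (sP i) => ? [].
Qed.

End Sheaf.

Lemma rres_ext (X : ringedSpace) (U : opens X) (a b : sec X U) :
  (forall x, oset U x -> exists (V : opens X) (h : V `<=` U), oset V x /\ rres h a = rres h b) ->
  a = b.
Proof. exact: (sheaf_ext (@rres_comp X) (@rres_sheaf X)). Qed.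

Section OmodBasics.
Variables (X : ringedSpace) (M : omod X).
Implicit Types U V W : opens X.

Lemma mresD U V (h : V `<=` U) (m n : msec M U) : mres M h (m + n) = mres M h m + mres M h n.
Proof. by rewrite -[m in LHS]scale1r mresP rmorph1 scale1r. Qed.

Lemma mres0 U V (h : V `<=` U) : mres M h 0 = 0.
Proof. by apply: (@addIr _ (mres M h 0)); rewrite -mresD add0r add0r. Qed.

Lemma mresZ U V (h : V `<=` U) a (m : msec M U) : mres M h (a *: m) = rres h a *: mres M h m.
Proof. by rewrite -[a *: m]addr0 mresP mres0 addr0. Qed.

Lemma mresN U V (h : V `<=` U) (m : msec M U) : mres M h (- m) = - mres M h m.
Proof. by rewrite -scaleN1r mresZ rmorphN1 scaleN1r. Qed.

Lemma mresB U V (h : V `<=` U) (m n : msec M U) : mres M h (m - n) = mres M h m - mres M h n.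
Proof. by rewrite mresD mresN. Qed.

Lemma mres_ext U (m n : msec M U) :
  (forall x, oset U x -> exists V (h : V `<=` U), oset V x /\ mres M h m = mres M h n) -> m = n.
Proof. apply: sheaf_ext; [exact: mres_comp | exact: mres_sheaf]. Qed.

Definition mres_glue U (P : forall V, msec M V -> Prop) :=
  @sheaf_glue X (msec M) (@mres X M) (@mres_comp X M) (@Defs.mres_sheaf X M) U P.

End OmodBasics.

Section OhomBasics.
Variables (X : ringedSpace) (M N : omod X) (f : ohom M N).
Implicit Types U V W : opens X.

Lemma ohomD U (m n : msec M U) : f U (m + n) = f U m + f U n.
Proof. by have := ohom_linear f 1 m n; rewrite !scale1r. Qed.
Lemma ohom0 U : f U 0 = 0.
Proof. by apply: (@addIr _ (f U 0)); rewrite -ohomD add0r add0r. Qed.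
Lemma ohomZ U a (m : msec M U) : f U (a *: m) = a *: f U m.
Proof. by rewrite -[a *: m]addr0 ohom_linear ohom0 addr0. Qed.
Lemma ohomN U (m : msec M U) : f U (- m) = - f U m.
Proof. by rewrite -scaleN1r ohomZ scaleN1r. Qed.
Lemma ohomB U (m n : msec M U) : f U (m - n) = f U m - f U n.
Proof. by rewrite ohomD ohomN. Qed.
End OhomBasics.

(** * The structure sheaf, extension from an open set, products and submodules *)

Section Constructions.
Variable X : ringedSpace.
Implicit Types U V W : opens X.

Definition omod_str : omod X.
Proof.
refine (@OMod X (fun U => (sec X U)^o : lmodType (sec X U)) (fun U V h => rres h) _ _ _ _).
- by move=> U V h a m n; rewrite rmorphD rmorphM.
- exact: rres_id.
- exact: rres_comp.
- exact: rres_sheaf.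
Defined.

Section Restrict.
Variables (U : opens X) (M : omod X).

Definition omod_restrict_res (V W : opens X) (h : W `<=` V) :
  opensI U W `<=` opensI U V := setIS h.

(** The module j_* j^* M, for j the inclusion of U. Data given over U alone become global with
    values in it. *)
Definition omod_restrict : omod X.
Proof.
refine (@OMod X (fun V => restrict_scalars (rres (@opensIr _ U V)) (msec M (opensI U V))
   : lmodType (sec X V)) (fun V W h => mres M (omod_restrict_res h)) _ _ _ _).
- move=> V W h a m n; etransitivity; first exact: mresP.
  rewrite (rres_comp _ _ ((@opensIr _ U W) >=> h)).
  by rewrite -(rres_comp h (@opensIr _ U W)).
- by move=> V h m; exact: mres_id.
- by move=> V W S h k l m; exact: mres_comp.
- move=> V I W WV cov s ss.
  apply: (@mres_sheaf _ M (opensI U V) I (fun i => opensI U (W i))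
    (fun i => omod_restrict_res (WV i))).
    by move=> x [Ux /cov [i Wi]]; exists i.
  move=> i j S Si Sj.
  have Wi : S `<=` W i by move=> x /Si [].
  have Wj : S `<=` W j by move=> x /Sj [].
  have US : S `<=` opensI U S by move=> x Sx; split=> //; have [] := Si _ Sx.
  have /(congr1 (mres M US)) := ss i j S Wi Wj.
  by rewrite (mres_comp _ _ Si) (mres_comp _ _ Sj).
Defined.

End Restrict.

Section Product.
Variables (I : Type) (M : I -> omod X).

Section Sections.
Variable U : opens X.
Definition prod_sec := forall i, msec (M i) U.
HB.instance Definition _ := gen_eqMixin prod_sec.
HB.instance Definition _ := gen_choiceMixin prod_sec.
Lemma prod_sec_eq (m n : prod_sec) : (forall i, m i = n i) -> m = n.
Proof. exact: functional_extensionality_dep. Qed.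
Let add (m n : prod_sec) : prod_sec := fun i => m i + n i.
Let opp (m : prod_sec) : prod_sec := fun i => - m i.
Let scale (a : sec X U) (m : prod_sec) : prod_sec := fun i => a *: m i.
Let zero : prod_sec := fun i => 0.
Fact prod_addA : associative add.
Proof. by move=> m n p; apply: prod_sec_eq => i; exact: addrA. Qed.
Fact prod_addC : commutative add.
Proof. by move=> m n; apply: prod_sec_eq => i; exact: addrC. Qed.
Fact prod_add0 : left_id zero add.
Proof. by move=> m; apply: prod_sec_eq => i; exact: add0r. Qed.
Fact prod_addN : left_inverse zero opp add.
Proof. by move=> m; apply: prod_sec_eq => i; exact: addNr. Qed.
HB.instance Definition _ := GRing.isZmodule.Build prod_sec prod_addA prod_addC prod_add0 prod_addN.
Fact prod_scaleA a b m : scale a (scale b m) = scale (a * b) m.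
Proof. by apply: prod_sec_eq => i; exact: scalerA. Qed.
Fact prod_scale1 : left_id 1 scale.
Proof. by move=> m; apply: prod_sec_eq => i; exact: scale1r. Qed.
Fact prod_scaleDr : right_distributive scale +%R.
Proof. by move=> a m n; apply: prod_sec_eq => i; exact: scalerDr. Qed.
Fact prod_scaleDl m : {morph scale^~ m : a b / a + b}.
Proof. by move=> a b; apply: prod_sec_eq => i; exact: scalerDl. Qed.
HB.instance Definition _ := GRing.Zmodule_isLmodule.Build (sec X U) prod_sec
  prod_scaleA prod_scale1 prod_scaleDr prod_scaleDl.
End Sections.

Definition omod_prod : omod X.
Proof.
refine (@OMod X (fun U => prod_sec U : lmodType (sec X U))
  (fun U V h (m : prod_sec U) i => mres (M i) h (m i)) _ _ _ _).
- by move=> U V h a m n; apply: prod_sec_eq => i; exact: mresP.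
- by move=> U h m; apply: prod_sec_eq => i; exact: mres_id.
- by move=> U V W h k l m; apply: prod_sec_eq => i; exact: mres_comp.
- move=> U J V VU cov s ss.
  have H i := @mres_sheaf _ (M i) U J V VU cov (fun j => s j i)
    (fun j k W Wj Wk => congr1 (fun t : prod_sec W => t i) (ss j k W Wj Wk)).
  exists (fun i => sval (cid (H i))); split.
    by move=> j; apply: prod_sec_eq => i; case: (cid (H i)) => t /= [].
  move=> t tP; apply: prod_sec_eq => i; case: (cid (H i)) => u /= [_].
  by apply => j; rewrite -tP.
Defined.

End Product.
End Constructions.

(** The locality clause [ss_loc] is what makes [omod_sub] a sheaf as it stands. *)
Record subsheaf (X : ringedSpace) (M : omod X) := Subsheaf {
  ss_set :> forall U, set (msec M U);
  ss0 : forall U, ss_set (0 : msec M U);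
  ssP : forall U a (m n : msec M U), ss_set m -> ss_set n -> ss_set (a *: m + n);
  ss_res : forall (U V : opens X) (h : V `<=` U) (m : msec M U), ss_set m -> ss_set (mres M h m);
  ss_loc : forall U (m : msec M U), (forall x, oset U x ->
     exists (V : opens X) (h : V `<=` U), oset V x /\ ss_set (mres M h m)) -> ss_set m }.
Arguments ss_set {X M} s U _.

Section SubsheafTheory.
Variables (X : ringedSpace) (M : omod X) (K : subsheaf M).
Implicit Types U V W : opens X.

Lemma ssD U (m n : msec M U) : K U m -> K U n -> K U (m + n).
Proof. by move=> Km Kn; rewrite -[m]scale1r; exact: ssP. Qed.
Lemma ssZ U a (m : msec M U) : K U m -> K U (a *: m).
Proof. by move=> Km; rewrite -[_ *: _]addr0; apply: ssP => //; exact: ss0. Qed.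
Lemma ssN U (m : msec M U) : K U m -> K U (- m).
Proof. by move=> Km; rewrite -scaleN1r; exact: ssZ. Qed.
Lemma ssB U (m n : msec M U) : K U m -> K U n -> K U (m - n).
Proof. by move=> Km Kn; apply: ssD => //; exact: ssN. Qed.

Section Sections.
Variable U : opens X.
Definition sub_sec := {m : msec M U | K U m}.
HB.instance Definition _ := gen_eqMixin sub_sec.
HB.instance Definition _ := gen_choiceMixin sub_sec.
Let add (m n : sub_sec) : sub_sec := exist _ _ (ssD (svalP m) (svalP n)).
Let opp (m : sub_sec) : sub_sec := exist _ _ (ssN (svalP m)).
Let scale a (m : sub_sec) : sub_sec := exist _ _ (ssZ a (svalP m)).
Let zero : sub_sec := exist _ _ (@ss0 X M K U).
Lemma sub_sec_eq (m n : sub_sec) : sval m = sval n -> m = n.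
Proof.
case: m n => [m Km] [n Kn] /= e; subst n; by rewrite (Prop_irrelevance Km Kn).
Qed.
Fact sub_addA : associative add.
Proof. by move=> m n p; apply: sub_sec_eq; exact: addrA. Qed.
Fact sub_addC : commutative add.
Proof. by move=> m n; apply: sub_sec_eq; exact: addrC. Qed.
Fact sub_add0 : left_id zero add.
Proof. by move=> m; apply: sub_sec_eq; exact: add0r. Qed.
Fact sub_addN : left_inverse zero opp add.
Proof. by move=> m; apply: sub_sec_eq; exact: addNr. Qed.
HB.instance Definition _ := GRing.isZmodule.Build sub_sec sub_addA sub_addC sub_add0 sub_addN.
Fact sub_scaleA a b m : scale a (scale b m) = scale (a * b) m.
Proof. by apply: sub_sec_eq; exact: scalerA. Qed.
Fact sub_scale1 : left_id 1 scale.
Proof. by move=> m; apply: sub_sec_eq; exact: scale1r. Qed.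
Fact sub_scaleDr : right_distributive scale +%R.
Proof. by move=> a m n; apply: sub_sec_eq; exact: scalerDr. Qed.
Fact sub_scaleDl m : {morph scale^~ m : a b / a + b}.
Proof. by move=> a b; apply: sub_sec_eq; exact: scalerDl. Qed.
HB.instance Definition _ := GRing.Zmodule_isLmodule.Build (sec X U) sub_sec
  sub_scaleA sub_scale1 sub_scaleDr sub_scaleDl.
End Sections.

Definition sub_res U V (h : V `<=` U) (m : sub_sec U) : sub_sec V :=
  exist _ _ (ss_res h (svalP m)).

Definition omod_sub : omod X.
Proof.
refine (@OMod X (fun U => sub_sec U : lmodType (sec X U)) sub_res _ _ _ _).
- by move=> U V h a m n; apply: sub_sec_eq; exact: mresP.
- by move=> U h m; apply: sub_sec_eq; exact: mres_id.
- by move=> U V W h k l m; apply: sub_sec_eq; exact: mres_comp.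
- move=> U J V VU cov s ss.
  have [j k W Wj Wk|t [tP tu]] := @mres_sheaf _ M U J V VU cov (fun j => sval (s j)).
    exact: (congr1 sval (ss j k W Wj Wk)).
  have Kt : K U t.
    apply: ss_loc => x /cov [j Vx]; exists (V j), (VU j); split => //.
    by rewrite tP; exact: svalP.
  exists (exist _ t Kt); split=> [j|[u Ku] uP].
    by apply: sub_sec_eq; exact: tP.
  by apply: sub_sec_eq; apply: tu => j; rewrite -uP.
Defined.

Definition sub_incl : ohom omod_sub M.
Proof. by exists (fun U (m : sub_sec U) => sval m). Defined.

End SubsheafTheory.

Section SheafifiedSubmodule.
Variables (X : ringedSpace) (M : omod X) (P : forall U : opens X, set (msec M U)).
Hypotheses (P0 : forall U, P (0 : msec M U))
  (PP : forall U a (m n : msec M U), P m -> P n -> P (a *: m + n))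
  (Pres : forall (U V : opens X) (h : V `<=` U) (m : msec M U), P m -> P (mres M h m)).

Definition subsheaf_locally : subsheaf M.
Proof.
exists (fun U => [set n | forall x, oset U x -> exists (V : opens X) (h : V `<=` U),
  oset V x /\ P (mres M h n)]) => /=.
- by move=> U x Ux; exists U, sub_rfl; rewrite mres0.
- move=> U a m n Hm Hn x Ux.
  have [V [h [Vx HV]]] := Hm x Ux; have [W [k [Wx HW]]] := Hn x Ux.
  have Il := @opensIl _ V W; have Ir := @opensIr _ V W.
  exists (opensI V W), (Il >=> h); split=> //; rewrite mresP.
  by apply: PP; [rewrite -(mres_comp h Il) | rewrite -(mres_comp k Ir)]; exact: Pres.
- move=> U V h m Hm x Vx; have [W [k [Wx HW]]] := Hm x (h _ Vx).
  have Il := @opensIl _ V W; have Ir := @opensIr _ V W.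
  exists (opensI V W), Il; split=> //.
  by rewrite (mres_comp _ _ (Il >=> h)) -(mres_comp k Ir); exact: Pres.
- move=> U m loc x Ux; have [V [h [Vx Hm]]] := loc x Ux.
  have [W [k [Wx HW]]] := Hm x Vx.
  by exists W, (k >=> h); rewrite -(mres_comp h k).
Defined.

Lemma subsheaf_locallyW U (m : msec M U) : P m -> subsheaf_locally U m.
Proof. by move=> Pm x Ux; exists U, sub_rfl; rewrite mres_id. Qed.

End SheafifiedSubmodule.

(** * Local surjections and quotients *)

Lemma subr_telescope3 (V : zmodType) (a b c d : V) : a - b = (a - c) - (b - d) + (c - d).
Proof. by rewrite (opprB b d) [RHS]addrAC [a - c + (c - d)]addrA subrK addrA subrK. Qed.

Section LocalSurjections.
Variable X : ringedSpace.
Implicit Types (U V W : opens X) (M N P : omod X).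

Definition lsurj M N (p : ohom M N) : Prop :=
  forall U (n : msec N U) x, oset U x ->
    exists V (h : V `<=` U) (m : msec M V), oset V x /\ p V m = mres N h n.

Definition ohom_ker M N (f : ohom M N) : subsheaf M.
Proof.
exists (fun U => [set m | f U m = 0]) => /=.
- by move=> U; exact: ohom0.
- by move=> U a m n fm fn; rewrite ohom_linear fm fn scaler0 addr0.
- by move=> U V h m fm; rewrite ohom_res fm mres0.
- move=> U m loc; apply: mres_ext => x /loc [V [h [Vx e]]].
  by exists V, h; rewrite -ohom_res mres0.
Defined.

(** The value at n is glued from the f m, for m a local lift of n. It is characterised through all
    lifts of n over all smaller open sets; linearity and compatibility with restriction follow from
    this characterisation. *)
Lemma lsurj_factor M N P (p : ohom M N) (f : ohom M P) : lsurj p ->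
  (forall U m, p U m = 0 -> f U m = 0) ->
  exists g : ohom N P, forall U m, g U (p U m) = f U m.
Proof.
move=> ps pf.
have pf' U m m' : p U m = p U m' -> f U m = f U m'.
  by move=> e; apply/eqP; rewrite -subr_eq0 -ohomB; apply/eqP/pf; rewrite ohomB e subrr.
have H U (n : msec N U) : {q : msec P U | forall V (h : V `<=` U) m,
    p V m = mres N h n -> f V m = mres P h q}.
  apply: cid.
  have [||x Ux|q qP] := @mres_glue _ P U (fun V q => exists (h : V `<=` U) m,
      p V m = mres N h n /\ f V m = q).
  - move=> V W h k q [h' [m [pm fm]]]; exists (k >=> h), (mres M k m).
    by rewrite !ohom_res pm fm; split=> //; exact: mres_comp.
  - move=> V h q q' [h1 [m [pm <-]]] [h2 [m' [pm' <-]]]; apply: pf'.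
    by rewrite pm pm' (Prop_irrelevance h1 h2).
  - have [V [h [m [Vx pm]]]] := ps U n x Ux.
    by exists V, h, (f V m); split=> //; exists h, m.
  - by exists q => V h m pm; rewrite (qP V h (f V m)) //; exists h, m.
have uniq U (n : msec N U) (q q' : msec P U) :
    (forall V (h : V `<=` U) m, p V m = mres N h n -> f V m = mres P h q) ->
    (forall V (h : V `<=` U) m, p V m = mres N h n -> f V m = mres P h q') -> q = q'.
  move=> qP qP'; apply: mres_ext => x Ux; have [V [h [m [Vx pm]]]] := ps U n x Ux.
  by exists V, h; rewrite -(qP _ _ _ pm) -(qP' _ _ _ pm).
unshelve eexists.
  exists (fun U n => sval (H U n)).
  - move=> U a m n; case: (H U m) (H U n) (H U _) => [q qP] [r rP] [s sP] /=.
    apply: mres_ext => x Ux.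
    have [V [h [m1 [Vx pm1]]]] := ps U m x Ux.
    have [W [k [m2 [Wx pm2]]]] := ps V (mres N h n) x Vx.
    exists W, (k >=> h); split=> //.
    rewrite mresP -(sP W (k >=> h) (rres (k >=> h) a *: mres M k m1 + m2)).
      rewrite ohom_linear; congr (_ *: _ + _).
        by apply: qP; rewrite ohom_res pm1; exact: mres_comp.
      by apply: rP; rewrite pm2; exact: mres_comp.
    rewrite ohom_linear ohom_res pm1 pm2 mresP; congr (_ *: _ + _); exact: mres_comp.
  - move=> U V h m; case: (H U m) (H V _) => [q qP] [r rP] /=.
    apply: (uniq _ _ _ _ rP) => W k n pn.
    rewrite (mres_comp _ _ (k >=> h)) -(qP W (k >=> h) n) //.
    by rewrite pn; exact: mres_comp.
move=> U m /=; case: (H U _) => [q qP] /=.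
by have := qP U sub_rfl m; rewrite !mres_id => /(_ erefl) ->.
Qed.

Lemma lsurj_epi M N P (p : ohom M N) (f g : ohom N P) : lsurj p ->
  (forall U m, f U (p U m) = g U (p U m)) -> f = g.
Proof.
move=> ps fg; apply: ohom_eq => U n; apply: mres_ext => x Ux.
have [V [h [m [Vx pm]]]] := ps U n x Ux.
by exists V, h; rewrite -!ohom_res -pm.
Qed.

(* A section of M/K over U is a K-torsor inside M|U, given by its sections. *)
Section Quotient.
Variables (M : omod X) (K : subsheaf M).

Record torsor (U : opens X) := Torsor {
  tset :> forall V, set (msec M V);
  t_sub : forall V m, tset (m : msec M V) -> V `<=` U;
  t_res : forall V W (h : W `<=` V) m, tset m -> tset (mres M h m);
  t_diff : forall V (m m' : msec M V), tset m -> tset m' -> K V (m - m');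
  t_ex : forall x, oset U x -> exists V (m : msec M V), oset V x /\ tset m;
  t_loc : forall V (m : msec M V), V `<=` U -> (forall x, oset V x ->
    exists W (h : W `<=` V), oset W x /\
      exists m0, tset m0 /\ K W (mres M h m - m0)) -> tset m }.

(** By [t_loc] a torsor contains every section that differs locally from one of its own by a section
    of K, so one common section near each point forces equality. The module axioms of the quotient
    are checked on such a section. *)
Lemma torsor_eq U (S T : torsor U) :
  (forall x, oset U x -> exists V m, [/\ oset V x, S V m & T V m]) -> S = T.
Proof.
move=> H.
suff sub : forall S T : torsor U, (forall x, oset U x ->
    exists V m, [/\ oset V x, S V m & T V m]) -> forall V m, S V m -> T V m.
  have : tset S = tset T.
    apply: functional_extensionality_dep => V; apply/seteqP; split=> m; apply: sub => // x Ux.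
    by have [W [n [Wx Sn Tn]]] := H x Ux; exists W, n.
  case: S T {H} => [S S1 S2 S3 S4 S5] [T T1 T2 T3 T4 T5] /= ST; subst T.
  by congr Torsor; exact: Prop_irrelevance.
move=> {H}S {}T H V m Sm; have VU := t_sub Sm.
apply: t_loc => // x Vx; have [W [n [Wx Sn Tn]]] := H x (VU _ Vx).
exists (opensI V W), (@opensIl _ V W); split=> //.
exists (mres M (@opensIr _ V W) n); split; first exact: t_res.
by apply: (t_diff (t:=S)); exact: t_res.
Qed.

(** A family P of sections that is coherent modulo K is saturated to a torsor: T consists of the
    sections that differ locally from P by K. Sums, multiples, classes, restrictions and gluings of
    torsors are all obtained in this way. *)
Lemma torsor_glue U (P : forall V, set (msec M V)) :
  (forall V m, P V m -> V `<=` U) ->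
  (forall V W (k : W `<=` V) m, P V m -> P W (mres M k m)) ->
  (forall V (m m' : msec M V), P V m -> P V m' -> K V (m - m')) ->
  (forall x, oset U x -> exists V m, oset V x /\ P V m) ->
  {T : torsor U | forall V m, P V m -> T V m}.
Proof.
move=> PU Pres Pdiff Pex.
pose T V (m : msec M V) := V `<=` U /\ forall x, oset V x ->
    exists W (h : W `<=` V), oset W x /\ exists m0, P W m0 /\ K W (mres M h m - m0).
have PT V m : P V m -> T V m.
  move=> Pm; split; first exact: PU Pm.
  move=> x Vx; exists V, sub_rfl; split=> //; exists m; split=> //.
  by rewrite mres_id subrr; exact: ss0.
have Tres V W (h : W `<=` V) m : T V m -> T W (mres M h m).
  move=> [VU loc]; split; first exact: subset_trans VU.
  move=> x Wx; have [S [k [Sx [m0 [Pm0 Km]]]]] := loc x (h _ Wx).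
  exists (opensI W S), (@opensIl _ W S); split=> //.
  exists (mres M (@opensIr _ W S) m0); split; first exact: Pres.
  rewrite (mres_comp _ _ ((@opensIr _ W S) >=> k)).
  rewrite -(mres_comp k (@opensIr _ W S)) -mresB; exact: ss_res.
have Tdiff V (m m' : msec M V) : T V m -> T V m' -> K V (m - m').
  move=> [VU loc] [_ loc']; apply: ss_loc => x Vx.
  have [S [k [Sx [m0 [Pm0 Km]]]]] := loc x Vx.
  have [S' [k' [Sx' [m0' [Pm0' Km']]]]] := loc' x Vx.
  pose I := opensI S S'; have Il : I `<=` S := @opensIl _ S S'.
  have Ir : I `<=` S' := @opensIr _ S S'.
  exists I, (Il >=> k); split=> //; rewrite mresB.
  rewrite -{1}(mres_comp k Il) -(mres_comp k' Ir).
  have -> : mres M Il (mres M k m) - mres M Ir (mres M k' m') =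
     mres M Il (mres M k m - m0) - mres M Ir (mres M k' m' - m0')
     + (mres M Il m0 - mres M Ir m0').
    by rewrite !mresB; exact: subr_telescope3.
  apply: ssD; first by apply: ssB; exact: ss_res.
  by apply: Pdiff; exact: Pres.
unshelve eexists.
  exists T => //.
  - by move=> V m [].
  - move=> x /Pex [V [m [Vx Pm]]]; exists V, m; split=> //; exact: PT.
  - move=> V m VU loc; split=> // x Vx; have [W [h [Wx [m0 [[_ Tm0] Km]]]]] := loc x Vx.
    have [S [k [Sx [m1 [Pm1 Km1]]]]] := Tm0 x Wx.
    exists S, (k >=> h); split=> //; exists m1; split=> //.
    rewrite -(subrK (mres M k m0) (mres M _ m)) -addrA; apply: ssD => //.
    by rewrite -(mres_comp h k) -mresB; exact: ss_res.
by move=> V m /=; exact: PT.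
Qed.

Lemma t_common U (S T : torsor U) x : oset U x ->
  exists V (m n : msec M V), [/\ oset V x, S V m & T V n].
Proof.
move=> Ux; have [V [m [Vx Sm]]] := t_ex S Ux; have [W [n [Wx Tn]]] := t_ex T Ux.
exists (opensI V W), (mres M (@opensIl _ V W) m), (mres M (@opensIr _ V W) n).
by split=> //; exact: t_res.
Qed.

Lemma t_common3 U (R S T : torsor U) x : oset U x ->
  exists V (l m n : msec M V), [/\ oset V x, R V l, S V m & T V n].
Proof.
move=> Ux; have [V [m [n [Vx Sm Tn]]]] := t_common S T Ux; have [W [l [Wx Rl]]] := t_ex R Ux.
exists (opensI V W), (mres M (@opensIr _ V W) l), (mres M (@opensIl _ V W) m),
  (mres M (@opensIl _ V W) n).
by split=> //; exact: t_res.
Qed.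

Lemma torsor_add_ex U (S T : torsor U) :
  {R : torsor U | forall V m n, S V m -> T V n -> R V (m + n)}.
Proof.
have [||||R RP] := @torsor_glue U (fun V m => exists a b, [/\ S V a, T V b & m = a + b]).
- by move=> V m [a [b [/t_sub]]].
- move=> V W k m [a [b [Sa Tb ->]]]; exists (mres M k a), (mres M k b).
  by split; [exact: t_res | exact: t_res | exact: mresD].
- move=> V m m' [a [b [Sa Tb ->]]] [a' [b' [Sa' Tb' ->]]].
  rewrite opprD addrACA; apply: ssD; [exact: (t_diff (t:=S)) | exact: (t_diff (t:=T))].
- move=> x /(t_common S T) [V [m [n [Vx Sm Tn]]]]; exists V, (m + n); split=> //.
  by exists m, n.
by exists R => V m n Sm Tn; apply: RP; exists m, n.
Qed.

Lemma torsor_class_ex U (m : msec M U) :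
  {T : torsor U | forall V (h : V `<=` U) k, K V k -> T V (mres M h m + k)}.
Proof.
have [||||R RP] := @torsor_glue U (fun V n => exists (h : V `<=` U) k, K V k /\ n = mres M h m + k).
- by move=> V n [].
- move=> V W h n [l [k [Kk ->]]]; exists (h >=> l), (mres M h k).
  rewrite mresD; split; first exact: ss_res.
  by congr (_ + _); exact: mres_comp.
- move=> V n n' [h [k [Kk ->]]] [h' [k' [Kk' ->]]].
  rewrite (Prop_irrelevance h h') opprD addrACA subrr add0r; exact: ssB.
- move=> x Ux; exists U, m; split=> //; exists sub_rfl, 0.
  by split; [exact: ss0 | rewrite addr0 mres_id].
by exists R => V h k Kk; apply: RP; exists h, k.
Qed.

Lemma torsor_scale_ex U (a : sec X U) (S : torsor U) :
  {R : torsor U | forall V m (h : V `<=` U), S V m -> R V (rres h a *: m)}.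
Proof.
have [||||R RP] := @torsor_glue U (fun V m => exists (h : V `<=` U) b,
  S V b /\ m = rres h a *: b).
- by move=> V m [].
- move=> V W k m [h [b [Sb ->]]]; exists (k >=> h), (mres M k b).
  by rewrite mresZ (rres_comp _ _ (k >=> h)); split => //; exact: t_res.
- move=> V m m' [h [b [Sb ->]]] [h' [b' [Sb' ->]]].
  by rewrite (Prop_irrelevance h h') -scalerBr; apply: ssZ; exact: (t_diff (t:=S)).
- move=> x /(t_ex S) [V [m [Vx Sm]]]; exists V, (rres (t_sub Sm) a *: m); split=> //.
  by exists (t_sub Sm), m.
by exists R => V m h Sm; apply: RP; exists h, m.
Qed.

Lemma torsor_res_ex U V (h : V `<=` U) (S : torsor U) :
  {R : torsor V | forall W m (k : W `<=` V), S W m -> R W m}.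
Proof.
have [||||R RP] := @torsor_glue V (fun W m => W `<=` V /\ S W m).
- by move=> W m [].
- by move=> W W' k m [WV Sm]; split; [exact: subset_trans WV | exact: t_res].
- by move=> W m m' [_ Sm] [_ Sm']; exact: (t_diff (t:=S)).
- move=> x Vx; have [W [m [Wx Sm]]] := t_ex S (h _ Vx).
  exists (opensI V W), (mres M (@opensIr _ V W) m); do !split=> //; first exact: opensIl.
  exact: t_res.
by exists R => W m k Sm; apply: RP.
Qed.

Section Sections.
Variable U : opens X.
HB.instance Definition _ := gen_eqMixin (torsor U).
HB.instance Definition _ := gen_choiceMixin (torsor U).
Definition t_class m := sval (@torsor_class_ex U m).
Definition t_zero := t_class 0.
Definition t_add S T := sval (@torsor_add_ex U S T).
Definition t_scale a S := sval (@torsor_scale_ex U a S).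
Definition t_opp := t_scale (- 1).

Lemma t_classP V (h : V `<=` U) m k : K V k -> t_class m V (mres M h m + k).
Proof. exact: (svalP (torsor_class_ex m)). Qed.
Lemma t_class_res V (h : V `<=` U) m : t_class m V (mres M h m).
Proof. by rewrite -[mres _ _ _]addr0; apply: t_classP; exact: ss0. Qed.
Lemma t_class_self m : t_class m U m.
Proof. by have := t_class_res (@subset_refl _ U) m; rewrite mres_id. Qed.
Lemma t_addP (S T : torsor U) V m n : S V m -> T V n -> t_add S T V (m + n).
Proof. exact: (svalP (torsor_add_ex S T)). Qed.
Lemma t_scaleP a (S : torsor U) V m (h : V `<=` U) : S V m -> t_scale a S V (rres h a *: m).
Proof. exact: (svalP (torsor_scale_ex a S)). Qed.
Lemma t_zeroP V k : V `<=` U -> K V k -> t_zero V k.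
Proof. by move=> h Kk; have := t_classP h 0 Kk; rewrite mres0 add0r. Qed.

Fact t_addA : associative t_add.
Proof.
move=> R S T; apply: torsor_eq => x /(t_common3 R S T) [V [l [m [n [Vx Rl Sm Tn]]]]].
exists V, (l + (m + n)); split=> //; first by do !apply: t_addP.
by rewrite addrA; do !apply: t_addP.
Qed.
Fact t_addC : commutative t_add.
Proof.
move=> S T; apply: torsor_eq => x /(t_common S T) [V [m [n [Vx Sm Tn]]]].
by exists V, (m + n); split=> //; [|rewrite addrC]; apply: t_addP.
Qed.
Fact t_add0 : left_id t_zero t_add.
Proof.
move=> S; apply: torsor_eq => x /(t_ex S) [V [m [Vx Sm]]]; exists V, m; split=> //.
rewrite -[m]add0r; apply: t_addP => //; apply: t_zeroP; [exact: t_sub Sm | exact: ss0].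
Qed.
Fact t_addN : left_inverse t_zero t_opp t_add.
Proof.
move=> S; apply: torsor_eq => x /(t_ex S) [V [m [Vx Sm]]].
have VU := t_sub Sm; exists V, 0; split=> //; last by apply: t_zeroP => //; exact: ss0.
rewrite -(addNr m); apply: t_addP => //.
by have := t_scaleP (-1) VU Sm; rewrite rmorphN1 scaleN1r.
Qed.
HB.instance Definition _ := GRing.isZmodule.Build (torsor U) t_addA t_addC t_add0 t_addN.
Fact t_scaleA a b S : t_scale a (t_scale b S) = t_scale (a * b) S.
Proof.
apply: torsor_eq => x /(t_ex S) [V [m [Vx Sm]]]; have h := t_sub Sm.
exists V, (rres h a *: (rres h b *: m)); split=> //; first by do !apply: t_scaleP.
by rewrite scalerA -rmorphM; apply: t_scaleP.
Qed.
Fact t_scale1 : left_id 1 t_scale.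
Proof.
move=> S; apply: torsor_eq => x /(t_ex S) [V [m [Vx Sm]]]; exists V, m; split=> //.
by have := t_scaleP 1 (t_sub Sm) Sm; rewrite rmorph1 scale1r.
Qed.
Fact t_scaleDr : right_distributive t_scale +%R.
Proof.
move=> a S T; apply: torsor_eq => x /(t_common S T) [V [m [n [Vx Sm Tn]]]].
have h := t_sub Sm; exists V, (rres h a *: (m + n)); split=> //.
  by apply: t_scaleP; exact: t_addP.
by rewrite scalerDr; apply: t_addP; exact: t_scaleP.
Qed.
Fact t_scaleDl S : {morph t_scale^~ S : a b / a + b}.
Proof.
move=> a b; apply: torsor_eq => x /(t_ex S) [V [m [Vx Sm]]]; have h := t_sub Sm.
exists V, (rres h (a + b) *: m); split=> //; first exact: t_scaleP.
by rewrite rmorphD scalerDl; apply: t_addP; exact: t_scaleP.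
Qed.
HB.instance Definition _ := GRing.Zmodule_isLmodule.Build (sec X U) (torsor U)
  t_scaleA t_scale1 t_scaleDr t_scaleDl.
End Sections.

Definition t_restr U V (h : V `<=` U) (S : torsor U) : torsor V := sval (torsor_res_ex h S).
Lemma t_restrP U V (h : V `<=` U) (S : torsor U) W m : W `<=` V -> S W m -> t_restr h S W m.
Proof. by move=> k Sm; exact: (svalP (torsor_res_ex h S)). Qed.

Lemma t_ex_in U (S : torsor U) V x : oset U x -> oset V x -> exists W m,
  [/\ oset W x, W `<=` V & S W m].
Proof.
move=> Ux Vx; have [W [m [Wx Sm]]] := t_ex S Ux.
by exists (opensI V W), (mres M (@opensIr _ V W) m); split=> //;
  [exact: opensIl | exact: t_res].
Qed.

Definition omod_quot : omod X.
Proof.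
refine (@OMod X (fun U => torsor U : lmodType (sec X U)) t_restr _ _ _ _).
- move=> U V h a S T; apply: torsor_eq => x Vx.
  have [W [m [Wx WV Sm]]] := t_ex_in S (h _ Vx) Vx.
  have [W' [n [Wx' WW Sn]]] := t_ex_in T (h _ Vx) Wx.
  have k := subset_trans WW WV.
  exists W', (rres k (rres h a) *: mres M WW m + n); split=> //.
    apply: t_restrP => //; apply: t_addP => //.
    by rewrite (rres_comp _ _ (k >=> h)); apply: t_scaleP; exact: t_res.
  apply: t_addP; last exact: t_restrP.
  by apply: t_scaleP; apply: t_restrP => //; exact: t_res.
- move=> U h S; apply: torsor_eq => x /(t_ex S) [V [m [Vx Sm]]]; exists V, m; split=> //.
  by apply: t_restrP => //; exact: t_sub Sm.
- move=> U V W h k l S; apply: torsor_eq => x Wx.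
  have [W' [m [Wx' WW Sm]]] := t_ex_in S (l _ Wx) Wx.
  exists W', m; split=> //; last exact: t_restrP.
  by apply: t_restrP => //; apply: t_restrP => //; exact: subset_trans k.
- move=> U I V VU cov s ss.
  have [||||T TP] := @torsor_glue U (fun W m => exists i, s i W m).
  + by move=> W m [i /t_sub]; move/subset_trans; apply.
  + by move=> W W' k m [i sm]; exists i; exact: t_res.
  + move=> W m m' [i sm] [j sm'].
    have Wi := t_sub sm; have Wj := t_sub sm'.
    apply: (t_diff (t := t_restr Wi (s i))); first exact: t_restrP.
    by rewrite (ss i j W Wi Wj); exact: t_restrP.
  + by move=> x /cov [i /(t_ex (s i)) [W [m [Wx sm]]]]; exists W, m; split=> //; exists i.
  exists T; split=> [i|T' T'P].
    apply: torsor_eq => x /(t_ex (s i)) [W [m [Wx sm]]]; exists W, m; split=> //.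
    by apply: t_restrP; [exact: t_sub sm | apply: TP; exists i].
  apply: torsor_eq => x /cov [i Vx].
  have [W [m [Wx WV T'm]]] := t_ex_in T' (VU i _ Vx) Vx.
  exists W, m; split=> //; apply: TP; exists i; rewrite -(T'P i); exact: t_restrP.
Defined.

Definition quot_proj : ohom M omod_quot.
Proof.
exists (fun U m => t_class m : msec omod_quot U).
- move=> U a m n; apply: torsor_eq => x Ux; exists U, (a *: m + n); split=> //.
    exact: t_class_self.
  apply: t_addP.
    have := @t_scaleP U a (t_class m) U m (@subset_refl _ U); rewrite rres_id; apply.
    exact: t_class_self.
  exact: t_class_self.
- move=> U V h m; apply: torsor_eq => x Vx; exists V, (mres M h m); split=> //.
    exact: t_class_self.
  by apply: t_restrP => //; exact: t_class_res.
Defined.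

Lemma quot_proj_lsurj : lsurj quot_proj.
Proof.
move=> U S x Ux; have [V [m [Vx Sm]]] := t_ex S Ux.
exists V, (t_sub Sm), m; split=> //; apply: torsor_eq => y Vy; exists V, m; split=> //.
  exact: t_class_self.
exact: t_restrP.
Qed.

Lemma quot_proj_eq0 U m : quot_proj U m = 0 <-> K U m.
Proof.
split=> [e|Km].
  have z : t_zero U U 0 by apply: t_zeroP => //; exact: ss0.
  have c : t_zero U U m.
    rewrite -[t_zero U]e /=.
    exact: t_class_self.
  by have := t_diff c z; rewrite subr0.
apply: torsor_eq => x Ux; exists U, m; split=> //; last exact: t_zeroP.
exact: t_class_self.
Qed.

End Quotient.
End LocalSurjections.
Arguments lsurj {X M N} p.

(** * Basic open sets and affine charts *)

Section Units.
Variable A : comPzRingType.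
Implicit Types a b : A.

Lemma is_unit1 : is_unit (1 : A).
Proof. by exists 1; rewrite mulr1. Qed.
Lemma is_unitM a b : is_unit a -> is_unit b -> is_unit (a * b).
Proof. by move=> [c ac] [d bd]; exists (c * d); rewrite mulrACA ac bd mulr1. Qed.
Lemma is_unitX a n : is_unit a -> is_unit (a ^+ n).
Proof.
move=> ua; elim: n => [|n IH]; first by rewrite expr0; exact: is_unit1.
by rewrite exprS; exact: is_unitM.
Qed.
Lemma is_unitMl a b : is_unit (a * b) -> is_unit a.
Proof. by move=> [c abc]; exists (b * c); rewrite mulrA. Qed.
Lemma is_unitMr a b : is_unit (a * b) -> is_unit b.
Proof. by rewrite mulrC; exact: is_unitMl. Qed.
Lemma is_unit_inj (M : lmodType A) a (m n : M) : is_unit a -> a *: m = a *: n -> m = n.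
Proof.
move=> [b ab] e; rewrite -[m]scale1r -[n]scale1r -ab mulrC -!scalerA e; by [].
Qed.
Lemma is_unit_mulI a b c : is_unit a -> a * b = a * c -> b = c.
Proof. exact: (@is_unit_inj A^o). Qed.
Lemma is_unit_eq0 (M : lmodType A) a (m : M) : is_unit a -> a *: m = 0 -> m = 0.
Proof. by move=> ua am; apply: (is_unit_inj ua); rewrite am scaler0. Qed.
End Units.

Lemma is_unit_morph (A B : comPzRingType) (f : {rmorphism A -> B}) a : is_unit a -> is_unit (f a).
Proof. by move=> [b ab]; exists (f b); rewrite -rmorphM ab rmorph1. Qed.

Lemma idealX1 (A : comPzRingType) (p : spec A) a n : prime_set p (a ^+ n) -> prime_set p a.
Proof.
elim: n => [|n IH]; first by rewrite expr0 => /(@prime_proper _ p).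
by rewrite exprS => /(@prime_mul _ p) [].
Qed.

(** An ideal that is maximal among those containing J and missing all powers of [a] is prime; it
    exists by Zorn's lemma. *)
Lemma prime_avoiding (A : comPzRingType) (J : set A) a : is_ideal J ->
  (forall n, ~ J (a ^+ n)) -> exists p : spec A, J `<=` p /\ ~ prime_set p a.
Proof.
move=> iJ Ja.
pose P (K : set A) := [/\ is_ideal K, J `<=` K & forall n, ~ K (a ^+ n)].
(* The empty chain has union [set0], which is not an ideal; hence the extra alternative. A maximal K
   cannot be empty, as J would be strictly larger. *)
have [F FP tot|K [[K0|PK] Kmax]] := @Zorn_bigcup A (fun K => K = set0 \/ P K).
- have [[K [FK [x Kx]]]|none] := pselect (exists K, F K /\ exists x, K x); last first.
    left; rewrite -subset0 => x [K FK Kx]; apply: none; exists K; split=> //; by exists x.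
  right.
  have FP' L y : F L -> L y -> P L by move=> /FP [->|//] [].
  have [iK JK Ka] := FP' K x FK Kx.
  split=> [|y Jy|n [L FL La]].
  + split=> [|y z [L FL Ly] [L' FL' Lz]|y z [L FL Lz]].
    * exists K => //; exact: ideal0.
    * have [s|s] := tot _ _ FL FL'.
        by exists L' => //; apply: idealD; [case: (FP' L' z) | exact: s |].
      by exists L => //; apply: idealD; [case: (FP' L y) | | exact: s].
    * by exists L => //; apply: idealM => //; case: (FP' L z).
  + by exists K => //; exact: JK.
  + by have [_ _ /(_ n)] := FP' L _ FL La; exact.
- have [] := Kmax J _ (or_intror (And3 iJ (@subset_refl _ J) Ja)).
  by rewrite K0; split; [move=> x [] | move=> /(_ 0); apply; exact: ideal0].
have [iK JK Ka] := PK.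
(* By maximality the ideal K + (b), for b outside K, contains a power of [a]. *)
have ext b : ~ K b -> exists n c, K (a ^+ n - c * b).
  move=> nKb; apply: contrapT => nex.
  pose L : set A := [set x | exists2 k, K k & exists c, x = k + c * b].
  apply: (Kmax L).
    split=> [x Kx|]; first by exists x => //; exists 0; rewrite mul0r addr0.
    by move=> /(_ b) LK; apply: nKb; apply: LK; exists 0; [exact: ideal0|exists 1; rewrite mul1r add0r].
  right; split.
  - split; first by exists 0; [exact: ideal0|exists 0; rewrite mul0r addr0].
      move=> x y [k Kk [c ->]] [l Kl [d ->]]; exists (k + l); first exact: idealD.
      by exists (c + d); rewrite mulrDl addrACA.
    move=> x y [k Kk [c ->]]; exists (x * k); first exact: idealM.
    by exists (x * c); rewrite mulrDr mulrA.
  - by move=> x /JK Kx; exists x => //; exists 0; rewrite mul0r addr0.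
  - move=> n [k Kk [c e]]; apply: nex; exists n, c; by rewrite e addrK.
have pK1 : ~ K 1 by move=> /(Ka 0).
have pKM b c : K (b * c) -> K b \/ K c.
  move=> Kbc; apply: contrapT => /not_orP [/ext [n [d Kn]] /ext [m [e Km]]].
  apply: (Ka (n + m)%N); rewrite exprD.
  rewrite -[a ^+ n](subrK (d * b)) mulrDl; apply: (idealD iK).
    by rewrite mulrC; apply: idealM.
  rewrite -[a ^+ m](subrK (e * c)) mulrDr; apply: (idealD iK); first exact: idealM.
  by rewrite mulrACA; apply: idealM.
by exists (Spec iK pK1 pKM); split=> //= Kpa; apply: (Ka 1); rewrite expr1.
Qed.

Section NonZero.
Variable X : ringedSpace.
Implicit Types (U V W : opens X) (M N : omod X).

Lemma nz_is_open U (a : sec X U) : open [set x | germ_unit a x].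
Proof.
have -> : [set x | germ_unit a x] = \bigcup_(V in [set V : opens X |
    exists h : V `<=` U, is_unit (rres h a)]) oset V.
  apply/seteqP; split=> x /=; first by move=> [V [h [Vx u]]]; exists V => //; exists h.
  by move=> [V [h u] Vx]; exists V, h.
by apply: bigcup_open => V _; exact: oset_open.
Qed.

(** The locus where [a] is invertible. On a chart it is the basic open set D(a) ([nz_chart]), but it
    makes sense over any open set of a ringed space. *)
Definition nz U (a : sec X U) : opens X := Opens (nz_is_open a).

Lemma nzS U (a : sec X U) : nz a `<=` U.
Proof. by move=> x [V [h [Vx _]]]; exact: (h _ Vx). Qed.

(** Local inverses are unique, hence they glue. *)
Lemma unit_nz U (a : sec X U) V (h : V `<=` U) : V `<=` nz a -> is_unit (rres h a).
Proof.
move=> Va.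
have [||x Vx|b bP] := sheaf_glue (@rres_comp X) (@rres_sheaf X) (U := V) (P := fun W b =>
    exists k : W `<=` U, rres k a * b = 1).
- move=> W W' k l b [k' e]; exists (l >=> k').
  by rewrite -(rres_comp k' l) -rmorphM e rmorph1.
- move=> W k b b' [l e] [l' e'].
  rewrite (Prop_irrelevance l' l) in e'.
  by rewrite -[b]mul1r -e' mulrC mulrA [b * _]mulrC e mul1r.
- have [W [k [Wx [b e]]]] := Va x Vx.
  exists (opensI V W), (@opensIl _ V W), (rres (@opensIr _ V W) b); split=> //.
  by exists ((@opensIr _ V W) >=> k); rewrite -(rres_comp k (@opensIr _ V W)) -rmorphM e rmorph1.
exists b; apply: rres_ext => x Vx.
have [W [k [Wx [b' e]]]] := Va x Vx.
exists (opensI V W), (@opensIl _ V W); split=> //.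
rewrite rmorphM rmorph1 (bP _ _ (rres (@opensIr _ V W) b')).
  by rewrite (rres_comp _ _ ((@opensIr _ V W) >=> k)) -(rres_comp k (@opensIr _ V W)) -rmorphM e rmorph1.
by exists ((@opensIr _ V W) >=> k); rewrite -(rres_comp k (@opensIr _ V W)) -rmorphM e rmorph1.
Qed.

Lemma unit_nzS U (a : sec X U) : is_unit (rres (nzS (a := a)) a).
Proof. exact: unit_nz. Qed.

Lemma nz_res U V (h : V `<=` U) (a : sec X U) : nz (rres h a) = opensI V (nz a).
Proof.
apply: opens_eq; apply/seteqP; split=> x /=.
  move=> [W [k [Wx u]]]; split; first exact: (k _ Wx).
  exists W, (k >=> h); split=> //.
  by rewrite -(rres_comp h k).
move=> [Vx [W [k [Wx u]]]]; exists (opensI V W), (@opensIl _ V W); split=> //.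
rewrite (rres_comp _ _ ((@opensIr _ V W) >=> k)) -(rres_comp k (@opensIr _ V W)).
exact: is_unit_morph.
Qed.

Lemma nzM U (a b : sec X U) : nz (a * b) = opensI (nz a) (nz b).
Proof.
apply: opens_eq; apply/seteqP; split=> x /=.
  move=> [W [k [Wx]]]; rewrite rmorphM => u.
  split; exists W, k; split=> //; [exact: is_unitMl u | exact: is_unitMr u].
move=> [[V [h [Vx u]]] [W [k [Wx v]]]].
exists (opensI V W), ((@opensIl _ V W) >=> h); split=> //.
rewrite rmorphM; apply: is_unitM; first by rewrite -(rres_comp h (@opensIl _ V W)); exact: is_unit_morph.
by rewrite -(rres_comp k (@opensIr _ V W)); exact: is_unit_morph.
Qed.

Lemma nz1 U : nz (1 : sec X U) = U.
Proof.
apply: opens_eq; apply/seteqP; split=> x; first exact: nzS.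
by move=> Ux; exists U, sub_rfl; split=> //; rewrite rmorph1; exact: is_unit1.
Qed.

Lemma nzX U (a : sec X U) n : (0 < n)%N -> nz (a ^+ n) = nz a.
Proof.
case: n => // n _; elim: n => [|n IH]; first by rewrite expr1.
by rewrite exprS nzM IH; apply: opens_eq; rewrite /= setIid.
Qed.

Lemma nzX_sub U (a : sec X U) n : nz a `<=` nz (a ^+ n).
Proof. by case: n => [|n]; [rewrite expr0 nz1; exact: nzS | rewrite nzX]. Qed.

(* M(nz a) is the localization of M(U) at a. *)
Definition good M U : Prop := forall (a : sec X U) V (h : V `<=` U), oset V = nz a ->
  (forall m : msec M V, exists (m0 : msec M U) n, rres h a ^+ n *: m = mres M h m0) /\
  (forall m0 : msec M U, mres M h m0 = 0 -> exists n, a ^+ n *: m0 = 0).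

Lemma good_lift M U (gM : good M U) (a : sec X U) V (h : V `<=` U) (m : msec M V) : oset V = nz a ->
  exists (m0 : msec M U) n, rres h a ^+ n *: m = mres M h m0.
Proof. by move=> /(gM a V h) [+ _]; exact. Qed.

Lemma good_tors M U (gM : good M U) (a : sec X U) V (h : V `<=` U) (m : msec M U) : oset V = nz a ->
  mres M h m = 0 -> exists n, a ^+ n *: m = 0.
Proof. by move=> /(gM a V h) [_ +]; exact. Qed.

(* What is used of an affine open set, in terms of the ring O(U) alone. *)
Record aff U : Prop := Aff {
  aff_basis : forall V x, oset V x -> oset U x -> exists a : sec X U, oset (nz a) x /\ nz a `<=` V;
  aff_good : good (omod_str X) U;
  aff_ideal : forall (J : set (sec X U)) a, is_ideal J ->
    (forall x, oset (nz a) x -> exists2 b, J b & oset (nz b) x) -> exists n, J (a ^+ n) }.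

(** Localization in stages: up to a power of the unit [a], a function b on D(a) is the restriction
    of a function b0 on U. Therefore D(b) = D(a * b0) is a basic open set of U, where the hypothesis
    on M applies. *)
Lemma good_sub M U (a : sec X U) : good (omod_str X) U -> good M U -> good M (nz a).
Proof.
move=> gO gM b V h eV.
have nzaU : nz a `<=` U := @nzS _ a.
have VU := subset_trans h nzaU.
have ua : is_unit (rres nzaU a) by exact: unit_nz.
have [b0 [k eb]] : exists (b0 : sec X U) k, rres nzaU a ^+ k * b = rres nzaU b0.
  by have [b0 [k e]] := good_lift gO nzaU b erefl; exists b0, k.
have eab : oset V = nz (a * b0).
  rewrite nzM eV; apply/seteqP; split=> x /=.
    move=> bx; have ax := nzS bx; split=> //.
    have : oset (nz (rres nzaU b0)) x.
      rewrite -eb nzM; split=> //; apply: nzX_sub; by rewrite nz_res.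
    by rewrite nz_res => -[].
  move=> [ax b0x].
  have : oset (nz (rres nzaU a ^+ k * b)) x by rewrite eb nz_res.
  by rewrite nzM => -[].
split=> [m|m0 m00].
  have [m0 [n e]] := good_lift gM VU m eab.
  (* As b0 restricts to a^k * b, the power (a * b0)^n restricts to a^(n + k * n) * b^n; the first
     factor is a unit on D(a) and is divided out. *)
  have [c ac] : is_unit (rres nzaU a ^+ (n + k * n)) by exact: is_unitX.
  exists (c *: mres M nzaU m0), n; rewrite mresZ (mres_comp _ _ VU) -e.
  have -> : rres VU (a * b0) ^+ n = rres h (rres nzaU a ^+ (n + k * n)) * rres h b ^+ n.
    have E : rres nzaU (a * b0) ^+ n = rres nzaU a ^+ (n + k * n) * b ^+ n.
      by rewrite rmorphM -eb !exprMn exprD exprM mulrA.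
    rewrite -(rres_comp nzaU h) -rmorphXn E rmorphM; congr (_ * _); exact: rmorphXn.
  by rewrite scalerA mulrA -rmorphM [c * _]mulrC ac rmorph1 mul1r.
have [m1 [j e]] := good_lift gM nzaU m0 erefl.
have : mres M VU m1 = 0.
  by rewrite -(mres_comp nzaU h VU) -e mresZ m00 scaler0.
move=> /(good_tors gM eab) [n /(congr1 (mres M nzaU))]; rewrite mres0 mresZ -e => z.
exists n.
have u : is_unit (rres nzaU a ^+ (n + k * n) * rres nzaU a ^+ j).
  by apply: is_unitM; exact: is_unitX.
apply: (is_unit_eq0 u); rewrite -z !scalerA; congr (_ *: _).
by rewrite rmorphXn rmorphM -eb !exprMn exprD exprM mulrAC mulrA.
Qed.

End NonZero.
Arguments nz {X U} a.
Arguments nzS {X U} a.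

Section Charts.
Variables (X : ringedSpace) (c : affine_chart X).
Local Notation A := (chart_ring c).
Local Notation U := (chart_open c).
Local Notation phi := (chart_hom c).
Local Notation cm := (@chart_map X c).

Lemma basic_open_is_open (f : A) : open (basic_open f).
Proof.
exists [set f]; apply/seteqP; split=> p /= np; first by move=> fp; apply: np; exact: fp.
by move=> pf; apply: np => _ ->.
Qed.

Lemma spec_basis (p : spec A) (V : set (spec A)) : open V -> V p ->
  exists f, ~ prime_set p f /\ basic_open f `<=` V.
Proof.
move=> [E ->] /= nEp.
have [f [Ef npf]] : exists f, E f /\ ~ prime_set p f.
  apply: contrapT => ne; apply: nEp => f Ef; apply: contrapT => npf; apply: ne; by exists f.
by exists f; split=> // q nqf Eq; apply: nqf; exact: Eq.
Qed.

Definition chart_basic f : opens X := Opens (chart_open_map (basic_open_is_open f)).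

Lemma chart_basicS f : chart_basic f `<=` U.
Proof. by rewrite -chart_range => _ [p _ <-]; exists p. Qed.

Lemma chart_pt x : oset U x -> exists p, cm p = x.
Proof. by rewrite -chart_range => -[p _ <-]; exists p. Qed.

Lemma chart_inU p : oset U (cm p).
Proof. by rewrite -chart_range; exists p. Qed.

Lemma chart_basis x (V : opens X) : oset U x -> oset V x ->
  exists f, oset (chart_basic f) x /\ chart_basic f `<=` V.
Proof.
move=> Ux Vx; have [p e] := chart_pt Ux; subst x.
have oV : open (cm @^-1` V) by apply: preimage_is_open; exact: chart_continuous.
have [f [npf fV]] := spec_basis oV Vx.
by exists f; split=> [|_ [q nqf <-]]; [exists p | exact: fV].
Qed.

(** If f is invertible near the point of p, choose D(g) inside that neighbourhood. There f * b0 =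
    g^n for some b0, and in A this holds after multiplication by a power of g. So f in p would put g
    in p. *)
Lemma chart_germ f p : germ_unit (phi f) (cm p) <-> ~ prime_set p f.
Proof.
split=> [[V [h [Vx [b e]]]] pf|npf]; last first.
  exists (chart_basic f), (@chart_basicS f); split; first by exists p.
  by have [] := chart_localization (f := f) (@chart_basicS f) erefl.
have [g [[q nqg qp] gV]] := chart_basis (chart_inU p) Vx.
have npg : ~ prime_set p g by rewrite -(chart_inj qp).
have [ug lift tors] := chart_localization (f := g) (@chart_basicS g) erefl.
have [b0 [n eb]] := lift (rres gV b).
have /tors [m] : rres (@chart_basicS g) (phi (f * b0 - g ^+ n)) = 0.
  rewrite (rmorphB phi) (rmorphM phi) (rmorphXn phi).
  rewrite (rmorphB (rres _)) (rmorphM (rres _)) (rmorphXn (rres _)) -eb.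
  by rewrite mulrCA -[rres _ (phi f)](rres_comp h gV) -rmorphM e rmorph1 mulr1 subrr.
rewrite mulrBr -exprD => /eqP; rewrite subr_eq0 => /eqP e'.
apply: npg; apply: (@idealX1 _ p _ (m + n)); rewrite -e' mulrA mulrAC.
exact: (idealM (prime_is_ideal p)).
Qed.

Lemma nz_chart f : nz (phi f) = chart_basic f.
Proof.
apply: opens_eq; apply/seteqP; split=> x /=.
  move=> fx; have [p e] := chart_pt (nzS _ _ fx); subst x.
  by exists p => //; apply/chart_germ.
by move=> [p npf <-]; apply/chart_germ.
Qed.

(** The localization property at f = 1, as D(1) is the whole chart. *)
Lemma chart_homE (a : sec X U) : exists f, a = phi f.
Proof.
have e : oset U = cm @` basic_open (1 : A).
  rewrite -chart_range; apply/seteqP; split=> _ [p _ <-]; exists p => //.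
  exact: prime_proper.
have [_ lift _] := chart_localization (@subset_refl _ U) e.
have [f [n ef]] := lift a; exists f; move: ef.
by rewrite rmorph1 rmorph1 expr1n mul1r rres_id.
Qed.

Lemma good_chart (M : omod X) : (forall (f : A) (V : opens X) (h : V `<=` U),
    oset V = cm @` basic_open f ->
    (forall m : msec M V, exists (m0 : msec M U) n, rres h (phi f) ^+ n *: m = mres M h m0) /\
    (forall m0 : msec M U, mres M h m0 = 0 -> exists n, phi f ^+ n *: m0 = 0)) <-> good M U.
Proof.
split=> [H a V h|gM f V h eV]; last by apply: gM; rewrite nz_chart.
by have [f ->] := chart_homE a; rewrite nz_chart => /H; exact.
Qed.

Lemma aff_chart : aff U.
Proof.
split.
- move=> V x Vx Ux; have [f [fx fV]] := chart_basis Ux Vx.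
  by exists (phi f); rewrite nz_chart.
- apply/good_chart => f V h eV; have [_ lift tors] := chart_localization h eV.
  split=> [m|m0 e]; first by have [g [n e]] := lift m; exists (phi g), n.
  have [g eg] := chart_homE m0; subst m0; have [n en] := tors g e.
  by exists n; rewrite -rmorphXn -[RHS](rmorph0 phi) -en rmorphM.
(* If no power of [a] lay in J, a prime containing J and avoiding [a] would be a point of D(a) lying
   in no D(b) with b in J. *)
- move=> J a iJ; have [f ->] := chart_homE a => cov.
  apply: contrapT => nJ.
  have iJ' : is_ideal [set g | J (phi g)].
    split=> [|g h Jg Jh|g h Jh] /=; first by rewrite rmorph0; exact: ideal0.
      by rewrite rmorphD; exact: idealD.
    by rewrite rmorphM; exact: idealM.
  have [|p [Jp npf]] := @prime_avoiding _ _ f iJ'.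
    by move=> n /= Jn; apply: nJ; exists n; rewrite -rmorphXn.
  have [|b Jb bx] := cov (cm p); first by apply/chart_germ.
  have [g eg] := chart_homE b; subst b.
  by move/chart_germ: bx; apply; exact: Jp.
Qed.

End Charts.

(** * Quasi-coherence on affine open sets *)

Section Germs.
Variable X : ringedSpace.
Implicit Types U V W : opens X.

Lemma germ_res U V (h : V `<=` U) (a : sec X U) x : oset V x ->
  germ_unit (rres h a) x <-> germ_unit a x.
Proof.
move=> Vx; have e : oset (nz (rres h a)) = oset (opensI V (nz a)) by rewrite nz_res.
have {}e : germ_unit (rres h a) x = (oset V x /\ germ_unit a x) := congr1 (fun S : set X => S x) e.
by rewrite e; split=> [[]|].
Qed.

Lemma germM U (a b : sec X U) x : germ_unit (a * b) x <-> germ_unit a x /\ germ_unit b x.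
Proof.
have e : oset (nz (a * b)) = oset (opensI (nz a) (nz b)) by rewrite nzM.
by have -> : germ_unit (a * b) x = (germ_unit a x /\ germ_unit b x)
  := congr1 (fun S : set X => S x) e.
Qed.

Lemma germX U (a : sec X U) n x : germ_unit a x -> germ_unit (a ^+ n) x.
Proof. exact: nzX_sub. Qed.

Lemma aff_lift U (aU : aff U) (a : sec X U) V (h : V `<=` U) (m : sec X V) :
  oset V = nz a -> exists m0 n, rres h a ^+ n * m = rres h m0.
Proof. by move=> eV; have [m0 [n e]] := good_lift (aff_good aU) h m eV; exists m0, n. Qed.

End Germs.

Section SchemeLocal.
Variable X : scheme.
Implicit Types U V W : opens X.

(** The stalks of a general ringed space may be zero; on a scheme a chart reduces the claim to the
    fact that 0 lies in every prime ideal. *)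
Lemma germ0 U x : ~ germ_unit (0 : sec X U) x.
Proof.
have [c cx] := scheme_cover x => u; have Ux : oset U x := nzS _ _ u.
have [p e] := chart_pt cx; subst x.
have : germ_unit (chart_hom c 0) (chart_map p).
  apply/(germ_res (@opensIr _ U (chart_open c))); first by split.
  move/(germ_res (@opensIl _ U (chart_open c))) : u => /(_ (conj Ux cx)).
  by rewrite !rmorph0.
by move/chart_germ; apply; apply: ideal0; exact: prime_is_ideal.
Qed.

(** The stalks are local rings. On a basic open set D(f) of a chart, both sections acquire
    numerators a0 and b0 after multiplication by powers of f, and the claim becomes the closure of a
    prime ideal under sums. *)
Lemma germD U (a b : sec X U) x : germ_unit (a + b) x -> germ_unit a x \/ germ_unit b x.
Proof.
move=> u; have Ux : oset U x := nzS _ _ u.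
have [c cx] := scheme_cover x.
have [p e] := chart_pt cx; subst x.
have [f [fx fU]] := chart_basis cx Ux.
pose r := rres (@chart_basicS _ c f); pose phi := chart_hom c.
have [uf lift _] := chart_localization (f := f) (@chart_basicS _ c f) erefl.
have [a0 [n ea]] := lift (rres fU a); have [b0 [m eb]] := lift (rres fU b).
have key (d : sec X U) d0 k : r (phi f) ^+ k * rres fU d = r (phi d0) ->
    germ_unit d (chart_map p) <-> ~ prime_set p d0.
  move=> e; rewrite -chart_germ -(germ_res (@chart_basicS _ c f)) // -/r -/phi -e germM.
  split=> [ud|[_]]; last by move/germ_res; exact.
  split; last by apply/germ_res.
  by exists (chart_basic f), sub_rfl; split=> //; rewrite rres_id; exact: is_unitX.
have eD : r (phi f) ^+ (n + m) * rres fU (a + b) = r (phi (f ^+ m * a0 + f ^+ n * b0)).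
  rewrite rmorphD mulrDr (rmorphD phi) !(rmorphM phi) !(rmorphXn phi).
  rewrite (rmorphD r) !(rmorphM r) !(rmorphXn r) -ea -eb.
  by rewrite exprD; congr (_ + _); rewrite [RHS]mulrA // [r (phi f) ^+ m * _]mulrC.
move/(key _ _ _ eD): u => npD.
rewrite (key _ _ _ ea) (key _ _ _ eb); apply: contrapT => /not_orP [/contrapT pa /contrapT pb].
by apply: npD; apply: (idealD (prime_is_ideal p)); apply: (idealM (prime_is_ideal p)).
Qed.

(** Quasi-compactness of U. The elements [a] for which D(a) is covered by finitely many of the given
    D(f) form an ideal, by [germD]; [aff_ideal] shows that it contains 1. *)
Lemma aff_finite U (P : sec X U -> Prop) : aff U ->
  (forall x, oset U x -> exists f, P f /\ oset (nz f) x) ->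
  exists s : seq (sec X U), (forall f, f \in s -> P f) /\
    (forall x, oset U x -> exists2 f, f \in s & oset (nz f) x).
Proof.
move=> aU cov.
pose J : set (sec X U) := [set a | exists s : seq (sec X U), (forall f, f \in s -> P f) /\
    (forall x, oset (nz a) x -> exists2 f, f \in s & oset (nz f) x)].
have iJ : is_ideal J.
  split=> [|a b [s [Ps cs]] [t [Pt ct]]|a b [s [Ps cs]]].
  - by exists [::]; split=> // x /germ0.
  - exists (s ++ t); split=> [f|x /germD [/cs|/ct] [f fs fx]].
    + by rewrite mem_cat => /orP [/Ps|/Pt].
    + by exists f => //; rewrite mem_cat fs.
    + by exists f => //; rewrite mem_cat fs orbT.
  - by exists s; split=> // x /germM [_ /cs].
have [x Ux|n [s [Ps cs]]] := aff_ideal aU (a := 1) iJ.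
  have [f [Pf fx]] := cov x (nzS _ _ Ux); exists f => //; exists [:: f].
  by split=> [g|y fy]; [rewrite inE => /eqP -> | exists f => //; rewrite inE].
by exists s; split=> // x Ux; apply: cs; rewrite expr1n nz1.
Qed.

(** For [aff_ideal], an ideal J of O(D(a)) is replaced by its preimage in O(U), and b by a numerator
    b0, with D(b) = D(a * b0). The power of [a] that appears at the end is a unit on D(a). *)
Lemma aff_sub U (a : sec X U) : aff U -> aff (nz a).
Proof.
move=> aU; split.
- move=> V x Vx ax; have [b [bx bV]] := aff_basis aU Vx (nzS _ _ ax).
  exists (rres (nzS a) b); rewrite nz_res; split=> // y [_]; exact: bV.
- by apply: good_sub; exact: aff_good.
- move=> J b iJ cov.
  have ua := unit_nzS a.
  have lift (d : sec X (nz a)) : exists d0 k, rres (nzS a) a ^+ k * d = rres (nzS a) d0.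
    exact: (aff_lift aU (nzS a) d erefl).
  have [b0 [k eb]] := lift b.
  pose K := [set d | J (rres (nzS a) d)].
  have iK : is_ideal K.
    split=> [|c d Kc Kd|c d Kd]; rewrite /K /=.
    - by rewrite rmorph0; exact: ideal0.
    - by rewrite rmorphD; exact: idealD.
    - by rewrite rmorphM; exact: idealM.
  have [x|n Kn] := aff_ideal aU (a := a * b0) iK.
    move=> /germM [ax b0x].
    have bx : germ_unit b x.
      have : germ_unit (rres (nzS a) b0) x by apply/germ_res.
      by rewrite -eb => /germM [].
    have [d Jd dx] := cov x bx.
    have [d0 [j ed]] := lift d.
    exists d0; first by rewrite /K /= -ed; exact: idealM.
    apply/(germ_res (nzS a)) => //; rewrite -ed; apply/germM; split=> //.
    by apply: germX; apply/germ_res.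
  exists n; move: Kn; rewrite /K /= rmorphXn rmorphM -eb mulrA -exprS exprMn => Jn.
  have [c ec] : is_unit ((rres (nzS a) a ^+ k.+1) ^+ n) by do !apply: is_unitX.
  by rewrite -[b ^+ n]mul1r -ec [_ * c]mulrC -mulrA; exact: idealM.
Qed.

Lemma seq_uniform (T : eqType) (s : seq T) (P : T -> nat -> Prop) :
  (forall t m n, P t m -> (m <= n)%N -> P t n) ->
  (forall t, t \in s -> exists n, P t n) -> exists n, forall t, t \in s -> P t n.
Proof.
move=> mono; elim: s => [|t s IH] H; first by exists 0%N.
have [|n nP] := IH; first by move=> u us; apply: H; rewrite inE us orbT.
have [|m mP] := H t; first by rewrite inE eqxx.
exists (maxn m n) => u; rewrite inE => /orP [/eqP ->|us].
  by apply: mono mP _; exact: leq_maxl.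
by apply: mono (nP u us) _; exact: leq_maxr.
Qed.

Lemma scalerX0 (A : comPzRingType) (M : lmodType A) (a : A) (m : M) j k :
  a ^+ j *: m = 0 -> (j <= k)%N -> a ^+ k *: m = 0.
Proof. by move=> e jk; rewrite -(subnK jk) exprD -scalerA e scaler0. Qed.

(** A finite subcover by sets D(f) suffices, and exponents found on its members are replaced by a
    common one. The torsion half is immediate from this; the extension half glues numerators. *)
Lemma good_cover (M : omod X) U : aff U ->
  (forall x, oset U x -> exists f : sec X U, good M (nz f) /\ oset (nz f) x) -> good M U.
Proof.
move=> aU cov a V h eV.
have [s [gs cs]] := aff_finite aU cov.
have torsU (m0 : msec M U) : mres M h m0 = 0 -> exists n, a ^+ n *: m0 = 0.
  move=> m00.
  have [t j k|f fs|n nP] := @seq_uniform _ s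
      (fun f n => rres (nzS f) a ^+ n *: mres M (nzS f) m0 = 0).
  - exact: scalerX0.
  - have k : opensI (nz f) V `<=` nz f := capl.
    apply: (good_tors (gs f fs) (h := k)); first by rewrite nz_res /= eV.
    by rewrite (mres_comp _ _ ((@opensIr _ (nz f) V) >=> h))
       -(mres_comp h (@opensIr _ (nz f) V)) m00 mres0.
  - exists n; apply: mres_ext => x Ux; have [f fs fx] := cs x Ux.
    by exists (nz f), (nzS f); rewrite mres0 mresZ rmorphXn nP.
split=> // m.
have Il (f : sec X U) : opensI (nz f) V `<=` nz f := capl.
have Ir (f : sec X U) : opensI (nz f) V `<=` V := capr.
have IV (f : sec X U) : opensI (nz f) V `<=` U := subset_trans (Ir f) h.
(* For one exponent n and every f of the cover, a^n *: m extends from the part of V in D(f) to a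
   section mf over D(f). *)
have [||n nP] := @seq_uniform _ s (fun f n => exists mf : msec M (nz f),
    mres M (Il f) mf = rres (IV f) a ^+ n *: mres M (Ir f) m).
- move=> f j k [mf e] jk; exists (rres (nzS f) a ^+ (k - j) *: mf).
  rewrite mresZ e rmorphXn (rres_comp _ _ (IV f)) scalerA -exprD subnK //.
- move=> f fs.
  have [mf [n e]] := good_lift (gs f fs) (a := rres (nzS f) a) (Il f) (mres M (Ir f) m)
    (etrans (congr1 (setI (nz f)) eV) (esym (congr1 (@oset _) (nz_res (nzS f) a)))).
  by exists n, mf; rewrite -e (rres_comp _ _ (IV f)).
have mfE f : {mf : msec M (nz f) | f \in s ->
    mres M (Il f) mf = rres (IV f) a ^+ n *: mres M (Ir f) m}.
  apply: cid; have [fs|nfs] := boolP (f \in s); last by exists 0.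
  by have [mf e] := nP f fs; exists mf.
pose mf f := sval (mfE f).
have mfP f : f \in s -> mres M (Il f) (mf f) = rres (IV f) a ^+ n *: mres M (Ir f) m :=
  svalP (mfE f).
have Jl (f g : sec X U) : nz (f * g) `<=` nz f by rewrite nzM; exact: opensIl.
have Jr (f g : sec X U) : nz (f * g) `<=` nz g by rewrite nzM; exact: opensIr.
(* The extensions mf and mg agree over V, but perhaps not on all of D(f * g). Their difference there
   is killed by a power of [a]; with a common exponent l the sections a^l *: mf glue. *)
have [||l lP] := @seq_uniform _ [seq (f, g) | f <- s, g <- s] (fun p l =>
    rres (nzS (p.1 * p.2)) a ^+ l *:
      (mres M (Jl p.1 p.2) (mf p.1) - mres M (Jr p.1 p.2) (mf p.2)) = 0).
- by move=> p j k; exact: scalerX0.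
- move=> _ /allpairsP [[f g] /= [fs gs' ->]] /=.
  have gfg : good M (nz (f * g)).
    have := good_sub (a := rres (nzS f) g) (good_sub (aff_good aU) (aff_good aU)) (gs f fs).
    by rewrite nz_res nzM.
  have k : opensI (nz (f * g)) V `<=` nz (f * g) := capl.
  apply: (good_tors gfg (h := k)); first by rewrite nz_res /= eV.
  have kf : opensI (nz (f * g)) V `<=` opensI (nz f) V by apply: setSI; exact: Jl.
  have kg : opensI (nz (f * g)) V `<=` opensI (nz g) V by apply: setSI; exact: Jr.
  rewrite mresB (mres_comp _ _ (kf >=> (Il f))) (mres_comp _ _ (kg >=> (Il g))).
  rewrite -(mres_comp (Il f) kf) -(mres_comp (Il g) kg) mfP // mfP // !mresZ !rmorphXn.
  rewrite (rres_comp _ _ (kf >=> (IV f))) (rres_comp _ _ (kf >=> (IV f))).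
  have kV := subset_trans kf (Ir f).
  by rewrite !(mres_comp _ _ kV) subrr.
have [|||m1 m1P] := @mres_glue _ M U (fun W w => exists f (k : W `<=` nz f),
   f \in s /\ w = mres M k (rres (nzS f) a ^+ l *: mf f)).
- move=> W W' k k' w [f [k1 [fs ->]]]; exists f, (k' >=> k1); split=> //.
  exact: mres_comp.
- move=> W k w w' [f [k1 [fs ->]]] [g [k2 [gs' ->]]].
  have kW : W `<=` nz (f * g) by rewrite nzM => x Wx; split; [exact: k1 | exact: k2].
  have /lP /= : (f, g) \in [seq (f, g) | f <- s, g <- s] by apply/allpairsP; exists (f, g).
  rewrite scalerBr => /eqP; rewrite subr_eq0 => /eqP /(congr1 (mres M kW)).
  rewrite !mresZ !rmorphXn !(rres_comp _ _ k).
  by rewrite !(mres_comp _ _ k1) !(mres_comp _ _ k2).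
- move=> x Ux; have [f fs fx] := cs x Ux.
  exists (nz f), (nzS f), (rres (nzS f) a ^+ l *: mf f); split=> //.
  by exists f, sub_rfl; rewrite mres_id.
exists m1, (l + n)%N; apply: mres_ext => x Vx; have [f fs fx] := cs x (h _ Vx).
exists (opensI (nz f) V), (Ir f); split=> //.
rewrite (mres_comp _ _ (IV f)) (m1P _ (IV f) (mres M (Il f) (rres (nzS f) a ^+ l *: mf f))); last first.
  by exists f, (Il f).
rewrite !mresZ mfP // !rmorphXn !(rres_comp _ _ (IV f)) scalerA -exprD //.
Qed.

(** Inside an affine V around x take D(b) within D(a), with [a] a function on U. Clearing the
    denominator of b shows that D(b) = D(a * b0) is basic in U as well, which leads back to
    [good_cover]. *)
Lemma good_local (M : omod X) U : aff U ->
  (forall x, oset U x -> exists V, [/\ oset V x, aff V & good M V]) -> good M U.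
Proof.
move=> aU cov; apply: good_cover => // x Ux.
have [V [Vx aV gV]] := cov x Ux.
have [a [ax aVs]] := aff_basis aU Vx Ux.
have [b [bx bUa]] := aff_basis aV ax Vx.
have [b0 [k e]] := aff_lift aU (nzS a) (rres aVs b) erefl.
exists (a * b0); suff <- : nz b = nz (a * b0).
  by split=> //; apply: good_sub => //; exact: aff_good.
apply: opens_eq; apply/seteqP; split=> y; rewrite /=.
  move=> yb; have ya := bUa _ yb; apply/germM; split=> //.
  apply/(germ_res (nzS a)) => //; rewrite -e; apply/germM; split.
    by apply: germX; apply/germ_res.
  by apply/germ_res.
move=> /germM [ya]; move/(germ_res (nzS a)) => /(_ ya); rewrite -e => /germM [_].
by move/(germ_res aVs); apply.
Qed.

(** The definition provides one chart around each point; by [good_local] the localization property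
    spreads to all affine open sets. *)
Lemma quasi_coherentP (M : omod X) :
  quasi_coherent M <-> forall U, aff U -> good M U.
Proof.
split=> [qM U aU|gM x].
  apply: good_local => // x Ux; have [c [cx H]] := qM x.
  by exists (chart_open c); split=> //; [exact: aff_chart | exact/good_chart].
have [c cx] := scheme_cover x; exists c; split=> //.
by apply/good_chart; apply: gM; exact: aff_chart.
Qed.

Lemma quasi_coherent_local (M : omod X) :
  (forall x, exists U, [/\ oset U x, aff U & good M U]) -> quasi_coherent M.
Proof. by move=> loc; apply/quasi_coherentP => U aU; apply: good_local. Qed.

Lemma omod_str_qcoh : quasi_coherent (omod_str X).
Proof. by apply/quasi_coherentP => U; exact: aff_good. Qed.

Lemma aff_cover x (V : opens X) : oset V x -> exists U, [/\ oset U x, aff U & U `<=` V].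
Proof.
move=> Vx; have [c cx] := scheme_cover x.
have [a [ax aV]] := aff_basis (aff_chart c) Vx cx.
by exists (nz a); split=> //; apply: aff_sub; exact: aff_chart.
Qed.

(** The [a] with a *: m in Q form an ideal, to which [aff_ideal] applies: membership in a submodule
    of M(U) is local on an affine U. *)
Lemma aff_local_mem (M : omod X) U (Q : set (msec M U)) (m : msec M U) :
  aff U -> good M U -> Q 0 -> (forall a q r, Q q -> Q r -> Q (a *: q + r)) ->
  (forall x, oset U x -> exists a q, [/\ oset (nz a) x, Q q &
     exists n, mres M (nzS a) (a ^+ n *: m) = mres M (nzS a) q]) -> Q m.
Proof.
move=> aU gM Q0 QP loc.
have QZ a q : Q q -> Q (a *: q) by move=> Qq; rewrite -[_ *: _]addr0; exact: QP.
have [||n] := aff_ideal aU (J := [set a | Q (a *: m)]) (a := 1).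
- split=> [|a b Qa Qb|a b Qb] /=; first by rewrite scale0r.
    by rewrite scalerDl -[a *: m]scale1r; exact: QP.
  by rewrite -scalerA; exact: QZ.
- move=> x x1; have [a [q [ax Qq [n e]]]] := loc x (nzS _ _ x1).
  have [k ek] : exists k, a ^+ k *: (a ^+ n *: m - q) = 0.
    by apply: (good_tors gM (h := nzS a)) => //; rewrite mresB e subrr.
  exists (a ^+ (k + n)); last exact: germX.
  move: ek; rewrite scalerBr => /eqP; rewrite subr_eq0 scalerA -exprD /= => /eqP ->.
  exact: QZ.
- by rewrite /= expr1n scale1r.
Qed.

Lemma aff_lsurj (M N : omod X) (p : ohom M N) U : aff U -> good M U -> good N U -> lsurj p ->
  forall n : msec N U, exists m, p U m = n.
Proof.
move=> aU gM gN ps n.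
apply: (aff_local_mem (Q := [set n | exists m, p U m = n]) aU gN).
- by exists 0; rewrite ohom0.
- by move=> a _ _ [q <-] [r <-]; exists (a *: q + r); rewrite ohom_linear.
- move=> x Ux; have [V [h [m [Vx e]]]] := ps U n x Ux.
  have [a [ax aV]] := aff_basis aU Vx Ux.
  have [m0 [k ek]] := good_lift gM (nzS a) (mres M aV m) erefl.
  exists a, (p U m0); split=> //; first by exists m0.
  exists k; rewrite -ohom_res -ek ohomZ ohom_res e mresZ rmorphXn.
  by rewrite (mres_comp _ _ (nzS a)).
Qed.

(** The extension half of [good] for K; the torsion half is inherited from M, as [good_omod_sub]
    shows. *)
Definition good_sset (M : omod X) (K : subsheaf M) U : Prop :=
  forall (a : sec X U) V (h : V `<=` U) (m : msec M V), oset V = nz a -> K V m ->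
    exists m0 n, K U m0 /\ rres h a ^+ n *: m = mres M h m0.

Lemma good_omod_sub (M : omod X) (K : subsheaf M) U : good M U ->
  good (omod_sub K) U <-> good_sset K U.
Proof.
move=> gM; split=> [gK a V h m eV Km|gK a V h eV].
  have [m0 [n e]] := good_lift gK h (exist _ m Km : msec (omod_sub K) V) eV.
  by exists (sval m0), n; split; [exact: svalP | exact: (congr1 sval e)].
split=> [[m Km]|[m0 Km0] e].
  have [m0 [n [Km0 e]]] := gK a V h m eV Km.
  by exists (exist _ m0 Km0), n; apply: sub_sec_eq.
have [n en] := good_tors gM eV (congr1 sval e : mres M h m0 = 0).
by exists n; apply: sub_sec_eq.
Qed.

Lemma good_sset_sub (M : omod X) (K : subsheaf M) U (a : sec X U) : aff U -> good M U ->
  good_sset K U -> good_sset K (nz a).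
Proof.
move=> aU gM /(good_omod_sub _ gM) gK; apply/good_omod_sub.
  by apply: good_sub => //; exact: aff_good.
by apply: good_sub => //; exact: aff_good.
Qed.

Lemma good_ker (M N : omod X) (f : ohom M N) U : good M U -> good N U -> good_sset (ohom_ker f) U.
Proof.
move=> gM gN a V h m eV /= fm; have [m0 [n e]] := good_lift gM h m eV.
have : mres N h (f U m0) = 0 by rewrite -ohom_res -e ohomZ fm scaler0.
move=> /(good_tors gN eV) [k ek]; exists (a ^+ k *: m0), (k + n)%N.
by rewrite ohomZ ek mresZ -e rmorphXn scalerA exprD.
Qed.

(** A direct proof that H^1 of the kernel does not obstruct. If m lifts t over D(g) and m0 extends
    g^k *: m, then g^k *: t - p m0 vanishes on D(g), so a power of g kills it and g^(l + k) *: t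
    lifts. The [a] such that a *: t lifts form an ideal, which by [aff_ideal] contains 1. *)
Lemma quot_surj (M Q : omod X) (p : ohom M Q) U : aff U -> good M U ->
  good_sset (ohom_ker p) U -> lsurj p -> forall t : msec Q U, exists m, p U m = t.
Proof.
move=> aU gM gK ps t.
(* At this stage Q is not known to be [good]. Torsion is proved only for the sections a *: t - p m,
   all of which lift over the cover on which t lifts. *)
pose P (f : sec X U) := forall t' : msec Q U, (exists a m, t' = a *: t - p U m) ->
  exists m : msec M (nz f), p _ m = mres Q (nzS f) t'.
have [s [Ps cs]] : exists s : seq (sec X U), (forall f, f \in s -> P f) /\
    (forall x, oset U x -> exists2 f, f \in s & oset (nz f) x).
  apply: aff_finite => // x Ux; have [V [h [m [Vx e]]]] := ps U t x Ux.
  have [f [fx fV]] := aff_basis aU Vx Ux; exists f; split=> // t' [a [m' ->]].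
  exists (rres (nzS f) a *: mres M fV m - mres M (nzS f) m').
  rewrite ohomB ohomZ !ohom_res e mresB mresZ; congr (_ *: _ - _); exact: mres_comp.
have tors g t' : (exists a m, t' = a *: t - p U m) -> mres Q (nzS g) t' = 0 ->
    exists n, g ^+ n *: t' = 0.
  move=> t'P z.
  have [f j k|f fs|n nP] := @seq_uniform _ s
      (fun f n => rres (nzS f) g ^+ n *: mres Q (nzS f) t' = 0).
  - exact: scalerX0.
  - have [m em] := Ps f fs t' t'P.
    have k := nzS (rres (nzS f) g).
    have kg : nz (rres (nzS f) g) `<=` nz g by rewrite nz_res; exact: opensIr.
    have Km : ohom_ker p (nz (rres (nzS f) g)) (mres M k m).
      rewrite /= ohom_res em (mres_comp _ _ (kg >=> (nzS g))).
      by rewrite -(mres_comp (nzS g) kg) z mres0.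
    have [m0 [n [Km0 e]]] := good_sset_sub aU gM gK k erefl Km.
    have gMf : good M (nz f) by apply: good_sub => //; exact: aff_good.
    have [l el] : exists l, rres (nzS f) g ^+ l *: (rres (nzS f) g ^+ n *: m - m0) = 0.
      by apply: (good_tors gMf (h := k)) => //; rewrite mresB -e mresZ rmorphXn subrr.
    exists (l + n)%N; rewrite -em exprD -scalerA.
    have : p (nz f) (rres (nzS f) g ^+ l *: (rres (nzS f) g ^+ n *: m - m0)) = 0.
      by rewrite el ohom0.
    by rewrite ohomZ ohomB (Km0 : p _ m0 = 0) subr0 ohomZ.
  - exists n; apply: mres_ext => x Ux; have [f fs fx] := cs x Ux.
    by exists (nz f), (nzS f); rewrite mres0 mresZ rmorphXn nP.
have [||n] := aff_ideal aU (J := [set a | exists m, p U m = a *: t]) (a := 1).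
- split=> [|a b [m em] [n en]|a b [m em]] /=.
  + by exists 0; rewrite ohom0 scale0r.
  + by exists (m + n); rewrite ohomD em en scalerDl.
  + by exists (a *: m); rewrite ohomZ em scalerA.
- move=> x /nzS /cs [g gs gx].
  have [|m em] := Ps g gs t; first by exists 1, 0; rewrite ohom0 subr0 scale1r.
  have [m0 [k ek]] := good_lift gM (nzS g) m erefl.
  have [||l el] := tors g (g ^+ k *: t - p U m0); first by exists (g ^+ k), m0.
    by rewrite mresB mresZ -ohom_res -ek ohomZ em rmorphXn subrr.
  exists (g ^+ (l + k)); last exact: germX.
  exists (g ^+ l *: m0); move: el; rewrite scalerBr scalerA -exprD => /eqP.
  by rewrite subr_eq0 ohomZ => /eqP ->.
- by rewrite /= expr1n scale1r.
Qed.

Lemma good_quot (M Q : omod X) (p : ohom M Q) U : aff U -> good M U ->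
  good_sset (ohom_ker p) U -> lsurj p -> good Q U.
Proof.
move=> aU gM gK ps a V h eV.
have {}eV : V = nz a by exact: opens_eq.
subst V; split=> [t|t z].
  have [||m em] := quot_surj (p := p) (aff_sub a aU) _ _ ps t.
  - by apply: good_sub => //; exact: aff_good.
  - exact: good_sset_sub.
  have [m0 [n e]] := good_lift gM h m erefl.
  by exists (p U m0), n; rewrite -ohom_res -e ohomZ em.
have [m em] := quot_surj aU gM gK ps t; subst t.
have Km : ohom_ker p (nz a) (mres M h m) by rewrite /= ohom_res.
have [m0 [n [Km0 e]]] := gK a _ h _ erefl Km.
have [l el] : exists l, a ^+ l *: (a ^+ n *: m - m0) = 0.
  by apply: (good_tors gM (h := h)) => //; rewrite mresB -e mresZ rmorphXn subrr.
exists (l + n)%N; rewrite exprD -scalerA.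
have : p U (a ^+ l *: (a ^+ n *: m - m0)) = 0 by rewrite el ohom0.
by rewrite ohomZ ohomB (Km0 : p _ m0 = 0) subr0 ohomZ.
Qed.

End SchemeLocal.

(** * Quasi-coherent modules as a category *)

Section UniversalArrows.
Variables (C : category) (W : C -> Prop).

(** Reduces the adjoint to one reflection for each object; functoriality comes from the uniqueness
    of factorizations. *)
Lemma has_left_adjointP : has_left_adjoint (inclusion W) <->
  forall N : C, exists (L : C) (eta : Hom N L), W L /\
    forall M (h : Hom N M), W M -> exists! k : Hom L M, cmp k eta = h.
Proof.
split=> [[G [phi [phib phin]]] N|H].
  pose eta : Hom N (sval (G N)) := phi N (G N) (idm (G N)).
  have phiE d (h : Hom (G N) d) : phi N d h = cmp (h : Hom (sval (G N)) (sval d)) eta.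
    have := phin N N (G N) d (idm N) h (idm (G N)).
    by rewrite fhom1 !cmpm1.
  exists (sval (G N)), eta; split=> [|M h WM]; first exact: svalP.
  have [psi phiK psiK] := phib N (exist _ M WM).
  exists (psi h); split=> [|k e]; first by rewrite -(phiE (exist _ M WM)) psiK.
  by rewrite -(phiK k) phiE e.
have [L [eta [WL univ]]] : exists (L : C -> C) (eta : forall N, Hom N (L N)),
    (forall N, W (L N)) /\
    forall N M (h : Hom N M), W M -> exists! k : Hom (L N) M, cmp k (eta N) = h.
  exists (fun N => sval (cid (H N))), (fun N => sval (cid (svalP (cid (H N))))).
  by split=> N; case: (svalP (cid (svalP (cid (H N))))).
have [fac facE] : exists fac : forall N M, Hom N M -> W M -> Hom (L N) M,
    forall N M (h : Hom N M) (w : W M), cmp (fac N M h w) (eta N) = h.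
  exists (fun N M h w => sval (cid (univ N M h w))) => N M h w.
  exact: (svalP (cid (univ N M h w))).1.
have facU N M (w : W M) (k k' : Hom (L N) M) : cmp k (eta N) = cmp k' (eta N) -> k = k'.
  move=> e; have [k0 [_ u]] := univ N M (cmp k' (eta N)) w; by rewrite -(u k e) -(u k' erefl).
pose Gob N : full_subcategory W := exist _ (L N) (WL N).
pose Ghom N N' (f : Hom N N') : Hom (Gob N) (Gob N') := fac N (L N') (cmp (eta N') f) (WL N').
unshelve eexists.
  exists Gob Ghom.
  - move=> N; apply: (facU N (L N) (WL N)).
    by apply: (etrans (facE _ _ _ _)); rewrite cmpm1; exact: (esym (cmp1m (eta N))).
  - move=> A B E g f; apply: (facU A (L E) (WL E)).
    apply: (etrans (facE _ _ _ _)).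
    have -> : cmp (eta E) (cmp g f) = cmp (cmp (fac B (L E) (cmp (eta E) g) (WL E))
        (fac A (L B) (cmp (eta B) f) (WL B))) (eta A).
      by rewrite -cmpA facE [RHS]cmpA facE cmpA.
    by [].
exists (fun c d (h : Hom (Gob c) d) => cmp (h : Hom (L c) (sval d)) (eta c)); split.
- move=> c d; exists (fun h => fac c (sval d) h (svalP d)) => [k|h] /=; last exact: facE.
  by apply: (facU c (sval d) (svalP d)); rewrite facE.
- by move=> c c' d d' u v h /=; rewrite -!cmpA /= facE.
Qed.

Lemma has_right_adjointP : has_right_adjoint (inclusion W) <->
  forall N : C, exists (R : C) (eps : Hom R N), W R /\
    forall M (h : Hom M N), W M -> exists! k : Hom M R, cmp eps k = h.
Proof.
split=> [[G [phi [phib phin]]] N|H].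
  have [psi phiK psiK] := phib (G N) N.
  pose eps : Hom (sval (G N)) N := psi (idm (G N)).
  have phiE c (k : Hom c (G N)) : phi c N (cmp eps (k : Hom (sval c) (sval (G N)))) = k.
    have := phin (G N) c N N k (idm N) eps.
    by rewrite fhom1 !cmp1m psiK => ->; exact: (@cmp1m (full_subcategory W)).
  exists (sval (G N)), eps; split=> [|M h WM]; first exact: svalP.
  have [psi' phiK' psiK'] := phib (exist _ M WM) N.
  exists (phi (exist _ M WM) N h); split=> [|k e].
    by rewrite -[RHS](phiK' h) -[LHS]phiK' phiE.
  by rewrite -e phiE.
have [R [eps [WR univ]]] : exists (R : C -> C) (eps : forall N, Hom (R N) N),
    (forall N, W (R N)) /\
    forall N M (h : Hom M N), W M -> exists! k : Hom M (R N), cmp (eps N) k = h.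
  exists (fun N => sval (cid (H N))), (fun N => sval (cid (svalP (cid (H N))))).
  by split=> N; case: (svalP (cid (svalP (cid (H N))))).
have [fac facE] : exists fac : forall N M, Hom M N -> W M -> Hom M (R N),
    forall N M (h : Hom M N) (w : W M), cmp (eps N) (fac N M h w) = h.
  exists (fun N M h w => sval (cid (univ N M h w))) => N M h w.
  exact: (svalP (cid (univ N M h w))).1.
have facU N M (w : W M) (k k' : Hom M (R N)) : cmp (eps N) k = cmp (eps N) k' -> k = k'.
  move=> e; have [k0 [_ u]] := univ N M (cmp (eps N) k') w; by rewrite -(u k e) -(u k' erefl).
pose Gob N : full_subcategory W := exist _ (R N) (WR N).
pose Ghom N N' (f : Hom N N') : Hom (Gob N) (Gob N') := fac N' (R N) (cmp f (eps N)) (WR N).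
unshelve eexists.
  exists Gob Ghom.
  - move=> N; apply: (facU N (R N) (WR N)).
    by apply: (etrans (facE _ _ _ _)); rewrite cmp1m; exact: (esym (cmpm1 (eps N))).
  - move=> A B E g f; apply: (facU E (R A) (WR A)).
    apply: (etrans (facE _ _ _ _)).
    have -> : cmp (cmp g f) (eps A) = cmp (eps E) (cmp (fac E (R B) (cmp g (eps B)) (WR B))
        (fac B (R A) (cmp f (eps A)) (WR A))).
      by rewrite [RHS]cmpA facE -[RHS]cmpA facE cmpA.
    by [].
exists (fun c d (h : Hom (inclusion W c) d) => fac d (sval c) h (svalP c)); split.
- move=> c d; exists (fun k => cmp (eps d) k) => [h|k] /=; first exact: facE.
  by apply: (facU d (sval c) (svalP c)); rewrite facE.
- move=> c c' d d' u v h /=; apply: (facU d' (sval c') (svalP c')).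
  apply: (etrans (facE _ _ _ _)).
  have -> : cmp v (cmp h (u : Hom (sval c') (sval c))) = cmp (eps d')
      (cmp (fac d' (R d) (cmp v (eps d)) (WR d)) (cmp (fac d (sval c) h (svalP c)) u)).
    by rewrite [RHS]cmpA facE -[RHS]cmpA (cmpA (eps d)) facE.
  by [].
Qed.

End UniversalArrows.

Definition ohom_zero (X : ringedSpace) (M N : omod X) : ohom M N.
Proof.
exists (fun U _ => 0) => [U a m n|U V h m]; by rewrite ?scaler0 ?addr0 ?mres0.
Defined.

Section QcohMorphisms.
Variable X : scheme.
Implicit Types M N : Qcoh X.

Definition qcoh_of (M : omod X) (qM : quasi_coherent M) : Qcoh X := exist _ M qM.

Lemma qcoh_good M U : aff U -> good (sval M) U.
Proof. by move=> aU; apply: (iffLR (quasi_coherentP (sval M)) (svalP M)). Qed.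

Lemma omod_sub_qcoh (M : omod X) (K : subsheaf M) : quasi_coherent M ->
  (forall U, aff U -> good_sset K U) -> quasi_coherent (omod_sub K).
Proof.
move=> /quasi_coherentP gM gK; apply/quasi_coherentP => U aU.
by apply/good_omod_sub; [exact: gM | exact: gK].
Qed.

(** The kernel is quasi-coherent, hence available as a test object: its inclusion and the zero map
    become equal after f. *)
Lemma monic_inj M N (f : Hom M N) : monic f -> forall U m, ohom_fun f U m = 0 -> m = 0.
Proof.
move=> mf U m fm.
have qK : quasi_coherent (omod_sub (ohom_ker f)).
  apply: omod_sub_qcoh; first exact: svalP.
  by move=> V aV; apply: good_ker; exact: qcoh_good.
pose K := qcoh_of qK.
pose i : Hom K M := sub_incl (ohom_ker f).
have e : i = ohom_zero (omod_sub (ohom_ker f)) (sval M).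
  apply: mf; apply: ohom_eq => V [k fk] /=; rewrite fk.
  by rewrite [RHS]ohom0.
exact: (congr1 (fun g : ohom (omod_sub (ohom_ker f)) (sval M) => g U (exist _ m fm)) e).
Qed.

Lemma inj_monic M N (f : Hom M N) : (forall U m, ohom_fun f U m = 0 -> m = 0) -> monic f.
Proof.
move=> fi T u v uv; apply: ohom_eq => U t; apply/eqP; rewrite -subr_eq0; apply/eqP/fi.
by rewrite ohomB; apply/eqP; rewrite subr_eq0; apply/eqP; exact: (congr1 (fun g : ohom _ _ => g U t) uv).
Qed.

Lemma lsurj_epic M N (f : Hom M N) : lsurj f -> epic f.
Proof.
move=> fs T u v uv; apply: (lsurj_epi fs) => U m.
exact: (congr1 (fun g : ohom _ _ => g U m) uv).
Qed.

(* N -> N/K becomes zero after composition with f, hence is zero. *)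
Lemma epic_sub M N (f : Hom M N) (K : subsheaf (sval N)) : epic f ->
  (forall U, aff U -> good_sset K U) -> (forall U m, K U (ohom_fun f U m)) ->
  forall U n, K U n.
Proof.
move=> ef gK fK U n.
have qQ : quasi_coherent (omod_quot K).
  apply/quasi_coherentP => V aV; apply: (@good_quot X (sval N) _ (quot_proj K) V aV (qcoh_good N aV)); last exact: quot_proj_lsurj.
  move=> a W h m eW /quot_proj_eq0 Km; have [m0 [k [Km0 e]]] := gK V aV a W h m eW Km.
  by exists m0, k; split=> //; apply/quot_proj_eq0.
pose p : Hom N (qcoh_of qQ) := quot_proj K.
pose z : Hom N (qcoh_of qQ) := ohom_zero (sval N) (omod_quot K).
have e : p = z.
  by apply: ef; apply: ohom_eq => V m; apply/quot_proj_eq0; exact: fK.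
apply/quot_proj_eq0; exact: (congr1 (fun g : ohom _ _ => g U n) e).
Qed.

End QcohMorphisms.

(** * The closed subspace of an ideal *)

Section Ideals.
Variables (X : scheme) (I : subsheaf (omod_str X)).
Implicit Types (U V W : opens X) (N M : omod X).

Definition kills N : Prop := forall U (a : sec X U) (n : msec N U), I U a -> a *: n = 0.

Hypothesis gI : forall U, aff U -> good_sset I U.

Lemma ideal_lift U (aU : aff U) (g : sec X U) V (h : V `<=` U) (a : sec X V) : oset V = nz g -> I V a ->
  exists (a0 : sec X U) n, I U a0 /\ rres h g ^+ n * a = rres h a0.
Proof. by move=> eV Ia; have [a0 [n [Ia0 e]]] := gI aU h eV Ia; exists a0, n. Qed.

(** Smaller open sets are included in the condition because I may have too few sections over a
    general U. For affine U the sections over U are enough, by [annih_aff]. *)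
Definition annih N : subsheaf N.
Proof.
exists (fun U => [set n | forall V (h : V `<=` U) (a : sec X V), I V a -> a *: mres N h n = 0]) => /=.
- by move=> U V h a _; rewrite mres0 scaler0.
- move=> U b m n Hm Hn V h a Ia.
  by rewrite mresP scalerDr scalerA mulrC -scalerA Hm // Hn // scaler0 addr0.
- by move=> U V h m Hm W k a Ia; rewrite (mres_comp _ _ (k >=> h)); exact: Hm.
- move=> U m loc V h a Ia; apply: mres_ext => x Vx.
  have [W [k [Wx Hm]]] := loc x (h _ Vx).
  exists (opensI V W), (@opensIl _ V W); split=> //.
  rewrite mres0 mresZ (mres_comp _ _ ((@opensIr _ V W) >=> k)).
  rewrite -(mres_comp k (@opensIr _ V W)); apply: Hm; exact: (ss_res (@opensIl _ V W) Ia).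
Defined.

(** Over D(g) a section of I is, up to a power of the unit g, the restriction of a section of I over
    U. *)
Lemma annih_aff N U (m : msec N U) : aff U -> (forall a : sec X U, I U a -> a *: m = 0) ->
  annih N U m.
Proof.
move=> aU Im V h a Ia; apply: mres_ext => x Vx.
have [g [gx gV]] := aff_basis aU Vx (h _ Vx).
exists (nz g), gV; split=> //; rewrite mres0 mresZ (mres_comp _ _ (nzS g)).
have [a0 [n [Ia0 e]]] := ideal_lift aU (nzS g) erefl (ss_res gV Ia : I (nz g) (rres gV a)).
apply: (is_unit_eq0 (is_unitX n (unit_nzS g))).
by rewrite scalerA e -mresZ Im // mres0.
Qed.

(** Every generator of the ideal kills m on D(a), hence kills a numerator m0 up to a power of [a].
    As there are finitely many generators, one power a^l serves for all of them. *)
Lemma annih_noeth N (c : affine_chart X) : noetherian_ring (chart_ring c) ->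
  good N (chart_open c) -> good_sset (annih N) (chart_open c).
Proof.
move=> noeth gN a V h m eV Hm.
have [m0 [k e]] := good_lift gN h m eV.
have [|n [g [Ig gen]]] := noeth [set f | I (chart_open c) (chart_hom c f)].
  split=> [|f g If Ig|f g Ig] /=.
  - by rewrite rmorph0; exact: ss0.
  - by rewrite rmorphD; exact: ssD.
  - by rewrite rmorphM; exact: (ssZ (chart_hom c f) Ig).
have [i j l|i _|l lP] := @seq_uniform _ (enum 'I_n) (fun i l => a ^+ l *: (chart_hom c (g i) *: m0) = 0).
- exact: scalerX0.
- apply: (good_tors gN (h := h)) => //.
  rewrite mresZ -e scalerA mulrC -scalerA.
  have := Hm V sub_rfl (rres h (chart_hom c (g i))).
  rewrite mres_id => ->; first by rewrite scaler0.
  exact: (ss_res h (Ig i)).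
exists (a ^+ l *: m0), (l + k)%N; split; last by rewrite mresZ -e rmorphXn scalerA exprD.
apply: annih_aff; first exact: aff_chart.
move=> b; have [f ->] := chart_homE b => If.
have [d ->] := gen f If.
rewrite rmorph_sum scaler_suml; apply: big1 => i _.
rewrite (rmorphM (chart_hom c)) -scalerA.
have -> : chart_hom c (g i) *: (a ^+ l *: m0) = a ^+ l *: (chart_hom c (g i) *: m0).
  by rewrite !scalerA mulrC.
by rewrite lP ?mem_enum // scaler0.
Qed.

Lemma annih_good (noethX : noetherian_scheme X) N : quasi_coherent N ->
  forall U, aff U -> good_sset (annih N) U.
Proof.
move=> qN U aU; have gN := iffLR (quasi_coherentP N) qN.
apply/(good_omod_sub _ (gN U aU)).
suff /quasi_coherentP : quasi_coherent (omod_sub (annih N)) by exact.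
apply: quasi_coherent_local => x; have [n [c [cov noeth]]] := noethX.
have [i cx] := cov x; exists (chart_open (c i)).
have aC := aff_chart (c i); split=> //.
by apply/good_omod_sub; [exact: gN | exact: annih_noeth (noeth i) (gN _ aC)].
Qed.

(** * The product of an ideal and a module *)

Section IdealProduct.
Variable N : omod X.

(** The submodule I(U) N(U), as the intersection of all submodules that contain the products.
    Membership is thus its own induction principle. *)
Definition ideal_prod_pre U (n : msec N U) : Prop :=
  forall Q : set (msec N U), Q 0 -> (forall a q r, Q q -> Q r -> Q (a *: q + r)) ->
    (forall (a : sec X U) m, I U a -> Q (a *: m)) -> Q n.

Lemma ideal_prod_pre0 U : ideal_prod_pre (0 : msec N U).
Proof. by move=> Q Q0 _ _; exact: Q0. Qed.
Lemma ideal_prod_preP U a (m n : msec N U) :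
  ideal_prod_pre m -> ideal_prod_pre n -> ideal_prod_pre (a *: m + n).
Proof. by move=> Hm Hn Q Q0 QP QI; apply: (QP); [exact: Hm | exact: Hn]. Qed.
Lemma ideal_prod_preI U (a : sec X U) (m : msec N U) : I U a -> ideal_prod_pre (a *: m).
Proof. by move=> Ia Q _ _ QI; exact: QI. Qed.
Lemma ideal_prod_pre_res U V (h : V `<=` U) (m : msec N U) :
  ideal_prod_pre m -> ideal_prod_pre (mres N h m).
Proof.
move=> Hm; apply: (Hm [set q | ideal_prod_pre (mres N h q)]) => /=.
- by rewrite mres0; exact: ideal_prod_pre0.
- by move=> a q r Hq Hr; rewrite mresP; exact: ideal_prod_preP.
- by move=> a q Ia; rewrite mresZ; apply: ideal_prod_preI; exact: (ss_res h Ia).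
Qed.

Definition ideal_prod : subsheaf N :=
  subsheaf_locally ideal_prod_pre0 ideal_prod_preP ideal_prod_pre_res.

Hypothesis gN : forall U, aff U -> good N U.

Lemma ideal_prod_pre_lift U (g : sec X U) (m : msec N (nz g)) : aff U -> ideal_prod_pre m ->
  exists q n, ideal_prod_pre q /\ rres (nzS g) g ^+ n *: m = mres N (nzS g) q.
Proof.
move=> aU Hm; apply: (Hm [set m | exists q n,
  ideal_prod_pre q /\ rres (nzS g) g ^+ n *: m = mres N (nzS g) q]) => /=.
- by exists 0, 0%N; rewrite scaler0 mres0; split=> //; exact: ideal_prod_pre0.
- move=> a q' r' [q [n [Hq eq]]] [r [l [Hr er]]].
  have [a0 [j ea]] := aff_lift aU (nzS g) a erefl.
  exists ((g ^+ l * a0) *: q + (g ^+ (j + n) *: r + 0)), (l + j + n)%N; split.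
    do !apply: ideal_prod_preP => //; exact: ideal_prod_pre0.
  rewrite addr0 mresD !mresZ -eq -er rmorphM !rmorphXn -ea scalerDr !scalerA.
  rewrite -!exprD; congr (_ *: _ + _ *: _); last by rewrite -addnA addnC.
  by rewrite !exprD -!mulrA; congr (_ * (_ * _)); rewrite mulrC.
- move=> a m' Ia; have [a0 [j [Ia0 ea]]] := ideal_lift aU (nzS g) erefl Ia.
  have [m0 [n e]] := good_lift (gN aU) (nzS g) m' erefl.
  exists (a0 *: m0), (j + n)%N; split; first exact: ideal_prod_preI.
  by rewrite mresZ -e -ea !scalerA exprD -mulrA [_ * a]mulrC mulrA.
Qed.

(** Over an affine open set, passing from the presheaf product to [ideal_prod] adds nothing. *)
Lemma ideal_prod_aff U (m : msec N U) : aff U -> ideal_prod U m -> ideal_prod_pre m.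
Proof.
move=> aU Hm; apply: (aff_local_mem (Q := @ideal_prod_pre U) aU (gN aU)).
- exact: ideal_prod_pre0.
- exact: ideal_prod_preP.
- move=> x Ux; have [V [h [Vx HV]]] := Hm x Ux.
  have [g [gx gV]] := aff_basis aU Vx Ux.
  have [q [n [Hq e]]] := ideal_prod_pre_lift aU (ideal_prod_pre_res gV HV).
  exists g, q; split=> //; exists n.
  by rewrite mresZ rmorphXn -(mres_comp h gV).
Qed.

Lemma ideal_prod_good U : aff U -> good_sset ideal_prod U.
Proof.
move=> aU a V h m eV Hm; have {}eV : V = nz a by exact: opens_eq.
subst V; have Hm' := ideal_prod_aff (aff_sub a aU) Hm.
have [q [n [Hq e]]] := ideal_prod_pre_lift aU Hm'.
exists q, n; rewrite (Prop_irrelevance h (nzS a)); split=> //.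
exact: subsheaf_locallyW.
Qed.

End IdealProduct.

Lemma kills_quot N : kills (omod_quot (ideal_prod N)).
Proof.
move=> U a t Ia; apply: mres_ext => x Ux.
have [V [h [m [Vx e]]]] := @quot_proj_lsurj _ _ (ideal_prod N) U t x Ux.
exists V, h; split=> //; rewrite mresZ mres0 -e -ohomZ; apply/quot_proj_eq0.
by apply: subsheaf_locallyW; apply: ideal_prod_preI; exact: (ss_res h Ia).
Qed.

Lemma kills_factor N M (f : ohom N M) : kills M ->
  exists! g : ohom (omod_quot (ideal_prod N)) M, ohom_comp g (quot_proj (ideal_prod N)) = f.
Proof.
move=> kM.
have [|g gP] := lsurj_factor (f := f) (@quot_proj_lsurj _ _ (ideal_prod N)).
  move=> U m /quot_proj_eq0 Hm; apply: mres_ext => x Ux.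
  have [V [h [Vx HV]]] := Hm x Ux; exists V, h; split=> //.
  rewrite mres0 -ohom_res; apply: (HV [set q | f V q = 0]) => /=.
  - exact: ohom0.
  - by move=> a q r fq fr; rewrite ohom_linear fq fr scaler0 addr0.
  - by move=> a n Ia; rewrite ohomZ kM.
exists g; split=> [|g' e]; first exact: ohom_eq.
apply: (lsurj_epi (@quot_proj_lsurj _ _ (ideal_prod N))) => U m.
by rewrite gP -e.
Qed.

Theorem closed_of_ideal (noethX : noetherian_scheme X) :
  closed_subspace (fun N : Qcoh X => kills (sval N)).
Proof.
split; first split.
- move=> N M kM [S [i [p [mi ep]]]].
  have kS : kills (sval S).
    move=> U a n Ia; apply: (monic_inj mi).
    by etransitivity; [exact: ohomZ | exact: kM].
  move=> U a n Ia.
  (* The image of S lies in the annihilator of I in N, which is quasi-coherent; as p is epic, this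
     annihilator is all of N. *)
  have /(_ U n) : forall U n, annih (sval N) U n.
    apply: (epic_sub ep).
      by move=> V aV; apply: annih_good => //; exact: svalP.
    by move=> V m W h b Ib; rewrite -ohom_res -ohomZ kS // ohom0.
  by move/(_ U sub_rfl a Ia); rewrite mres_id.
- apply/has_right_adjointP => N.
  have qK : quasi_coherent (omod_sub (annih (sval N))).
    by apply: omod_sub_qcoh; [exact: svalP | move=> U aU; apply: annih_good => //; exact: svalP].
  exists (qcoh_of qK), (sub_incl (annih (sval N))); split.
    move=> U a [m Hm] Ia; apply: sub_sec_eq => /=.
    by have := Hm U sub_rfl a Ia; rewrite mres_id.
  move=> M h kM.
  have hK U m : annih (sval N) U (ohom_fun h U m).
    by move=> V k a Ia; rewrite -ohom_res -ohomZ kM // ohom0.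
  unshelve eexists.
    exists (fun U m => exist _ (ohom_fun h U m) (hK U m)) => [U a m n|U V k m]; apply: sub_sec_eq.
      exact: ohom_linear.
    exact: ohom_res.
  split=> [|k e]; first exact: ohom_eq.
  apply: ohom_eq => U m; apply: sub_sec_eq.
  exact: (congr1 (fun g : ohom _ _ => g U m) (esym e)).
- apply/has_left_adjointP => N.
  have gN := qcoh_good N.
  have qQ : quasi_coherent (omod_quot (ideal_prod (sval N))).
    apply/quasi_coherentP => V aV.
    apply: (@good_quot X (sval N) _ (quot_proj _) V aV (qcoh_good N aV)); last exact: quot_proj_lsurj.
    move=> a W h m eW /quot_proj_eq0 Hm.
    have [m0 [k [Hm0 e]]] := ideal_prod_good gN aV h eW Hm.
    by exists m0, k; split=> //; apply/quot_proj_eq0.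
  exists (qcoh_of qQ), (quot_proj (ideal_prod (sval N))); split; first exact: kills_quot.
  by move=> M h; exact: kills_factor.
Qed.

End Ideals.

(** * Closed embeddings *)

Record closed_embedding (S X : topologicalType) (i : S -> X) : Prop := ClosedEmbedding {
  ce_continuous : continuous i;
  ce_inj : injective i;
  ce_closed : closed (range i);
  ce_preimage : forall V : opens S, exists G : opens X, oset V = i @^-1` oset G }.

Section ClosedEmbeddings.
Variables (S : topologicalType) (X : ringedSpace) (i : S -> X) (e : closed_embedding i).
Implicit Types U W : opens X.

Definition ce_off : opens X.
Proof. by exists (~` range i); rewrite openC; exact: ce_closed. Defined.

(* The largest open set of X whose trace on S is V. *)
Definition shriek (V : opens S) : opens X.
Proof.
exists [set x | forall z, i z = x -> oset V z].
have [G eG] := ce_preimage e V.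
have -> : [set x | forall z, i z = x -> oset V z] = oset G `|` oset ce_off.
  rewrite eG; apply/seteqP; split=> x /= H.
    by have [[z _ ez]|nx] := pselect (range i x); [left; rewrite -ez; exact: H | right].
  by move=> z ez; subst x; case: H => // -[]; exists z.
by apply: openU; exact: oset_open.
Defined.

Lemma shriekS (V W : opens S) : W `<=` V -> shriek W `<=` shriek V.
Proof. by move=> WV x H z ez; apply: WV; exact: H. Qed.

Lemma shriek_pre (V : opens S) : i @^-1` shriek V `<=` V.
Proof. by move=> z; exact. Qed.

Lemma pre_shriek (V : opens S) : V `<=` i @^-1` shriek V.
Proof. by move=> z Vz y /(ce_inj e) ->. Qed.

Lemma shriek_max U (V : opens S) : i @^-1` U `<=` V -> U `<=` shriek V.
Proof. by move=> UV x Ux z ez; apply: UV; rewrite /= ez. Qed.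

Lemma shriek_sub U (V : opens S) : U `<=` shriek V -> i @^-1` U `<=` V.
Proof. by move=> UV z /UV; exact. Qed.

Variable N : omod X.
Hypothesis N_off : forall W (n n' : msec N W), W `<=` ce_off -> n = n'.

(** The set [shriek V] is covered by U, which contains all its points on the closed set, and by the
    complement of the closed set, where N is zero. With [shriek_surj], restriction from [shriek V]
    to any U with the same trace V is bijective. *)
Lemma shriek_inj U (V : opens S) (h : U `<=` shriek V) (n n' : msec N (shriek V)) :
  V `<=` i @^-1` U -> mres N h n = mres N h n' -> n = n'.
Proof.
move=> VU en; apply: mres_ext => x Vx.
have [[z _ ez]|nx] := pselect (range i x).
  by exists U, h; split=> //; rewrite -ez; apply: VU; exact: Vx.
exists (opensI (shriek V) ce_off), capl; split=> //.
by apply: N_off; exact: opensIr.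
Qed.

Lemma shriek_surj U (V : opens S) (h : U `<=` shriek V) (n : msec N U) :
  V `<=` i @^-1` U -> exists n', mres N h n' = n.
Proof.
move=> VU.
have [|||m mP] := @mres_glue _ N (shriek V) (fun W q => W `<=` ce_off \/
   exists k : W `<=` U, mres N k n = q).
- move=> W W' k k' q [Woff|[l <-]]; first by left; exact: subset_trans Woff.
  by right; exists (k' >=> l); rewrite (mres_comp _ _ (k' >=> l)).
- move=> W k q q' [Woff|[l <-]]; first by move=> _; exact: N_off.
  move=> [Woff|[l' <-]]; first exact: N_off.
  by rewrite (Prop_irrelevance l l').
- move=> x Vx; have [[z _ ez]|nx] := pselect (range i x).
    exists U, h, n; split; first by rewrite -ez; apply: VU; exact: Vx.
    by right; exists sub_rfl; rewrite mres_id.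
  exists (opensI (shriek V) ce_off), capl, 0; split=> //.
  by left; exact: opensIr.
by exists m; apply: mP; right; exists sub_rfl; rewrite mres_id.
Qed.

Lemma shriek_sheaf : is_sheaf (fun (V W : opens S) (h : W `<=` V) => mres N (shriekS h)).
Proof.
move=> V J W WV cov s ss.
have [|||m mP] := @mres_glue _ N (shriek V) (fun G q => G `<=` ce_off \/
   exists j (k : G `<=` shriek (W j)), mres N k (s j) = q).
- move=> G G' k k' q [Goff|[j [l <-]]]; first by left; exact: subset_trans Goff.
  by right; exists j, (k' >=> l); rewrite (mres_comp _ _ (k' >=> l)).
- move=> G k q q' [Goff|[j [l <-]]]; first by move=> _; exact: N_off.
  move=> [Goff|[j' [l' <-]]]; first exact: N_off.
  have := ss j j' (opensI (W j) (W j')) capl capr.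
  have GG : G `<=` shriek (opensI (W j) (W j')).
    by move=> x Gx z ez; split; [exact: (l _ Gx) | exact: (l' _ Gx)].
  by move/(congr1 (mres N GG)); rewrite (mres_comp _ _ l) (mres_comp _ _ l').
- move=> x Vx; have [[z _ ez]|nx] := pselect (range i x).
    have [j Wz] := cov z (Vx z ez).
    exists (shriek (W j)), (shriekS (WV j)), (s j); split.
      by move=> y; rewrite -ez => /(ce_inj e) ->.
    by right; exists j, sub_rfl; rewrite mres_id.
  exists (opensI (shriek V) ce_off), capl, 0; split=> //.
  by left; exact: opensIr.
exists m; split=> [j|m' m'P].
  by apply: mP; right; exists j, sub_rfl; rewrite mres_id.
apply: mres_ext => x Vx; have [[z _ ez]|nx] := pselect (range i x).
  have [j Wz] := cov z (Vx z ez).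
  exists (shriek (W j)), (shriekS (WV j)); split.
    by move=> y; rewrite -ez => /(ce_inj e) ->.
  rewrite [RHS](m'P j); apply: mP; right; exists j, sub_rfl; exact: mres_id.
exists (opensI (shriek V) ce_off), capl; split=> //.
by apply: N_off; exact: opensIr.
Qed.

End ClosedEmbeddings.

(** * Closed subschemes *)

Section MakeRMorphism.
Variables (A B : comPzRingType) (f : A -> B).
Hypotheses (fD : {morph f : x y / x + y}) (f1 : f 1 = 1) (fM : {morph f : x y / x * y}).

Definition rmorphism_fun of {morph f : x y / x + y} & f 1 = 1 & {morph f : x y / x * y} := f.
Local Notation g := (rmorphism_fun fD f1 fM).
Fact rmorphism_fun_zmod : zmod_morphism g.
Proof.
have f0 : f 0 = 0 by apply: (@addIr _ (f 0)); rewrite -fD !add0r.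
have fN x : f (- x) = - f x by apply: (@addIr _ (f x)); rewrite -fD !addNr.
by move=> x y; rewrite /rmorphism_fun fD fN.
Qed.
Fact rmorphism_fun_monoid : monoid_morphism g.
Proof. by split. Qed.
HB.instance Definition _ := GRing.isZmodMorphism.Build A B g rmorphism_fun_zmod.
HB.instance Definition _ := GRing.isMonoidMorphism.Build A B g rmorphism_fun_monoid.
Definition make_rmorphism : {rmorphism A -> B} := g.
End MakeRMorphism.

Lemma msec_empty (X : ringedSpace) (M : omod X) (U : opens X) (m n : msec M U) :
  (forall x, ~ oset U x) -> m = n.
Proof. by move=> U0; apply: mres_ext => x /U0. Qed.

Lemma ohom_bij_iso (X : ringedSpace) (M N : omod X) (g : ohom M N) :
  (forall U, bijective (g U)) -> isomorphic (C := omod_cat X) N M.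
Proof.
move=> bij.
have K U : {h : msec N U -> msec M U | cancel (g U) h & cancel h (g U)}.
  by apply: cid2; have [h ? ?] := bij U; exists h.
pose f U := s2val (K U).
have gK U : cancel (g U) (f U) := s2valP (K U).
have fK U : cancel (f U) (g U) := s2valP' (K U).
unshelve eexists.
  exists f => [U a m n|U V h m]; apply: (can_inj (gK _)).
    by rewrite ohom_linear !fK.
  by rewrite ohom_res !fK.
by exists g; split; apply: ohom_eq => U m; [exact: fK | exact: gK].
Qed.

Section Morphisms.
Variables (Z X : ringedSpace) (f : morphism Z X).
Implicit Types U V W : opens X.

Lemma mor_germ U (a : sec X U) z : oset U (f z) ->
  germ_unit (mor_sec f U a) z <-> germ_unit a (f z).
Proof.
move=> Uz; split; first exact: mor_local.
move=> [V [h [Vz u]]]; exists (mor_preimage f V), (mor_preimageS h); split=> //.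
by rewrite -mor_res; exact: is_unit_morph.
Qed.

Lemma nz_mor U (a : sec X U) : nz (mor_sec f U a) = mor_preimage f (nz a).
Proof.
apply: opens_eq; apply/seteqP; split=> z /= u.
  by apply/(mor_germ a) => //; exact: (nzS _ _ u).
by apply/(mor_germ a) => //; exact: (nzS _ _ u).
Qed.

Definition mor_ohom : ohom (omod_str X) (pushforward f (omod_str Z)).
Proof.
exists (fun U (a : sec X U) => mor_sec f U a).
- by move=> U a m n; rewrite rmorphD rmorphM.
- by move=> U V h m; exact: mor_res.
Defined.

Lemma good_push (M : omod Z) U : good M (mor_preimage f U) -> good (pushforward f M) U.
Proof.
move=> gM a V h eV.
have {}eV : V = nz a by exact: opens_eq.
subst V.
have e : oset (mor_preimage f (nz a)) = nz (mor_sec f U a) by rewrite nz_mor.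
split=> [m|m0 z].
  have [m0 [n en]] := good_lift gM (mor_preimageS h) m e; exists m0, n.
  have -> : mres (pushforward f M) h m0 = mres M (mor_preimageS h) m0 by [].
  by rewrite -en -(mor_res h) -[mor_sec _ _ _ ^+ n]rmorphXn.
have [n en] := good_tors gM e z; exists n.
by rewrite -[RHS]en -[mor_sec _ _ _ ^+ n]rmorphXn.
Qed.

End Morphisms.

Section ClosedSubscheme.
Variables (X : scheme) (Z : closed_subscheme X).
Local Notation i := (sub_mor Z).
Local Notation S := (sub_scheme Z).
Implicit Types U V W : opens X.

Lemma sub_inj : injective i.
Proof. by case: (sub_closed Z). Qed.

Lemma sub_preimage (V : opens S) : exists G : opens X, V = mor_preimage i G.
Proof.
have [_ _ H _] := sub_closed Z; have [G oG eV] := H V (oset_open V).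
by exists (Opens oG); exact: opens_eq.
Qed.

Lemma sub_lsurj : lsurj (mor_ohom i).
Proof.
have [_ _ _ H] := sub_closed Z; move=> U t x Ux.
have [V [s [k [Vx e]]]] := H U t x Ux.
exists (opensI U V), (@opensIl _ U V), (rres (@opensIr _ U V) s); split=> //=.
rewrite (mor_res (@opensIr _ U V) (mor_preimageS (@opensIr _ U V))) e.
by rewrite (rres_comp _ _ (mor_preimageS (@opensIl _ U V))).
Qed.

Lemma sub_embedding : closed_embedding i.
Proof.
split; [exact: mor_continuous | exact: sub_inj | by case: (sub_closed Z) |].
by move=> V; have [G ->] := sub_preimage V; exists G.
Qed.

Definition sub_off : opens X := ce_off sub_embedding.

(** Choose an affine V0 around z inside the preimage of an affine U0, an open set G of X with trace
    V0, and D(f) inside both U0 and G. The preimage of D(f) is the basic open set of V0 defined by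
    the image of f. *)
Lemma sub_aff_chart (z : S) : exists U, [/\ oset U (i z), aff U & aff (mor_preimage i U)].
Proof.
have [U0 [U0z aU0 _]] := aff_cover (I : oset (opensT X) (i z)).
have [V0 [V0z aV0 V0U]] := aff_cover (U0z : oset (mor_preimage i U0) z).
have [h [hz hV]] := aff_basis aV0 V0z V0z.
have [G eG] := sub_preimage V0.
have Gz : oset G (i z) by move: V0z; rewrite eG.
have [f [fz fG]] := aff_basis aU0 Gz U0z.
exists (nz f); split=> //; first exact: aff_sub.
have -> : mor_preimage i (nz f) = nz (rres V0U (mor_sec i U0 f)); last exact: aff_sub.
rewrite nz_res nz_mor; apply: opens_eq; apply/seteqP; split=> y /= fy; last by case: fy.
by split=> //; rewrite eG; exact: fG.
Qed.

Lemma push_str_qcoh : quasi_coherent (pushforward i (omod_str S)).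
Proof.
apply: quasi_coherent_local => x.
have [[z _ e]|nx] := pselect (range i x).
  subst x; have [U [Uz aU aV]] := sub_aff_chart z; exists U; split=> //.
  by apply: good_push; exact: aff_good.
have [U [Ux aU Uoff]] := aff_cover (nx : oset sub_off x).
exists U; split=> // a V h eV.
have E W (k : W `<=` U) (m n : msec (pushforward i (omod_str S)) W) : m = n.
  by apply: (@msec_empty _ (omod_str S)) => z /k /Uoff; apply; exists z.
by split=> [m|m0 _]; [exists 0, 0%N; exact: E | exists 0%N; exact: E].
Qed.

Definition sub_ideal : subsheaf (omod_str X) := ohom_ker (mor_ohom i).

Lemma sub_ideal_good U : aff U -> good_sset sub_ideal U.
Proof.
move=> aU; apply: good_ker; first exact: aff_good.
exact: (iffLR (quasi_coherentP _) push_str_qcoh).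
Qed.

Lemma sub_ideal_off W (a : sec X W) : W `<=` sub_off -> sub_ideal W a.
Proof. by move=> Woff; apply: (@msec_empty _ (omod_str S)) => z /Woff; apply; exists z. Qed.

Local Notation sub_shriek := (shriek sub_embedding).

Lemma sub_shriek_pre (V : opens S) : mor_preimage i (sub_shriek V) `<=` V.
Proof. exact: shriek_pre. Qed.

(** * Descent to the subscheme of a module killed by its ideal *)

Section Descent.
Variables (N : omod X) (kN : kills sub_ideal N).

Lemma kills_off W (n n' : msec N W) : W `<=` sub_off -> n = n'.
Proof.
move=> Woff; have z m : m = 0 :> msec N W.
  by rewrite -[m]scale1r kN //; exact: sub_ideal_off.
by rewrite (z n) (z n').
Qed.

Section Action.
Variable V : opens S.

Definition lifts W (t : sec S V) (s : sec X W) : Prop :=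
  exists k : mor_preimage i W `<=` V, mor_sec i W s = rres k t.

Lemma lifts_res W W' (k : W' `<=` W) t s : lifts t s -> lifts t (rres k s).
Proof.
move=> [l e]; exists ((mor_preimageS k) >=> l).
by rewrite (mor_res k (mor_preimageS k)) e (rres_comp _ _ ((mor_preimageS k) >=> l)).
Qed.

Lemma lifts_ex (t : sec S V) x : oset (sub_shriek V) x ->
  exists W (s : sec X W), [/\ oset W x, W `<=` sub_shriek V & lifts t s].
Proof.
move=> Vx.
have [W [h [s [Wx e]]]] := sub_lsurj (rres (@sub_shriek_pre V) t
  : msec (pushforward i (omod_str S)) (sub_shriek V)) Vx.
exists W, s; split=> //.
exists ((mor_preimageS h) >=> (@sub_shriek_pre V)).
by etransitivity; [exact: e | exact: rres_comp].
Qed.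

Lemma lifts_ex2 (t u : sec S V) x : oset (sub_shriek V) x ->
  exists W (r s : sec X W), [/\ oset W x, W `<=` sub_shriek V, lifts t r & lifts u s].
Proof.
move=> Vx; have [W [r [Wx WV tr]]] := lifts_ex t Vx; have [W' [s [Wx' _ us]]] := lifts_ex u Vx.
exists (opensI W W'), (rres (@opensIl _ W W') r), (rres (@opensIr _ W W') s).
by split=> //; [move=> y [/WV] | exact: lifts_res | exact: lifts_res].
Qed.

Lemma lifts_kills W (t : sec S V) (s s' : sec X W) (n : msec N W) :
  lifts t s -> lifts t s' -> s *: n = s' *: n.
Proof.
move=> [k e] [k' e']; apply/eqP; rewrite -subr_eq0 -scalerBl; apply/eqP/kN => /=.
by rewrite rmorphB e e' (Prop_irrelevance k k') subrr.
Qed.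

(** A function t on the subscheme acts through any local lift to X: two lifts differ by a section of
    the ideal, which kills N. *)
Lemma act_ex (t : sec S V) (n : msec N (sub_shriek V)) : {n' : msec N (sub_shriek V) |
  forall W (h : W `<=` sub_shriek V) (s : sec X W), lifts t s -> mres N h n' = s *: mres N h n}.
Proof.
apply: cid.
have [|||m mP] := @mres_glue _ N (sub_shriek V) (fun W q => exists (h : W `<=` sub_shriek V)
   (s : sec X W), lifts t s /\ q = s *: mres N h n).
- move=> W W' k k' q [h [s [ts ->]]]; exists (k' >=> h), (rres k' s).
  by rewrite mresZ (mres_comp _ _ (k' >=> h)); split=> //; exact: lifts_res.
- move=> W k q q' [h [s [ts ->]]] [h' [s' [ts' ->]]].
  by rewrite (Prop_irrelevance h h'); exact: lifts_kills ts ts'.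
- move=> x Vx; have [W [s [Wx WV ts]]] := lifts_ex t Vx.
  by exists W, WV, (s *: mres N WV n); split=> //; exists WV, s.
by exists m => W h s ts; apply: mP; exists h, s.
Qed.

Definition shriek_sec : Type := msec N (sub_shriek V).
HB.instance Definition _ := GRing.Zmodule.on shriek_sec.
Definition act (t : sec S V) (n : shriek_sec) : shriek_sec := sval (act_ex t n).
Lemma actE t n W (h : W `<=` sub_shriek V) (s : sec X W) : lifts t s ->
  mres N h (act t n) = s *: mres N h n.
Proof. exact: (svalP (act_ex t n)). Qed.

Fact actA a b m : act a (act b m) = act (a * b) m.
Proof.
apply: mres_ext => x /(lifts_ex2 a b) [W [r [s [Wx h ar bs]]]]; exists W, h; split=> //.
have abrs : lifts (a * b) (r * s).
  by case: ar bs => [k e] [k' e']; exists k; rewrite !rmorphM e e' (Prop_irrelevance k k').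
by rewrite (actE _ _ ar) (actE _ _ bs) scalerA (actE _ _ abrs).
Qed.
Fact act1 : left_id 1 act.
Proof.
move=> m; apply: mres_ext => x Vx; exists (sub_shriek V), sub_rfl; split=> //.
have l1 : lifts (1 : sec S V) (1 : sec X (sub_shriek V)).
  by exists (@sub_shriek_pre V); rewrite !rmorph1.
by rewrite (actE _ _ l1) scale1r.
Qed.
Fact actDr : right_distributive act +%R.
Proof.
move=> a m n; apply: mres_ext => x /(lifts_ex a) [W [s [Wx h ts]]]; exists W, h; split=> //.
by rewrite mresD !(actE _ _ ts) mresD scalerDr.
Qed.
Fact actDl m : {morph act^~ m : a b / a + b}.
Proof.
move=> a b; apply: mres_ext => x /(lifts_ex2 a b) [W [r [s [Wx h ar bs]]]]; exists W, h; split=> //.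
have abrs : lifts (a + b) (r + s).
  by case: ar bs => [k e] [k' e']; exists k; rewrite !rmorphD e e' (Prop_irrelevance k k').
by rewrite mresD (actE _ _ ar) (actE _ _ bs) -scalerDl (actE _ _ abrs).
Qed.
HB.instance Definition _ := GRing.Zmodule_isLmodule.Build (sec S V) shriek_sec actA act1 actDr actDl.
End Action.

(** The pullback i^* N. As the ideal kills N, it is i^-1 N with the action just defined. *)
Definition omod_shriek : omod S.
Proof.
refine (@OMod S (fun V : opens S => shriek_sec V : lmodType (sec S V))
  (fun (V W : opens S) h => mres N (shriekS (e := sub_embedding) h)) _ _ _ _).
- move=> V W h a m n; rewrite mresD; congr (_ + _).
  apply: mres_ext => x Wx; have [G [s [Gx GV ts]]] := lifts_ex a (shriekS (e := sub_embedding) h Wx).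
  exists (opensI G (sub_shriek W)), capr; split=> //.
  have ts' := lifts_res (@opensIl _ G (sub_shriek W)) ts.
  have GV' : opensI G (sub_shriek W) `<=` sub_shriek V by move=> y [/GV].
  have ts2 : lifts (rres h a) (rres (@opensIl _ G (sub_shriek W)) s).
    case: (ts') => k e; exists (shriek_sub (@opensIr _ G (sub_shriek W))).
    by rewrite e (rres_comp _ _ k).
  by rewrite (mres_comp _ _ GV') (actE _ _ ts') (actE _ _ ts2) (mres_comp _ _ GV').
- by move=> V h m; exact: mres_id.
- by move=> V W G h k l m; exact: mres_comp.
- exact: shriek_sheaf kills_off.
Defined.

Lemma omod_shriek_push : isomorphic (C := omod_cat X) N (pushforward i omod_shriek).
Proof.
have k U : U `<=` sub_shriek (mor_preimage i U) by exact: shriek_max.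
unshelve eapply (@ohom_bij_iso _ (pushforward i omod_shriek) N).
  exists (fun U m => mres N (k U) m).
  - move=> U a m n; rewrite mresD; congr (_ + _); apply: actE.
    by exists sub_rfl; rewrite rres_id.
  - move=> U V h m; rewrite (mres_comp _ _ (h >=> (k U))).
    by etransitivity; first exact: (mres_comp _ _ (h >=> (k U))).
move=> U /=.
have inj : injective (mres N (k U)) by move=> m n; exact: (shriek_inj kills_off).
have surj n : exists m, mres N (k U) m = n by exact: (shriek_surj kills_off).
exists (fun n => sval (cid (surj n))) => [m|n]; last exact: (svalP (cid (surj n))).
by apply: inj; exact: (svalP (cid (surj _))).
Qed.

(** Over an affine U with affine trace, b lifts to a function [a] on U. The localization property at
    b is that of N at [a], read through the bijections between sections over [shriek V] and over
    U. *)
Lemma omod_shriek_qcoh : quasi_coherent N -> quasi_coherent omod_shriek.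
Proof.
move=> /quasi_coherentP gN; apply: quasi_coherent_local => z.
have [U [Uz aU aV]] := sub_aff_chart z; exists (mor_preimage i U); split=> //.
move=> b W h eW.
have [a ea] : exists a : sec X U, mor_sec i U a = b.
  by apply: (aff_lsurj aU (aff_good aU) _ sub_lsurj b); apply: good_push; exact: aff_good.
have {}eW : W = mor_preimage i (nz a) by apply: opens_eq; rewrite eW -ea nz_mor.
have kU : U `<=` sub_shriek (mor_preimage i U) by exact: shriek_max.
have kW : nz a `<=` sub_shriek W by apply: shriek_max; rewrite eW.
have WW : W `<=` mor_preimage i (nz a) by rewrite eW.
have kn : nz a `<=` sub_shriek (mor_preimage i U) := subset_trans (nzS a) kU.
split=> [m|m0 z0].
  have [m1 [n e]] := good_lift (gN U aU) (nzS a) (mres N kW (m : msec N (sub_shriek W))) erefl.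
  have [m0 em0] := shriek_surj kills_off kU m1 sub_rfl.
  exists m0, n; apply: (shriek_inj kills_off (h := kW) WW).
  etransitivity.
    apply: (actE _ kW (s := rres (nzS a) a ^+ n)).
    exists (shriek_sub kW); rewrite rmorphXn (mor_res (nzS a) (mor_preimageS (nzS a))) ea.
    by rewrite [RHS]rmorphXn (rres_comp _ _ (mor_preimageS (nzS a))).
  rewrite e -em0 (mres_comp _ _ kn); symmetry; exact: mres_comp.
have : mres N (nzS a) (mres N kU m0) = 0.
  rewrite (mres_comp _ _ kn) -(mres_comp (shriekS (e := sub_embedding) h) kW).
  by rewrite (z0 : mres N (shriekS (e := sub_embedding) h) m0 = 0) mres0.
move=> /(good_tors (gN U aU) (erefl : oset (nz a) = nz a)) [n en].
exists n; apply: (shriek_inj kills_off (h := kU) sub_rfl); rewrite [RHS]mres0 -[RHS]en.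
apply: actE; exists sub_rfl; by rewrite rmorphXn ea rres_id.
Qed.

End Descent.

Lemma qcoh_imageP (N : Qcoh X) : qcoh_image Z N <-> kills sub_ideal (sval N).
Proof.
split=> [[M [f [g [gf _]]]] U a n Ia|kN].
  have gfE m : ohom_fun g U (ohom_fun f U m) = m.
    exact: (congr1 (fun h : ohom _ _ => h U m) gf).
  rewrite -[LHS]gfE ohomZ.
  have -> : a *: ohom_fun f U n = 0.
    by etransitivity; last exact: (scale0r (ohom_fun f U n : msec (sval M) _)); rewrite -(Ia : mor_sec i U a = 0).
  exact: ohom0.
exists (qcoh_of (omod_shriek_qcoh kN (svalP N))); exact: omod_shriek_push.
Qed.

End ClosedSubscheme.

(** * Comparing closed subschemes *)

Local Notation sub_shriek := (shriek (sub_embedding _)).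

Section Factor.
Variables (X : scheme) (Y Z : closed_subscheme X).
Local Notation iY := (sub_mor Y).
Local Notation iZ := (sub_mor Z).
Hypothesis ZY : forall U a, sub_ideal Z U a -> sub_ideal Y U a.

(** Off Z the section 1 lies in the ideal of Z, hence in that of Y; at a point y mapped off Z this
    would make 1 equal to 0 near y. *)
Lemma sub_factor_pt (y : sub_scheme Y) : exists z, iZ z = iY y.
Proof.
apply: contrapT => nz.
have yoff : oset (sub_off Z) (iY y) by move=> [z _ e]; apply: nz; exists z.
have : sub_ideal Z (sub_off Z) 1 by exact: sub_ideal_off.
move=> /ZY /= e1.
have : germ_unit (mor_sec iY (sub_off Z) 1) y.
  by apply/mor_germ => //; exists (sub_off Z), sub_rfl; split=> //;
    rewrite rmorph1; exact: is_unit1.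
by rewrite e1; exact: germ0.
Qed.

Definition sub_factor_map y := sval (cid (sub_factor_pt y)).
Lemma sub_factor_mapE y : iZ (sub_factor_map y) = iY y.
Proof. exact: (svalP (cid (sub_factor_pt y))). Qed.

Lemma sub_factor_continuous : continuous sub_factor_map.
Proof.
apply/continuousP => V oV; have [G eG] := sub_preimage (Opens oV).
have {}eG : V = iZ @^-1` oset G := congr1 (@oset _) eG.
have -> : sub_factor_map @^-1` V = iY @^-1` oset G.
  by rewrite eG; apply/seteqP; split=> y /=; rewrite sub_factor_mapE.
exact: (oset_open (mor_preimage iY G)).
Qed.

Lemma sub_factor_ohom : exists g : ohom (pushforward iZ (omod_str (sub_scheme Z)))
    (pushforward iY (omod_str (sub_scheme Y))),
  forall U a, g U (mor_sec iZ U a) = mor_sec iY U a.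
Proof. exact: (lsurj_factor (f := mor_ohom iY) (@sub_lsurj _ Z) ZY). Qed.

Let g := sval (cid sub_factor_ohom).
Let gE U a : g U (mor_sec iZ U a) = mor_sec iY U a := svalP (cid sub_factor_ohom) U a.

Let g1 U : g U 1 = 1 :> sec _ (mor_preimage iY U).
Proof. by have := gE (1 : sec X U); rewrite !rmorph1. Qed.

Let gD U (t u : sec _ (mor_preimage iZ U)) : g U (t + u) = (g U t : sec _ (mor_preimage iY U)) + g U u.
Proof. exact: (ohomD g). Qed.

Let gM U (t u : sec _ (mor_preimage iZ U)) : g U (t * u) = (g U t : sec _ (mor_preimage iY U)) * g U u.
Proof.
apply: (@mres_ext _ (pushforward iY (omod_str (sub_scheme Y)))) => x Ux.
have [V [h [a [Vx ea]]]] := sub_lsurj (t : msec (pushforward iZ (omod_str _)) U) Ux.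
have [W [k [b [Wx eb]]]] := sub_lsurj (mres _ h (u : msec (pushforward iZ (omod_str _)) U)) Vx.
exists W, (k >=> h); split=> //.
have kh := mor_preimageS (f := iY) (k >=> h).
have kh' := mor_preimageS (f := iZ) (k >=> h).
have at' : mor_sec iZ W (rres k a) = rres kh' t.
  rewrite (mor_res k (mor_preimageS k)) (ea : mor_sec iZ V a = _).
  exact: rres_comp.
have bu : mor_sec iZ W b = rres kh' u.
  rewrite (eb : mor_sec iZ W b = _); exact: rres_comp.
have gr v : rres kh (g U v : sec _ (mor_preimage iY U)) = g W (rres kh' v) :> sec _ (mor_preimage iY W).
  symmetry; rewrite (Prop_irrelevance kh (mor_preimageS (k >=> h))).
  rewrite (Prop_irrelevance kh' (mor_preimageS (k >=> h))).
  exact: (ohom_res g (k >=> h) v).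
transitivity (rres kh (g U (t * u) : sec _ (mor_preimage iY U))).
  by congr (rres _ _); exact: Prop_irrelevance.
transitivity (rres kh ((g U t : sec _ (mor_preimage iY U)) * g U u)); last first.
  by congr (rres _ _); exact: Prop_irrelevance.
by rewrite gr rmorphM -at' -bu -rmorphM gE rmorphM -!gE at' bu -!gr -rmorphM.
Qed.

Local Notation preF := (preimage_opens sub_factor_continuous).

Lemma sub_factor_sub (V : opens (sub_scheme Z)) : preF V `<=` mor_preimage iY (sub_shriek V).
Proof. by move=> y Vy z; rewrite -sub_factor_mapE => /sub_inj ->. Qed.

(** The map g compares pushforwards, so it is available only over open sets of X; an open set V of Z
    is presented there as the trace of [sub_shriek V]. *)
Definition sub_factor_sec_fun (V : opens (sub_scheme Z)) (t : sec _ V) : sec _ (preF V) :=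
  rres (@sub_factor_sub V) (g (sub_shriek V) (rres (@sub_shriek_pre _ _ V) t)).

Definition sub_factor_sec (V : opens (sub_scheme Z)) : {rmorphism sec _ V -> sec _ (preF V)}.
Proof.
apply: (@make_rmorphism _ _ (@sub_factor_sec_fun V)).
- by move=> t u; rewrite /sub_factor_sec_fun rmorphD gD rmorphD.
- by rewrite /sub_factor_sec_fun rmorph1 g1 rmorph1.
- by move=> t u; rewrite /sub_factor_sec_fun rmorphM gM rmorphM.
Defined.

(** The comorphism is computed through any local lift of t to X. The morphism axioms and the
    triangle are checked on such lifts. *)
Lemma sub_factor_lift (V : opens (sub_scheme Z)) (t : sec _ V) W (s : sec X W)
    (P : opens (sub_scheme Y)) (h : P `<=` preF V) (k : P `<=` mor_preimage iY W) :
  lifts t s -> rres h (sub_factor_sec V t) = rres k (mor_sec iY W s).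
Proof.
move=> [l e]; have WV : W `<=` sub_shriek V by exact: shriek_max.
rewrite -gE e -(rres_comp (@sub_shriek_pre _ _ V) (mor_preimageS WV) l).
have -> : g W (rres (mor_preimageS WV) (rres (@sub_shriek_pre _ _ V) t)) =
    rres (mor_preimageS WV) (g (sub_shriek V) (rres (@sub_shriek_pre _ _ V) t)).
  exact: (ohom_res g WV).
have hk := subset_trans k (mor_preimageS WV).
by rewrite (rres_comp _ _ hk) /= /sub_factor_sec_fun (rres_comp _ _ hk).
Qed.

Definition sub_factor : morphism (sub_scheme Y) (sub_scheme Z).
Proof.
refine (@Morphism _ _ sub_factor_map sub_factor_continuous sub_factor_sec _ _).
- move=> U V h k s; apply: rres_ext => y Vy.
  have Uy : oset (sub_shriek V) (iY y) by exact: (sub_factor_sub Vy).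
  have [W [r [Wy WV sr]]] := lifts_ex (rres h s) Uy.
  pose P := opensI (preF V) (mor_preimage iY W).
  have PV : P `<=` preF V := capl.
  have PW : P `<=` mor_preimage iY W := capr.
  exists P, PV; split=> //.
  rewrite (sub_factor_lift PV PW sr) (rres_comp _ _ (PV >=> k)).
  symmetry; apply: sub_factor_lift; case: sr => l e; exists (l >=> h).
  by rewrite e (rres_comp _ _ (l >=> h)).
- move=> U s y Uy u.
  have Uy' : oset (sub_shriek U) (iY y) by exact: (@sub_factor_sub U y Uy).
  have [W [r [Wy WV sr]]] := lifts_ex s Uy'.
  pose P := opensI (preF U) (mor_preimage iY W).
  have PV : P `<=` preF U := capl.
  have PW : P `<=` mor_preimage iY W := capr.
  have Py : oset P y by [].
  move/(germ_res PV _ Py): u; rewrite (sub_factor_lift PV PW sr) => /(germ_res PW _ Py).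
  move=> /(mor_germ r Wy); rewrite -sub_factor_mapE.
  have Wz : oset W (iZ (sub_factor_map y)) by rewrite sub_factor_mapE.
  move=> /(mor_germ r Wz); case: sr => l ->.
  by move=> /(germ_res l); apply.
Defined.

Lemma sub_factor_triangle : mor_triangle sub_factor iZ iY.
Proof.
split; first exact: sub_factor_mapE.
move=> U s W h k; apply: sub_factor_lift; exists sub_rfl.
by rewrite rres_id.
Qed.

Lemma sub_factor_inj (V : opens (sub_scheme Z)) :
  (forall U a, sub_ideal Y U a -> sub_ideal Z U a) -> (forall z, exists y, iY y = iZ z) ->
  injective (mor_sec sub_factor V).
Proof.
move=> YZ YZpt s t e; apply/eqP; rewrite -subr_eq0; apply/eqP.
have {e} : mor_sec sub_factor V (s - t) = 0 by rewrite rmorphB e subrr.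
move: (s - t) => {s}t z; apply: rres_ext => x Vx.
have Ux : oset (sub_shriek V) (iZ x) by exact: (@pre_shriek _ _ _ (sub_embedding Z) V x Vx).
have [W [r [Wx WV sr]]] := lifts_ex t Ux.
have WP : mor_preimage iY W `<=` preF V.
  by move=> y /WV; apply; exact: sub_factor_mapE.
have := sub_factor_lift WP sub_rfl sr.
have -> : sub_factor_sec V t = 0 by exact: z.
rewrite rmorph0 rres_id => /esym /YZ /= r0.
case: sr => l; rewrite r0 => e; exists (mor_preimage iZ W), l; split=> //.
by rewrite -e rmorph0.
Qed.

End Factor.

Section SameSubscheme.
Variables (X : scheme) (Y Z : closed_subscheme X).
Local Notation iY := (sub_mor Y).
Local Notation iZ := (sub_mor Z).

Lemma same_subscheme_ideal : (forall U a, sub_ideal Y U a <-> sub_ideal Z U a) -> same_subscheme Y Z.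
Proof.
move=> YZ.
have ZY1 U a : sub_ideal Z U a -> sub_ideal Y U a by move/YZ.
have YZ1 U a : sub_ideal Y U a -> sub_ideal Z U a by move/YZ.
have pt := sub_factor_pt YZ1.
pose phi := sub_factor ZY1; exists phi; split; last exact: sub_factor_triangle.
have phiE y : iZ (phi y) = iY y by exact: sub_factor_mapE.
split.
  exists (sub_factor_map YZ1); split; first exact: sub_factor_continuous.
    by move=> y; apply: sub_inj; rewrite sub_factor_mapE phiE.
  by move=> z; apply: sub_inj; rewrite phiE sub_factor_mapE.
move=> V.
have inj (W : opens (sub_scheme Z)) : injective (mor_sec phi W) by exact: sub_factor_inj.
(* Local preimages come from lifts of t to X. Since [inj] holds over every open set they are unique,
   and therefore glue. *)
have surj (t : sec _ (mor_preimage phi V)) : exists s, mor_sec phi V s = t.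
  have loc z : oset V z -> exists G (r : sec X G) (k : mor_preimage iZ G `<=` V),
      oset G (iZ z) /\ mor_sec phi _ (mor_sec iZ G r) = rres (mor_preimageS k) t.
    move=> Vz; have [y ey] := pt z.
    have yz : phi y = z by apply: sub_inj; rewrite phiE.
    have Uy : oset (sub_shriek (mor_preimage phi V)) (iY y).
      by apply: (@pre_shriek _ _ _ (sub_embedding Y) (mor_preimage phi V) y); rewrite -yz in Vz.
    have [G [r [Gy GV [l e]]]] := lifts_ex t Uy.
    have kV : mor_preimage iZ G `<=` V.
      move=> z' Gz'; have [y' ey'] := pt z'.
      have <- : phi y' = z' by apply: sub_inj; rewrite phiE.
      by apply: (l y'); rewrite /= ey'.
    exists G, r, kV; split; first by rewrite -ey.
    have GG : mor_preimage phi (mor_preimage iZ G) `<=` mor_preimage iY G.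
      by move=> y' /=; rewrite -phiE.
    have [_ tri] := sub_factor_triangle ZY1.
    have := tri G r _ sub_rfl GG; rewrite rres_id e => t1.
    apply: (etrans t1); exact: rres_comp.
  have [|||s sP] := sheaf_glue (@rres_comp (sub_scheme Z)) (@rres_sheaf _) (U := V) (P := fun W q =>
      exists k : mor_preimage phi W `<=` mor_preimage phi V, mor_sec phi W q = rres k t).
  - move=> W W' k k' q [l e]; exists ((mor_preimageS k') >=> l).
    by rewrite (mor_res k' (mor_preimageS k')) e (rres_comp _ _ ((mor_preimageS k') >=> l)).
  - by move=> W k q q' [l e] [l' e']; apply: inj; rewrite e e' (Prop_irrelevance l l').
  - move=> z /loc [G [r [k [Gz e]]]].
    by exists (mor_preimage iZ G), k, (mor_sec iZ G r); split=> //; exists (mor_preimageS k).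
  exists s; apply: rres_ext => y /loc [G [r [k [Gy e]]]].
  exists (mor_preimage phi (mor_preimage iZ G)), (mor_preimageS k); split=> //.
  by rewrite -(mor_res k) (sP _ k (mor_sec iZ G r)) //; exists (mor_preimageS k).
exists (fun t => sval (cid (surj t))) => [s|t]; last exact: (svalP (cid (surj t))).
by apply: inj; exact: (svalP (cid (surj _))).
Qed.

Lemma ideal_same_subscheme : same_subscheme Y Z -> forall U a, sub_ideal Y U a <-> sub_ideal Z U a.
Proof.
move=> [phi [[_ bij] [phiE tri]]] U a /=.
have h : mor_preimage iY U `<=` mor_preimage phi (mor_preimage iZ U).
  by move=> y /=; rewrite phiE.
have h' : mor_preimage phi (mor_preimage iZ U) `<=` mor_preimage iY U.
  by move=> y /=; rewrite phiE.
split=> e0.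
  apply: (bij_inj (bij (mor_preimage iZ U))); rewrite rmorph0.
  by have := tri U a _ sub_rfl h'; rewrite rres_id e0 rmorph0.
by have := tri U a _ h sub_rfl; rewrite rres_id e0 !rmorph0.
Qed.

(** The module to test is i_* O_Z: it is killed by the ideal of Z, and a section that kills its
    element 1 lies in that ideal. *)
Lemma qcoh_image_ideal : qcoh_image Y = qcoh_image Z -> forall U a, sub_ideal Y U a -> sub_ideal Z U a.
Proof.
move=> YZ U a Ya; pose N : Qcoh X := qcoh_of (push_str_qcoh Z).
have : qcoh_image Z N.
  apply/qcoh_imageP => V b t Ib.
  have -> : b *: t = (mor_sec iZ V b * t : sec _ (mor_preimage iZ V)) by [].
  by rewrite (Ib : mor_sec iZ V b = 0) mul0r.
rewrite -YZ => /qcoh_imageP /(_ U a 1 Ya) e.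
by change (mor_sec iZ U a = 0); rewrite -[LHS]mulr1.
Qed.

End SameSubscheme.

Lemma same_subschemeP (X : scheme) (Y Z : closed_subscheme X) :
  same_subscheme Y Z <-> qcoh_image Y = qcoh_image Z.
Proof.
split=> [/ideal_same_subscheme YZ|YZ].
  apply: funext => N; apply: propext; rewrite !qcoh_imageP.
  by split=> k U a n /YZ; exact: k.
apply: same_subscheme_ideal => U a; split; exact: qcoh_image_ideal.
Qed.

(** * Quotient rings of the structure sheaf, and a criterion for affineness *)

(* A locally cyclic module is a quotient of the structure sheaf by an ideal,
   hence a sheaf of rings. *)
Section CyclicRing.
Variables (X : ringedSpace) (E : omod X) (p : ohom (omod_str X) E) (ps : lsurj p).
Implicit Types U V W : opens X.

Lemma cyc_ex2 U (d e : msec E U) x : oset U x -> exists V (h : V `<=` U) (a b : sec X V),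
  [/\ oset V x, p V a = mres E h d & p V b = mres E h e].
Proof.
move=> Ux; have [V [h [a [Vx ea]]]] := ps d Ux.
have [W [k [b [Wx eb]]]] := ps (mres E h e) Vx.
exists W, (k >=> h), (rres k a), b; split=> //; last by rewrite eb; exact: mres_comp.
rewrite -(mres_comp h k) -ea; exact: (ohom_res p k a).
Qed.

Lemma cyc_ex3 U (d e f : msec E U) x : oset U x -> exists V (h : V `<=` U) (a b c : sec X V),
  [/\ oset V x, p V a = mres E h d, p V b = mres E h e & p V c = mres E h f].
Proof.
move=> Ux; have [V [h [a [b [Vx ea eb]]]]] := cyc_ex2 d e Ux.
have [W [k [c [Wx ec]]]] := ps (mres E h f) Vx.
exists W, (k >=> h), (rres k a), (rres k b), c; split=> //.
- rewrite -(mres_comp h k) -ea; exact: (ohom_res p k a).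
- rewrite -(mres_comp h k) -eb; exact: (ohom_res p k b).
- by rewrite ec; exact: mres_comp.
Qed.

(** The product of p a and p b has to be p (a * b). This equals a *: p b, so it depends on b only
    through p b, and by symmetry on [a] only through p a. *)
Lemma cyc_mul_ex U (d e : msec E U) : {f : msec E U | forall V (h : V `<=` U) (a b : sec X V),
  p V a = mres E h d -> p V b = mres E h e -> mres E h f = p V (a * b)}.
Proof.
apply: cid.
have pM V (a b : sec X V) : p V (a * b) = a *: p V b by exact: (ohomZ p a b).
have [|||f fP] := @mres_glue _ E U (fun V f => exists (h : V `<=` U) (a b : sec X V),
    [/\ p V a = mres E h d, p V b = mres E h e & f = p V (a * b)]).
- move=> V W h k f [h' [a [b [ea eb ->]]]].
  exists (k >=> h'), (rres k a), (rres k b); split.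
  + rewrite -(mres_comp h' k) -ea; exact: (ohom_res p k a).
  + rewrite -(mres_comp h' k) -eb; exact: (ohom_res p k b).
  + by rewrite -rmorphM; symmetry; exact: (ohom_res p k (a * b)).
- move=> V h f f' [k [a [b [ea eb ->]]]] [k' [a' [b' [ea' eb' ->]]]].
  rewrite (Prop_irrelevance k' k) in ea' eb'.
  have -> : p V (a * b) = p V (a * b') by rewrite !pM eb eb'.
  by rewrite ![_ * b']mulrC !pM ea ea'.
- move=> x /(cyc_ex2 d e) [V [h [a [b [Vx ea eb]]]]].
  by exists V, h, (p V (a * b)); split=> //; exists h, a, b.
by exists f => V h a b ea eb; apply: fP; exists h, a, b.
Qed.

(* The ring structure depends on the unused argument. *)
Definition cyc_sec of lsurj p := fun U => msec E U : Type.
Local Notation cyc U := (cyc_sec ps U).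

Section Sections.
Variable U : opens X.
HB.instance Definition _ := GRing.Zmodule.on (cyc U).
Definition cyc_mul (d e : cyc U) : cyc U := sval (cyc_mul_ex d e).
Definition cyc_one : cyc U := p U (1 : sec X U).

Lemma cyc_mulE (d e : cyc U) V (h : V `<=` U) (a b : sec X V) :
  p V a = mres E h d -> p V b = mres E h e -> mres E h (cyc_mul d e) = p V (a * b).
Proof. exact: (svalP (cyc_mul_ex d e)). Qed.

Fact cyc_mulA : associative cyc_mul.
Proof.
move=> d e f; apply: mres_ext => x Ux.
have [W [h [a [b [c [Wx ea eb ec]]]]]] := cyc_ex3 d e f Ux.
exists W, h; split=> //.
rewrite (cyc_mulE ea (esym (cyc_mulE eb ec))) mulrA.
by rewrite (cyc_mulE (esym (cyc_mulE ea eb)) ec).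
Qed.
Fact cyc_mulC : commutative cyc_mul.
Proof.
move=> d e; apply: mres_ext => x /(cyc_ex2 d e) [V [h [a [b [Vx ea eb]]]]].
by exists V, h; rewrite (cyc_mulE ea eb) (cyc_mulE eb ea) mulrC.
Qed.
Fact cyc_mul1 : left_id cyc_one cyc_mul.
Proof.
move=> e; apply: mres_ext => x /(ps e) [V [h [a [Vx ea]]]]; exists V, h; split=> //.
have e1 : p V (1 : sec X V) = mres E h cyc_one.
  by rewrite -(rmorph1 (rres h)); exact: (ohom_res p h (1 : sec X U)).
by rewrite (cyc_mulE e1 ea) mul1r.
Qed.
Fact cyc_mulDl : left_distributive cyc_mul +%R.
Proof.
move=> d e f; apply: mres_ext => x Ux.
have [W [h [a [b [c [Wx ea eb ec]]]]]] := cyc_ex3 d e f Ux.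
exists W, h; split=> //; rewrite mresD (cyc_mulE ea ec) (cyc_mulE eb ec).
have eab : p W (a + b) = mres E h (d + e).
  by rewrite mresD -ea -eb; exact: (ohomD p).
by rewrite (cyc_mulE eab ec) mulrDl; exact: (ohomD p).
Qed.
HB.instance Definition _ := GRing.Zmodule_isComPzRing.Build (cyc U)
  cyc_mulA cyc_mulC cyc_mul1 cyc_mulDl.
End Sections.

Lemma cyc_proj_mul U (a b : sec X U) : p U (a * b) = (p U a : cyc U) * (p U b : cyc U).
Proof.
have := @cyc_mulE U (p U a) (p U b) U sub_rfl a b.
by rewrite !mres_id => /(_ erefl erefl) e; exact: (esym e).
Qed.

Lemma cyc_scale U (a : sec X U) (e : msec E U) : a *: e = (p U a : cyc U) * (e : cyc U).
Proof.
apply: mres_ext => x /(ps e) [V [h [b [Vx eb]]]]; exists V, h; split=> //.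
have ea : p V (rres h a) = mres E h (p U a) by exact: (ohom_res p h a).
by rewrite (cyc_mulE ea eb) mresZ -eb; symmetry; exact: (ohomZ p _ b).
Qed.

Lemma cyc_res_mul U V (h : V `<=` U) (d e : cyc U) :
  mres E h (d * e : cyc U) = (mres E h d : cyc V) * (mres E h e : cyc V).
Proof.
apply: mres_ext => x Vx; have [W [k [a [b [Wx ea eb]]]]] := cyc_ex2 d e (h _ Vx).
have Il := @opensIl _ V W; have Ir := @opensIr _ V W; have I := subset_trans Il h.
have {}ea : p _ (rres Ir a) = mres E I d.
  by rewrite -(mres_comp k Ir) -ea; exact: (ohom_res p Ir a).
have {}eb : p _ (rres Ir b) = mres E I e.
  by rewrite -(mres_comp k Ir) -eb; exact: (ohom_res p Ir b).
exists (opensI V W), Il; split=> //; rewrite (mres_comp _ _ I) (cyc_mulE ea eb).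
symmetry; apply: cyc_mulE; [rewrite ea | rewrite eb]; symmetry; exact: mres_comp.
Qed.

Lemma cyc_res1 U V (h : V `<=` U) : mres E h (1 : cyc U) = 1 :> cyc V.
Proof. by symmetry; rewrite /GRing.one /= /cyc_one -(rmorph1 (rres h)); exact: (ohom_res p h (1 : sec X U)). Qed.

Definition cyc_res U V (h : V `<=` U) : {rmorphism cyc U -> cyc V}.
Proof.
apply: (@make_rmorphism _ _ (fun e : cyc U => mres E h e : cyc V)) => [a b||a b].
- exact: mresD.
- exact: cyc_res1.
- exact: cyc_res_mul.
Defined.

End CyclicRing.

Section AffineCriterion.
Variables (Z : ringedSpace) (V : opens Z).
Local Notation B := (sec Z V).
Hypothesis pts : forall q : spec B, exists z, oset V z /\ forall b : B, germ_unit b z <-> ~ prime_set q b.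
Hypothesis primes : forall z, oset V z -> exists q : spec B, forall b : B, germ_unit b z <-> ~ prime_set q b.
Hypothesis sep : forall z z', oset V z -> oset V z' ->
  (forall b : B, germ_unit b z <-> germ_unit b z') -> z = z'.
Hypothesis basis : forall (W : opens Z) z, oset W z -> oset V z ->
  exists b : B, oset (nz b) z /\ nz b `<=` W.
Hypothesis gO : good (omod_str Z) V.

Lemma spec_eq (A : comPzRingType) (q r : spec A) :
  (forall a, prime_set q a <-> prime_set r a) -> q = r.
Proof.
move=> qr; have e : prime_set q = prime_set r by apply/seteqP; split=> a /qr.
case: q r e {qr} => [q q1 q2 q3] [r r1 r2 r3] /= e; subst r.
by congr Spec; exact: Prop_irrelevance.
Qed.

Definition crit_map (q : spec B) : Z := sval (cid (pts q)).
Let mapV q : oset V (crit_map q) := (svalP (cid (pts q))).1.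
Let mapE q b : germ_unit b (crit_map q) <-> ~ prime_set q b := (svalP (cid (pts q))).2 b.

Let mapK z : oset V z -> exists q, crit_map q = z.
Proof.
move=> Vz; have [q qP] := primes Vz; exists q; apply: sep => // b.
by rewrite mapE qP.
Qed.

(** The hypotheses match the points z of V with the primes of O(V), z corresponding to the functions
    that are not invertible at z. The topology is controlled by [basis]; the ring map of the chart
    is the identity of O(V), and its localization property is [gO]. *)
Lemma affine_criterion : exists c : affine_chart Z, chart_open c = V.
Proof.
have Enz (b : B) : oset (nz b) = crit_map @` basic_open b.
  apply/seteqP; split=> z /= => [bz|[q nqb <-]]; last by apply/mapE.
  by have [q eq] := mapK (nzS _ _ bz); subst z; exists q => //; apply/mapE.
unshelve eexists.
  apply: (@AffineChart Z B crit_map V (idfun : {rmorphism B -> B})).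
  - move=> q r e; apply: spec_eq => b.
    have : ~ prime_set q b <-> ~ prime_set r b by rewrite -!mapE e.
    by move=> [H H']; split=> ?; apply: contrapT => ?; [apply: (H' _) | apply: (H _)].
  - apply/continuousP => W oW; exists [set b | nz b `<=` W].
    apply/seteqP; split=> q /= => [Wq|nE].
      have [b [bz bW]] := basis (Wq : oset (Opens oW) _) (mapV q).
      by move=> /(_ b bW); apply/mapE.
    have [b [bW nqb]] : exists b : B, nz b `<=` W /\ ~ prime_set q b.
      apply: contrapT => ne; apply: nE => b bW; apply: contrapT => nqb.
      by apply: ne; exists b.
    by apply: bW; apply/mapE.
  - move=> _ [E ->].
    have -> : crit_map @` [set q : spec B | ~ (E `<=` q)] = \bigcup_(b in E) oset (nz b).
      apply/seteqP; split=> z /=.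
        move=> [q nE <-]; apply: contrapT => ne; apply: nE => b Eb.
        by apply: contrapT => nqb; apply: ne; exists b => //; apply/mapE.
      move=> [b Eb bz]; have [q nqb <-] : (crit_map @` basic_open b) z by rewrite -Enz.
      by exists q => // Eq; apply: nqb; exact: Eq.
    by apply: bigcup_open => b _; exact: oset_open.
  - apply/seteqP; split=> z /= => [[q _ <-] //|/mapK [q <-]]; by exists q.
  - move=> f W h; rewrite -Enz => eW; split.
    + by apply: unit_nz; rewrite eW.
    + by move=> b; have [m0 [n en]] := good_lift gO h b eW; exists m0, n.
    + by move=> a ea; have [n en] := good_tors gO eW (ea : mres (omod_str Z) h a = 0); exists n.
by [].
Qed.

End AffineCriterion.

(** * The closed subscheme of an ideal *)

Section Support.
Variables (X : scheme) (E : omod X) (p : ohom (omod_str X) E).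

(** The support of E: as soon as p is locally surjective, E is locally generated by p 1, so its
    stalk at x vanishes exactly when p 1 vanishes near x. *)
Definition supp : set X := [set x | forall U : opens X, oset U x -> p U (1 : sec X U) <> 0].

Definition supp_pt := {x : X | supp x}.
HB.instance Definition _ := gen_eqMixin supp_pt.
HB.instance Definition _ := gen_choiceMixin supp_pt.

Definition supp_open (V : set supp_pt) : Prop := exists U : set X, open U /\ V = sval @^-1` U.
Lemma supp_openT : supp_open setT.
Proof. by exists setT; split; [exact: openT|]. Qed.
Lemma supp_openI (V W : set supp_pt) : supp_open V -> supp_open W -> supp_open (V `&` W).
Proof. by move=> [U [oU ->]] [U' [oU' ->]]; exists (U `&` U'); split; [exact: openI|]. Qed.
Lemma supp_open_bigU (I : Type) (f : I -> set supp_pt) :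
  (forall i, supp_open (f i)) -> supp_open (\bigcup_i f i).
Proof.
move=> /choice [U UP]; exists (\bigcup_i U i); split.
  by apply: bigcup_open => i _; have [] := UP i.
by rewrite preimage_bigcup; apply: eq_bigcupr => i _; have [] := UP i.
Qed.
HB.instance Definition _ := isOpenTopological.Build supp_pt supp_openT supp_openI supp_open_bigU.

Lemma supp_embedding : closed_embedding (sval : supp_pt -> X).
Proof.
split.
- by apply/continuousP => V oV; exists V.
- by move=> [x px] [y py] /= xy; subst y; rewrite (Prop_irrelevance px py).
- rewrite -openC.
  have -> : ~` range (sval : supp_pt -> X) =
      \bigcup_(U in [set U : opens X | p U (1 : sec X U) = 0]) oset U.
    apply/seteqP; split=> x /=.
      move=> nx; apply: contrapT => ne; apply: nx.
      have sx : supp x by move=> U Ux e; apply: ne; exists U.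
      by exists (exist _ x sx).
    by move=> [U e Ux] [[y sy] _ /= yx]; subst y; exact: sy e.
  by apply: bigcup_open => U _; exact: oset_open.
- by move=> V; have [U [oU eV]] := oset_open V; exists (Opens oU).
Qed.

Hypothesis ps : lsurj p.
Hypothesis qE : quasi_coherent E.
Let goodE (U : opens X) (aU : aff U) : good E U := iffLR (quasi_coherentP E) qE U aU.
Local Notation emb := supp_embedding.
Local Notation pre := (preimage_opens (ce_continuous emb)).
Implicit Types U V W : opens X.

Lemma proj_unit_ideal W (a : sec X W) x : supp x -> p W a = 0 -> ~ germ_unit a x.
Proof.
move=> sx e [V [h [Vx [b eb]]]]; apply: (sx V Vx).
rewrite -eb; transitivity (p V (b *: (rres h a : msec (omod_str X) V))).
  by rewrite mulrC.
have pa : p V (rres h a) = 0.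
  transitivity (mres E h (p W a)); first exact: (ohom_res p h a).
  by rewrite e mres0.
by rewrite ohomZ pa scaler0.
Qed.

Lemma supp_off W (n n' : msec E W) : W `<=` ce_off emb -> n = n'.
Proof.
move=> Woff; apply: mres_ext => x Wx.
have nsx : ~ supp x by move=> sx; apply: (Woff _ Wx); exists (exist _ x sx).
have [U [Ux e]] : exists U, oset U x /\ p U (1 : sec X U) = 0.
  by apply: contrapT => ne; apply: nsx => U Ux e; apply: ne; exists U.
exists (opensI W U), capl; split=> //.
have z q : q = 0 :> msec E (opensI W U).
  rewrite -[q]scale1r (cyc_scale ps).
  have -> : p (opensI W U) (1 : sec X _) = 0.
    rewrite -(rmorph1 (rres (@opensIr _ W U))).
    transitivity (mres E (@opensIr _ W U) (p U (1 : sec X U))).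
      exact: (ohom_res p (@opensIr _ W U) (1 : sec X U)).
    by rewrite e mres0.
  exact: (mul0r (q : cyc_sec ps _)).
by rewrite (z (mres _ _ n)) (z (mres _ _ n')).
Qed.

Definition supp_space : ringedSpace.
Proof.
refine (@RingedSpace supp_pt (fun V : opens supp_pt => cyc_sec ps (shriek emb V) : comPzRingType)
  (fun (V W : opens supp_pt) h => cyc_res ps (shriekS (e := emb) h)) _ _ _).
- by move=> V h s; exact: mres_id.
- by move=> V W T h k l s; exact: mres_comp.
- exact: (shriek_sheaf supp_off).
Defined.
Local Notation S := supp_space.

Lemma supp_pre U : U `<=` shriek emb (pre U).
Proof. exact: shriek_max. Qed.

Lemma supp_sec_ex U (a : sec X U) :
  {s : sec S (pre U) | mres E (@supp_pre U) s = p U a}.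
Proof. by apply: cid; exact: (shriek_surj supp_off (@supp_pre U)). Qed.

Definition supp_sec_fun U (a : sec X U) := sval (supp_sec_ex a).
Lemma supp_sec_funE U (a : sec X U) : mres E (@supp_pre U) (supp_sec_fun a) = p U a.
Proof. exact: (svalP (supp_sec_ex a)). Qed.

Lemma supp_inj U (V : opens S) (h : U `<=` shriek emb V) (s t : sec S V) :
  V `<=` (sval : supp_pt -> X) @^-1` U -> mres E h s = mres E h t -> s = t.
Proof. exact: (shriek_inj supp_off). Qed.

Lemma supp_pre_inj U (s t : sec S (pre U)) :
  mres E (@supp_pre U) s = mres E (@supp_pre U) t -> s = t.
Proof. exact: supp_inj. Qed.

Lemma supp_secD U : {morph @supp_sec_fun U : a b / a + b}.
Proof.
move=> a b; apply: supp_pre_inj; rewrite supp_sec_funE.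
etransitivity; last by (symmetry; exact: (mresD (M := E))).
by rewrite !supp_sec_funE; exact: (ohomD p).
Qed.

Lemma supp_sec1 U : supp_sec_fun (1 : sec X U) = 1.
Proof. by apply: supp_pre_inj; rewrite supp_sec_funE; symmetry; exact: (cyc_res1 ps). Qed.

Lemma supp_secM U : {morph @supp_sec_fun U : a b / a * b}.
Proof.
move=> a b; apply: supp_pre_inj; rewrite supp_sec_funE.
etransitivity; last by (symmetry; exact: (cyc_res_mul (ps := ps))).
by rewrite !supp_sec_funE; exact: cyc_proj_mul.
Qed.

Definition supp_sec U : {rmorphism sec X U -> sec S (pre U)} :=
  make_rmorphism (@supp_secD U) (supp_sec1 U) (@supp_secM U).

Lemma supp_secE U (a : sec X U) V (h : V `<=` U) (k : V `<=` shriek emb (pre U)) :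
  mres E k (supp_sec U a) = p V (rres h a).
Proof.
rewrite -(mres_comp (@supp_pre U) h); transitivity (mres E h (p U a)).
  by congr (mres E h _); exact: (supp_sec_funE a).
by symmetry; exact: (ohom_res p h a).
Qed.

(** Lift an inverse of the image of [a] to a function b0 on X near the point. Then 1 - a * b0 lies
    in the kernel of p, so its germ at a point of the support is not invertible; as the stalk is
    local, a * b0 is invertible there, hence so is [a]. *)
Lemma supp_sec_local U (a : sec X U) (z : S) : oset U (sval z) ->
  germ_unit (supp_sec U a) z -> germ_unit a (sval z).
Proof.
move=> Uz [V [h [Vz [b eb]]]].
have xV : oset (shriek emb V) (sval z) by exact: (@pre_shriek _ _ _ emb V z Vz).
have [W [k [b0 [Wx eb0]]]] := ps (b : msec E (shriek emb V)) xV.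
pose G := opensI U W; have GU : G `<=` U := capl; have GW : G `<=` W := capr.
have GV : G `<=` shriek emb V := subset_trans GW k.
have Gz : oset G (sval z) by [].
pose c : sec X G := rres GU a * rres GW b0.
have ec : p G c = p G (1 : sec X G).
  have e1 : p G (rres GU a) = mres E GV (rres h (supp_sec U a)).
    have GG : G `<=` shriek emb (pre U) := subset_trans GU (@supp_pre U).
    rewrite -(supp_secE a GU GG); symmetry; exact: mres_comp.
  have e2 : p G (rres GW b0) = mres E GV b.
    by rewrite -(mres_comp k GW) -eb0; exact: (ohom_res p GW b0).
  rewrite /c (cyc_proj_mul ps) e1 e2 -cyc_res_mul.
  transitivity (mres E GV (1 : sec S V)); first by congr (mres E GV _); exact: eb.
  exact: (cyc_res1 ps).
have e0 : p G (1 - c) = 0.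
  by transitivity (p G (1 : sec X G) - p G c); [exact: (ohomB p) | rewrite ec subrr].
have u1 : germ_unit ((1 - c) + c) (sval z).
  rewrite subrK; exists G, sub_rfl; split=> //; rewrite rmorph1; exact: is_unit1.
have [u|u] := germD u1; first by case: (proj_unit_ideal (svalP z) e0 u).
by move: u => /germM [/(germ_res GU a Gz)].
Qed.

Definition supp_mor : morphism S X.
Proof.
refine (@Morphism S X (sval : supp_pt -> X) (ce_continuous emb) supp_sec _ _).
- move=> U V h k s; apply: (@supp_inj V _ (@supp_pre V)) => //.
  have VU : V `<=` shriek emb (pre U) := subset_trans h (@supp_pre U).
  rewrite (supp_secE _ (@subset_refl _ V)) rres_id -(supp_secE s h VU).
  symmetry; exact: mres_comp.
- exact: supp_sec_local.
Defined.

Lemma supp_sec_surj U (aU : aff U) (t : sec S (mor_preimage supp_mor U)) :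
  exists a, supp_sec U a = t.
Proof.
have gE := goodE aU.
have [a ea] := aff_lsurj aU (aff_good aU) gE ps (mres E (@supp_pre U) t).
by exists a; apply: (@supp_inj U _ (@supp_pre U)) => //; rewrite supp_sec_funE.
Qed.

Lemma supp_good U (aU : aff U) : good (omod_str S) (mor_preimage supp_mor U).
Proof.
have gE := goodE aU.
move=> b W h; have [a <-] := supp_sec_surj aU b => {b} eW.
have {}eW : W = mor_preimage supp_mor (nz a).
  by apply: opens_eq; rewrite eW -(nz_mor supp_mor).
have kU := @supp_pre U.
have kW : nz a `<=` shriek emb W by apply: shriek_max; rewrite eW.
have WW : W `<=` mor_preimage supp_mor (nz a) by rewrite eW.
have kn := subset_trans (nzS a) kU.
have rE n : mres E kW (rres h (supp_sec U a) ^+ n : sec S W) = p _ (rres (nzS a) a ^+ n).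
  have -> : rres h (supp_sec U a) ^+ n = rres h (supp_sec U (a ^+ n)) by rewrite !rmorphXn.
  have -> : rres (nzS a) a ^+ n = rres (nzS a) (a ^+ n) by rewrite rmorphXn.
  by rewrite -(supp_secE (a ^+ n) (nzS a) kn); exact: mres_comp.
split=> [m|m0 z0].
  have [m1 [n en]] := good_lift gE (nzS a) (mres E kW (m : msec E (shriek emb W))) erefl.
  have [m0 em0] := shriek_surj supp_off kU m1 (fun _ => id).
  exists m0, n; apply: (@supp_inj (nz a) W kW) => //.
  transitivity ((mres E kW (rres h (supp_sec U a) ^+ n : sec S W) : cyc_sec ps _) * mres E kW m).
    exact: (cyc_res_mul (ps := ps)).
  rewrite rE -(cyc_scale ps) en -em0 (mres_comp _ _ kn); symmetry; exact: mres_comp.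
have z1 : mres E (nzS a) (mres E kU m0) = 0.
  rewrite (mres_comp _ _ kn) -(mres_comp (shriekS (e := emb) h) kW).
  by rewrite (z0 : mres E (shriekS (e := emb) h) m0 = 0) mres0.
have [n en] := good_tors gE (erefl : oset (nz a) = nz a) z1.
exists n; apply: (@supp_inj U _ kU) => //.
transitivity ((mres E kU (supp_sec U a ^+ n : sec S _) : cyc_sec ps _) * mres E kU m0).
  exact: (cyc_res_mul (ps := ps)).
rewrite -rmorphXn (supp_secE (a ^+ n) (@subset_refl _ U) kU) rres_id.
by rewrite -(cyc_scale ps) en mres0.
Qed.

Lemma supp_chart (c : affine_chart X) : exists c' : affine_chart S,
  chart_open c' = mor_preimage supp_mor (chart_open c).
Proof.
set U := chart_open c; have aU : aff U := aff_chart c.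
have psiE (b : sec S (mor_preimage supp_mor U)) : exists f, b = supp_sec U (chart_hom c f).
  by have [a <-] := supp_sec_surj aU b; have [f ->] := chart_homE a; exists f.
have germE f (z : S) (q : spec (chart_ring c)) : chart_map q = sval z ->
    germ_unit (supp_sec U (chart_hom c f)) z <-> ~ prime_set q f.
  move=> eq; have Uz : oset U (sval z) by rewrite -eq; exact: chart_inU.
  by rewrite -chart_germ eq; exact: (mor_germ (f := supp_mor) _ Uz).
apply: affine_criterion.
- move=> r.
  have iq : is_ideal [set f | prime_set r (supp_sec U (chart_hom c f))].
    split=> [|f g rf rg|f g rg] /=.
    + by rewrite !rmorph0; apply: ideal0; exact: prime_is_ideal.
    + by rewrite !rmorphD; exact: (idealD (prime_is_ideal r)).
    + by rewrite !rmorphM; exact: (idealM (prime_is_ideal r)).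
  have q1 : ~ prime_set r (supp_sec U (chart_hom c 1)) by rewrite !rmorph1; exact: prime_proper.
  have qM f g : prime_set r (supp_sec U (chart_hom c (f * g))) ->
      prime_set r (supp_sec U (chart_hom c f)) \/ prime_set r (supp_sec U (chart_hom c g)).
    by rewrite !rmorphM; exact: prime_mul.
  pose q := Spec iq q1 qM.
  (* Were p 1 zero near this point, a power of some f outside q would kill p 1, hence have image 0
     in the quotient ring and lie in q. *)
  have sx : supp (chart_map q).
    move=> W Wx e1.
    have [f [fx fW]] := chart_basis (chart_inU q) Wx.
    move: fx; rewrite -nz_chart => fx.
    have nqf : ~ prime_set q f by apply/chart_germ.
    have gE := goodE aU.
    have fW' : nz (chart_hom c f) `<=` W by rewrite nz_chart.
    have : mres E (nzS (chart_hom c f)) (p U (1 : sec X U)) = 0.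
      transitivity (p _ (1 : sec X (nz (chart_hom c f)))).
        rewrite -(rmorph1 (rres (nzS (chart_hom c f)))); symmetry.
        exact: (ohom_res p (nzS (chart_hom c f)) (1 : sec X U)).
      rewrite -(rmorph1 (rres fW')).
      transitivity (mres E fW' (p W (1 : sec X W))); first exact: (ohom_res p fW' (1 : sec X W)).
      by rewrite e1 mres0.
    move=> /(good_tors gE erefl) [n en]; apply: nqf.
    apply: (@idealX1 _ q _ n) => /=.
    suff -> : supp_sec U (chart_hom c (f ^+ n)) = 0 by apply: ideal0; exact: prime_is_ideal.
    apply: (@supp_inj U _ (@supp_pre U)) => //; rewrite supp_sec_funE.
    transitivity (0 : msec E U); last by symmetry; exact: (mres0 E).
    rewrite -en rmorphXn.
    transitivity (p U (chart_hom c f ^+ n * 1)); first by rewrite mulr1.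
    exact: (ohomZ p (chart_hom c f ^+ n) (1 : sec X U)).
  exists (exist _ _ sx : S); split; first exact: chart_inU.
  by move=> b; have [f ->] := psiE b; exact: (germE f (exist _ _ sx) q erefl).
- move=> z Uz; have [q eq] := chart_pt Uz.
  have key b f : b = supp_sec U (chart_hom c f) -> ~ germ_unit b z <-> prime_set q f.
    by move=> ->; rewrite (germE f z q eq); split=> [/contrapT|pf]; [|exact].
  have iI : is_ideal [set b : sec S (mor_preimage supp_mor U) | ~ germ_unit b z].
    split=> [|a b|a b] /=.
    + by apply/(key _ 0); rewrite ?rmorph0 //; apply: ideal0; exact: prime_is_ideal.
    + have [f ea] := psiE a; have [g eb] := psiE b.
      move=> /(key _ _ ea) qf /(key _ _ eb) qg; apply/(key _ (f + g)).
        by rewrite !rmorphD ea eb.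
      exact: (idealD (prime_is_ideal q)).
    + have [f ea] := psiE a; have [g eb] := psiE b.
      move=> /(key _ _ eb) qg; apply/(key _ (f * g)); first by rewrite !rmorphM ea eb.
      exact: (idealM (prime_is_ideal q)).
  have n1 : ~ ~ germ_unit (1 : sec S (mor_preimage supp_mor U)) z.
    by move/(key _ 1); rewrite !rmorph1 => /(_ erefl); exact: prime_proper.
  have nM (a b : sec S (mor_preimage supp_mor U)) : ~ germ_unit (a * b) z ->
      ~ germ_unit a z \/ ~ germ_unit b z.
    move=> nab; apply: contrapT => /not_orP [/contrapT ua /contrapT ub].
    by apply: nab; apply/germM.
  exists (Spec iI n1 nM) => b /=; split=> [ub|]; [exact | exact: contrapT].
- move=> z z' Uz Uz' zz'; have [q eq] := chart_pt Uz; have [q' eq'] := chart_pt Uz'.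
  suff qq : q = q'.
    by apply: (ce_inj emb); apply: (etrans (esym eq)); rewrite qq.
  apply: spec_eq => f; have := zz' (supp_sec U (chart_hom c f)).
  rewrite (germE f z q eq) (germE f z' q' eq') => -[H H'].
  by split=> ?; apply: contrapT => ?; [exact: H' | exact: H].
- move=> W z Wz Uz; have [G eG] := ce_preimage emb W.
  have Gz : oset G (sval z) by move: Wz; rewrite eG.
  have [a [az aG]] := aff_basis aU Gz Uz.
  exists (supp_sec U a); have -> : nz (supp_sec U a) = mor_preimage supp_mor (nz a).
    exact: (nz_mor supp_mor).
  by split=> // y ay; rewrite eG; exact: aG.
- exact: supp_good.
Qed.

Definition supp_scheme : scheme.
Proof.
exists S => z; have [c cz] := scheme_cover (sval z).
by have [c' e] := supp_chart c; exists c'; rewrite e.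
Defined.

Lemma supp_closed_immersion : closed_immersion (supp_mor : morphism supp_scheme X).
Proof.
split.
- exact: (ce_inj emb).
- exact: (ce_closed emb).
- by move=> V [U [oU eV]]; exists U.
- move=> U t x Ux.
  have [V [h [s [Vx es]]]] := ps (mres E (@supp_pre U) t) Ux.
  exists V, s, (mor_preimageS (f := supp_mor) h); split=> //.
  apply: (@supp_inj V _ (@supp_pre V)) => //; rewrite [LHS]supp_sec_funE es.
  rewrite (mres_comp _ _ (h >=> (@supp_pre U))); symmetry; exact: mres_comp.
Qed.

Theorem closed_subscheme_of_quotient : exists Z : closed_subscheme X,
  forall U (a : sec X U), sub_ideal Z U a <-> p U a = 0.
Proof.
exists (ClosedSubscheme supp_closed_immersion) => U a /=.
rewrite -[p U a]supp_sec_funE; split=> [e|e].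
  by rewrite (e : supp_sec_fun a = 0); exact: mres0.
by apply: (@supp_inj U _ (@supp_pre U)) => //; rewrite [LHS]e; symmetry; exact: mres0.
Qed.

End Support.

(** * Sections of powers of a line bundle *)

Section Generators.
Variable X : ringedSpace.
Implicit Types (U V W : opens X) (M N P L Q : omod X).

Definition generator M U (e : msec M U) : Prop :=
  forall V (h : V `<=` U), bijective (fun a : sec X V => a *: mres M h e).

Lemma generator_res M U (e : msec M U) V (h : V `<=` U) : generator e -> generator (mres M h e).
Proof.
move=> ge W k; have [g gK Kg] := ge W (k >=> h).
by exists g => a; rewrite (mres_comp _ _ (k >=> h)).
Qed.

Section Coordinates.
Variables (M : omod X) (U : opens X) (e : msec M U).
Hypothesis ge : generator e.

Lemma coord_ex V (h : V `<=` U) (m : msec M V) : {a : sec X V | a *: mres M h e = m}.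
Proof. by apply: cid; have [g _ Kg] := ge h; exists (g m). Qed.
Definition coord V (h : V `<=` U) m := sval (coord_ex h m).
Lemma coordE V (h : V `<=` U) m : coord h m *: mres M h e = m.
Proof. exact: (svalP (coord_ex h m)). Qed.
Lemma coord_reflE m : coord (@subset_refl _ U) m *: e = m.
Proof. by have := coordE (@subset_refl _ U) m; rewrite mres_id. Qed.
Lemma coord_inj V (h : V `<=` U) (a b : sec X V) : a *: mres M h e = b *: mres M h e -> a = b.
Proof. by move/(bij_inj (ge h)). Qed.
Lemma coordP V (h : V `<=` U) a m : a *: mres M h e = m -> coord h m = a.
Proof. by move=> em; apply: (coord_inj (h := h)); rewrite coordE. Qed.
Lemma coord_linear V (h : V `<=` U) a m n : coord h (a *: m + n) = a * coord h m + coord h n.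
Proof. by apply: coordP; rewrite scalerDl -scalerA !coordE. Qed.
Lemma coord_res V W (h : V `<=` U) (k : W `<=` V) (l : W `<=` U) m :
  coord l (mres M k m) = rres k (coord h m).
Proof.
apply: coordP; rewrite -(mres_comp h k l) -mresZ; congr (mres M k _); exact: coordE.
Qed.
End Coordinates.

Lemma omod_restrictE U M V W (h : W `<=` V) (m : msec (omod_restrict U M) V) :
  mres (omod_restrict U M) h m = mres M (omod_restrict_res (U := U) h) m.
Proof. by []. Qed.

Definition omod_restr_proj U M : ohom M (omod_restrict U M).
Proof.
exists (fun V m => mres M (@opensIr _ U V) m).
- by move=> V a m n; rewrite mresP.
- move=> V W h m; rewrite (mres_comp _ _ ((@opensIr _ U W) >=> h)).
  by rewrite omod_restrictE (mres_comp _ _ ((@opensIr _ U W) >=> h)).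
Defined.

Lemma obilZl P L Q (b : obilinear P L Q) V a (m : msec P V) n :
  obil_fun b V (a *: m) n = a *: obil_fun b V m n.
Proof.
have bl := obil_linearl b n.
have b0 : obil_fun b V 0 n = 0.
  by apply: (@addIr _ (obil_fun b V 0 n)); have := bl 1 0 0; rewrite !scale1r !add0r.
by rewrite -[a *: m]addr0 bl b0 addr0.
Qed.

Lemma obilZr P L Q (b : obilinear P L Q) V a (m : msec P V) n :
  obil_fun b V m (a *: n) = a *: obil_fun b V m n.
Proof.
have bl := obil_linearr b m.
have b0 : obil_fun b V m 0 = 0.
  by apply: (@addIr _ (obil_fun b V m 0)); have := bl 1 0 0; rewrite !scale1r !add0r.
by rewrite -[a *: n]addr0 bl b0 addr0.
Qed.

(* Testing against j_* j^* O_X and j_* j^* Q, for j the inclusion of U, makes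
   the universal property of a tensor product local. *)
Lemma tensor_generator P L Q (beta : obilinear P L Q) U (p : msec P U) (e : msec L U) :
  (forall (R : omod X) (b : obilinear P L R), exists! h : ohom Q R,
     forall U m n, h U (obil_fun beta U m n) = obil_fun b U m n) ->
  generator p -> generator e -> generator (obil_fun beta U p e).
Proof.
move=> univ gp ge.
pose Il V : opensI U V `<=` U := @opensIl _ U V.
pose Ir V : opensI U V `<=` V := @opensIr _ U V.
pose q := obil_fun beta U p e.
(* The map h reads off the coordinate with respect to q: on the tensor of m and n it is the product
   of their coordinates. *)
have [h [hP _]] : exists! h : ohom Q (omod_restrict U (omod_str X)), forall V m n,
    h V (obil_fun beta V m n) =
    coord gp (Il V) (mres P (Ir V) m) * coord ge (Il V) (mres L (Ir V) n).
  unshelve eapply (univ (omod_restrict U (omod_str X)) (@OBilinear X P L (omod_restrict U (omod_str X))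
    (fun V m n => coord gp (Il V) (mres P (Ir V) m) * coord ge (Il V) (mres L (Ir V) n)) _ _ _)).
  - move=> V n a m m'; rewrite mresP coord_linear mulrDl -mulrA //.
  - move=> V m a n n'; rewrite mresP coord_linear mulrDr mulrCA //.
  - move=> V W k m n.
    have kk : opensI U W `<=` opensI U V by exact: setIS.
    rewrite !(mres_comp _ _ (kk >=> (Ir V))) -!(mres_comp (Ir V) kk).
    rewrite (coord_res gp (Il V) kk (Il W)) (coord_res ge (Il V) kk (Il W)) -rmorphM.
    by congr (rres _ _); exact: Prop_irrelevance.
pose r2fun V (t : msec Q V) : msec (omod_restrict U Q) V :=
  (h V t : sec X (opensI U V)) *: mres Q (Il V) q.
have r2lin V : linear (@r2fun V).
  move=> a m n; rewrite /r2fun.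
  have -> : h V (a *: m + n) = rres (Ir V) a * (h V m : sec X (opensI U V)) + (h V n : sec X (opensI U V))
    :> sec X (opensI U V) by rewrite ohom_linear.
  by rewrite scalerDl -scalerA.
have r2res V W (k : W `<=` V) (t : msec Q V) :
    r2fun W (mres Q k t) = mres (omod_restrict U Q) k (r2fun V t).
  by rewrite /r2fun ohom_res [RHS]omod_restrictE mresZ (mres_comp _ _ (Il W)).
pose r2 := OHom r2lin r2res.
(* Restricting t to U and multiplying q by h(t) give the same result on tensors, hence are equal by
   the uniqueness in the universal property. So q generates, with coordinate h. *)
have e12 : omod_restr_proj U Q = r2.
  have @b2 : obilinear P L (omod_restrict U Q).
    exists (fun V m n => mres Q (Ir V) (obil_fun beta V m n)).
    - by move=> V n a m m'; rewrite obil_linearl mresP.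
    - by move=> V m a n n'; rewrite obil_linearr mresP.
    - move=> V W k m n; rewrite obil_res (mres_comp _ _ ((Ir W) >=> k)).
      by rewrite omod_restrictE (mres_comp _ _ ((Ir W) >=> k)).
  have [h0 [_ u]] := univ _ b2.
  rewrite -(u (omod_restr_proj U Q)) // -(u r2) // => V m n /=.
  rewrite /r2fun hP -obil_res -scalerA.
  have -> : mres Q (Il V) q = obil_fun beta _ (mres P (Il V) p) (mres L (Il V) e) by rewrite obil_res.
  by rewrite -obilZr coordE -obilZl coordE.
have key V (t : msec Q V) : mres Q (Ir V) t = (h V t : sec X (opensI U V)) *: mres Q (Il V) q.
  exact: (congr1 (fun g : ohom Q (omod_restrict U Q) => g V t) e12).
move=> V k; have kI : V `<=` opensI U V by move=> x Vx; split=> //; exact: k.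
exists (fun t => rres kI (h V t)) => [a|t]; last first.
  have := congr1 (mres Q kI) (key V t).
  by rewrite mresZ (mres_comp _ _ k) (mres_comp _ _ (@subset_refl _ V)) mres_id => <-.
have hq : h V (mres Q k q) = (1 : sec X (opensI U V)).
  rewrite /q -obil_res hP.
  have c1 : coord gp (Il V) (mres P (Ir V) (mres P k p)) = 1.
    by apply: coordP; rewrite scale1r (mres_comp _ _ (Il V)).
  have c2 : coord ge (Il V) (mres L (Ir V) (mres L k e)) = 1.
    by apply: coordP; rewrite scale1r (mres_comp _ _ (Il V)).
  by rewrite c1 c2 mulr1.
transitivity (rres kI (rres (Ir V) a * 1)); first by rewrite ohomZ hq.
by rewrite mulr1 (rres_comp _ _ (@subset_refl _ V)) rres_id.
Qed.

(** The map [gam] sends e to its n-th tensor power; it is homogeneous of degree n instead of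
    additive. *)
Lemma tensor_power_generator L n P : tensor_power L n P ->
  exists gam : forall U, msec L U -> msec P U,
  [/\ forall U (e : msec L U), generator e -> generator (gam U e),
      forall U V (h : V `<=` U) (e : msec L U), gam V (mres L h e) = mres P h (gam U e) &
      forall U (a : sec X U) (e : msec L U), gam U (a *: e) = a ^+ n *: gam U e].
Proof.
elim=> {n P} [|n P Q _ [gam [gg gr gs]] [beta univ]].
  by exists (fun U e => e); split.
exists (fun U e => obil_fun beta U (gam U e) e); split.
- by move=> U e ge; apply: tensor_generator => //; exact: gg.
- by move=> U V h e; rewrite gr obil_res.
- by move=> U a e; rewrite gs obilZl obilZr scalerA exprSr.
Qed.

(* [sig U e] is the ratio of s to the n-th power of the generator e. *)
Lemma section_coord L n P (s : msec P (opensT X)) : tensor_power L n P ->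
  exists sig : forall U, msec L U -> sec X U,
  [/\ forall U V (h : V `<=` U) (e : msec L U), generator e -> sig V (mres L h e) = rres h (sig U e),
      forall U (a : sec X U) (e : msec L U), generator e -> generator (a *: e) ->
        sig U e = a ^+ n * sig U (a *: e) &
      forall U (e : msec L U) x, generator e -> oset U x ->
        nonvanishing s x <-> germ_unit (sig U e) x].
Proof.
move=> /tensor_power_generator [gam [gg gr gs]].
have T U : U `<=` opensT X by [].
have sigE U (e : msec L U) : {a : sec X U | generator e -> a *: gam U e = mres P (T U) s}.
  apply: cid; have [ge|nge] := pselect (generator e); last by exists 0.
  exists (coord (gg U e ge) (@subset_refl _ U) (mres P (T U) s)) => _.
  exact: coord_reflE.
pose sig U e := sval (sigE U e).
have sigP U e : generator e -> sig U e *: gam U e = mres P (T U) s := svalP (sigE U e).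
have inj U (e : msec L U) (a b : sec X U) : generator e -> a *: gam U e = b *: gam U e -> a = b.
  move=> ge ab; apply: (coord_inj (gg U e ge) (h := @subset_refl _ U)).
  by rewrite mres_id.
exists sig; split.
- move=> U V h e ge; apply: (inj V (mres L h e)); first exact: generator_res.
  by rewrite sigP; [rewrite gr -mresZ sigP // (mres_comp _ _ (T V)) | exact: generator_res].
- move=> U a e ge gae; apply: (inj U e) => //.
  by rewrite sigP // mulrC -scalerA -gs sigP.
- move=> U e x ge Ux; split=> [nv|[V [h [Vx [c ec]]]] W t Wx].
    have [V [h [k [a [Vx ea]]]]] := nv U (gam U e) Ux.
    exists V, h; split=> //; exists a.
    apply: (inj V (mres L h e)); first exact: generator_res.
    rewrite scale1r gr mulrC -scalerA -mresZ sigP // (mres_comp _ _ k).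
    by rewrite -ea.
  pose I := opensI W V; have Il : I `<=` W := capl; have Ir : I `<=` V := capr.
  have IU := subset_trans Ir h.
  pose gI := gg _ _ (generator_res IU ge).
  exists I, Il, (T I), (coord gI (@subset_refl _ I) (mres P Il t) * rres Ir c); split=> //.
  have -> : mres P (T I) s = rres IU (sig U e) *: gam I (mres L IU e).
    by rewrite gr -mresZ sigP // (mres_comp _ _ (T I)).
  rewrite scalerA -mulrA -(rres_comp h Ir) -rmorphM [c * _]mulrC ec rmorph1 mulr1.
  by rewrite coord_reflE.
Qed.

End Generators.

(** * An atlas from an ample line bundle *)

(* Affine open sets U_i on which a section s_i of a power of an ample line
   bundle generates it; a i j stands for the ratio s_j / s_i. *)
Record ample_atlas (X : scheme) := AmpleAtlas {
  at_idx : finType;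
  at_open :> at_idx -> opens X;
  at_aff : forall i, aff (at_open i);
  at_cover : forall x : X, exists i, oset (at_open i) x;
  at_ratio : forall i j : at_idx, sec X (at_open i);
  at_inter : forall i j, oset (opensI (at_open i) (at_open j)) = nz (at_ratio i j);
  at_ratio1 : forall i, at_ratio i i = 1;
  at_ratioM : forall i j k (V : opens X) (h : V `<=` at_open i) (l : V `<=` at_open j),
    rres h (at_ratio i j) * rres l (at_ratio j k) = rres h (at_ratio i k) }.

Section Atlas.
Variable X : scheme.
Implicit Types U V W : opens X.

Lemma noetherian_quasi_compact (noethX : noetherian_scheme X) (N : X -> opens X) :
  (forall x, oset (N x) x) -> exists s : seq X, forall y, exists2 x, x \in s & oset (N x) y.
Proof.
move=> Nx; have [n [c [cov _]]] := noethX.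
pose fc (A : set X) := exists s : seq X, forall y, A y -> exists2 x, x \in s & oset (N x) y.
have fcU A B : fc A -> fc B -> fc (A `|` B).
  move=> [s sP] [t tP]; exists (s ++ t) => y [/sP|/tP] [x xs xy];
    by exists x => //; rewrite mem_cat xs ?orbT.
have fc0 : fc set0 by exists [::].
have fcc i : fc (chart_open (c i)).
  have aU := aff_chart (c i).
  have [s [sP cs]] := @aff_finite X _ (fun f => exists x, nz f `<=` N x) aU
      (fun x Ux => let: ex_intro a (conj ax aN) := aff_basis aU (Nx x) Ux in
        ex_intro _ a (conj (ex_intro _ x aN) ax)).
  suff : fc [set y | exists2 f, f \in s & oset (nz f) y].
    by move=> [t tP]; exists t => y /cs; exact: tP.
  elim: s sP {cs} => [|f s IH] sP; first by exists [::] => y [].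
  have [|t tP] := IH; first by move=> g gs; apply: sP; rewrite inE gs orbT.
  have [|x xf] := sP f; first by rewrite inE eqxx.
  exists (x :: t) => y [g]; rewrite inE => /orP [/eqP -> /xf|gs gy].
    by exists x => //; rewrite inE eqxx.
  by have [z zt zy] := tP y (ex_intro2 _ _ g gs gy); exists z => //; rewrite inE zt orbT.
have : fc [set y | exists2 i, i \in enum 'I_n & oset (chart_open (c i)) y].
  elim: (enum 'I_n) => [|i r [t tP]]; first by exists [::] => y [].
  have [u uP] := fcc i; exists (u ++ t) => y [j]; rewrite inE => /orP [/eqP ->|jr] jy.
    by have [z zu zy] := uP y jy; exists z => //; rewrite mem_cat zu.
  by have [z zt zy] := tP y (ex_intro2 _ _ j jr jy); exists z => //; rewrite mem_cat zt orbT.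
move=> [s sP]; exists s => y; apply: sP; have [i yi] := cov y.
by exists i => //; rewrite mem_enum.
Qed.

(** Ampleness yields sections of powers of L of various degrees [n x]. With [n0] the product of the
    finitely many degrees that occur, raising to the power [m x] brings them all to degree [n0].
    Their ratios are then functions, independent of the generator e used to compute them: another
    generator multiplies both coordinates by the same [n0]-th power. *)
Lemma ample_atlas_ex (noethX : noetherian_scheme X) (L : omod X) : ample L ->
  inhabited (ample_atlas X).
Proof.
move=> [lb amp].
have gen_ex x : exists U (e : msec L U), oset U x /\ generator e by exact: lb.
have gen_ex_in x V : oset V x -> exists U (e : msec L U), [/\ oset U x, U `<=` V & generator e].
  move=> Vx; have [U [e [Ux ge]]] := gen_ex x.
  exists (opensI V U), (mres L (@opensIr _ V U) e); split=> //; first exact: opensIl.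
  exact: generator_res.
pose good_data x (D : nat * (forall U, msec L U -> sec X U) * opens X) :=
  let: (n, sig, N) := D in
  [/\ (0 < n)%N, oset N x, aff N,
      forall U V (h : V `<=` U) (e : msec L U), generator e -> sig V (mres L h e) = rres h (sig U e) &
      (forall U (a : sec X U) (e : msec L U), generator e -> generator (a *: e) ->
        sig U e = a ^+ n * sig U (a *: e)) /\
      (forall U (e : msec L U) y, generator e -> oset U y -> oset N y <-> germ_unit (sig U e) y)].
have /choice [D DP] : forall x, exists D, good_data x D.
  move=> x; have [n [P [s [n0 tp nv [c ec]]]]] := amp x.
  have [sig [sr ss sn]] := section_coord s tp.
  exists (n, sig, chart_open c); split=> //.
  - by rewrite -ec.
  - exact: aff_chart.
  - by split=> // U e y ge Uy; rewrite -ec; exact: sn.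
pose n x := (D x).1.1; pose sig x := (D x).1.2; pose N x := (D x).2.
have nP x : (0 < n x)%N by rewrite /n; have := DP x; case: (D x) => [[? ?] ?] [].
have Nx x : oset (N x) x by rewrite /N; have := DP x; case: (D x) => [[? ?] ?] [].
have Na x : aff (N x) by rewrite /N; have := DP x; case: (D x) => [[? ?] ?] [].
have sr x U V (h : V `<=` U) (e : msec L U) : generator e ->
    sig x V (mres L h e) = rres h (sig x U e).
  by rewrite /sig; have := DP x; case: (D x) => [[? ?] ?] [_ _ _ + _]; exact.
have ss x U (a : sec X U) (e : msec L U) : generator e -> generator (a *: e) ->
    sig x U e = a ^+ n x * sig x U (a *: e).
  by rewrite /sig /n; have := DP x; case: (D x) => [[? ?] ?] [_ _ _ _ [+ _]]; exact.
have sn x U (e : msec L U) y : generator e -> oset U y -> oset (N x) y <-> germ_unit (sig x U e) y.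
  by rewrite /sig /N; have := DP x; case: (D x) => [[? ?] ?] [_ _ _ _ [_ +]]; exact.
have [s cs] := noetherian_quasi_compact noethX Nx.
pose n0 := (\prod_(x <- s) n x)%N; pose m x := (n0 %/ n x)%N.
have n0P : (0 < n0)%N by apply: prodn_gt0.
have mP x : x \in s -> (n x * m x = n0)%N.
  move=> xs; rewrite mulnC divnK //; rewrite /n0 (big_rem x xs) /=; exact: dvdn_mulr.
have m0 x : x \in s -> (0 < m x)%N.
  by move=> xs; move: n0P; rewrite -(mP x xs) muln_gt0 => /andP [].
(* [tau x U e] is the ratio of the [m x]-th power of the section attached to
   x, a section of the [n0]-th power of L, to the [n0]-th power of e. *)
pose tau x U (e : msec L U) := sig x U e ^+ m x.
have taur x U V (h : V `<=` U) (e : msec L U) : generator e -> tau x V (mres L h e) = rres h (tau x U e).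
  by move=> ge; rewrite /tau sr // rmorphXn.
have taus x U (a : sec X U) (e : msec L U) : x \in s -> generator e -> generator (a *: e) ->
    tau x U e = a ^+ n0 * tau x U (a *: e).
  by move=> xs ge gae; rewrite /tau (ss x U a e) // exprMn -exprM mP.
have taun x U (e : msec L U) y : x \in s -> generator e -> oset U y ->
    oset (N x) y <-> germ_unit (tau x U e) y.
  move=> xs ge Uy; rewrite (sn x U e y) // /tau; split; first exact: germX.
  by rewrite -{1}(prednK (m0 x xs)) exprS => /germM [].
have tauu x U (e : msec L U) : x \in s -> generator e -> U `<=` N x -> is_unit (tau x U e).
  move=> xs ge UN; rewrite -[tau x U e](rres_id (@subset_refl _ U)); apply: unit_nz.
  by move=> y Uy; apply/taun => //; exact: UN.
have ratio_ex x y : x \in s -> y \in s -> exists a : sec X (N x),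
    forall V (h : V `<=` N x) (e : msec L V), generator e -> rres h a * tau x V e = tau y V e.
  move=> xs ys.
  have [|||a aP] := sheaf_glue (@rres_comp X) (@rres_sheaf X) (U := N x) (P := fun V q =>
      exists e : msec L V, generator e /\ q * tau x V e = tau y V e).
  - move=> V W h k q [e [ge eq]]; exists (mres L k e); split; first exact: generator_res.
    by rewrite !taur // -rmorphM eq.
  - move=> V h q q' [e [ge eq]] [e' [ge' eq']].
    pose a := coord ge (@subset_refl _ V) e'.
    have ea : a *: e = e' by exact: coord_reflE.
    have ga : generator (a *: e) by rewrite ea.
    have := eq; rewrite (taus x _ a) // (taus y _ a) // ea -eq' => e2.
    apply: (is_unit_mulI (tauu x V e xs ge h)); rewrite (taus x _ a) // ea.
    by rewrite [LHS]mulrC e2 -mulrA [q' * _]mulrC.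
  - move=> z /gen_ex_in [U [e [Uz UN ge]]].
    have [c ec] := tauu x U e xs ge UN.
    exists U, UN, (tau y U e * c); split=> //; exists e; split=> //.
    by rewrite -mulrA [c * _]mulrC ec mulr1.
  exists a => V h e ge; have [c ec] := tauu x V e xs ge h.
  rewrite (aP V h (tau y V e * c)); first by rewrite -mulrA [c * _]mulrC ec mulr1.
  by exists e; split=> //; rewrite -mulrA [c * _]mulrC ec mulr1.
pose idx := 'I_(size s); pose pt (i : idx) := tnth (in_tuple s) i.
have pts i : pt i \in s by exact: mem_tnth.
have ratioE (i j : idx) : {a : sec X (N (pt i)) | forall V (h : V `<=` N (pt i)) (e : msec L V),
   generator e -> rres h a * tau (pt i) V e = tau (pt j) V e}.
  by apply: cid; exact: ratio_ex.
constructor; unshelve eapply (@AmpleAtlas X idx (fun i => N (pt i)) (fun i => Na (pt i)) _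
  (fun i j => sval (ratioE i j))).
- move=> y; have [x xs xy] := cs y.
  have [i ei] := tnthP (in_tuple s) x xs.
  by exists i; rewrite /pt -ei.
- move=> i j /=; case: (ratioE i j) => a aP /=; apply/seteqP; split=> y.
    move=> [yi yj]; have [U [e [Uy UN ge]]] := gen_ex_in y _ yi.
    apply/(germ_res UN a Uy).
    have : germ_unit (tau (pt j) U e) y by apply/taun.
    by rewrite -(aP U UN e ge) => /germM [].
  move=> ay; have yi := nzS _ _ ay; split=> //.
  have [U [e [Uy UN ge]]] := gen_ex_in y _ yi.
  apply/(taun (pt j) U e) => //; rewrite -(aP U UN e ge); apply/germM; split.
    by apply/germ_res.
  by apply/(taun (pt i) U e).
- move=> i; case: (ratioE i i) => a aP /=.
  apply: rres_ext => y /gen_ex_in [U [e [Uy UN ge]]].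
  exists U, UN; split=> //; rewrite rmorph1.
  have [c ec] := tauu (pt i) U e (pts i) ge UN.
  by rewrite -[LHS]mulr1 -ec mulrA aP.
- move=> i j k V h l /=; case: (ratioE i j) => a aP; case: (ratioE j k) => b bP.
  case: (ratioE i k) => c cP /=.
  apply: rres_ext => y Vy.
  have [U [e [Uy UV ge]]] := gen_ex_in y V Vy.
  exists U, UV; split=> //.
  have Ui := subset_trans UV h; have Uj := subset_trans UV l.
  rewrite rmorphM (rres_comp _ _ Ui) (rres_comp _ _ Uj) (rres_comp _ _ Ui).
  apply: (is_unit_mulI (tauu (pt i) U e (pts i) ge Ui)).
  by rewrite [RHS]mulrC cP // mulrC mulrAC aP // mulrC bP.
Qed.

End Atlas.

(** * Twists and the ideal of a closed subspace *)

Section Twist.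
Variables (X : scheme) (At : ample_atlas X).
Implicit Types (U V W : opens X) (N M : omod X).
Local Notation idx := (at_idx At).
Local Notation a_ := (@at_ratio X At).

(** Transition functions of a line bundle: [cc1] and [ccM] make g_ji an inverse of g_ij. *)
Record cocycle := Cocycle {
  cc :> forall i j : idx, sec X (opensI (At i) (At j));
  cc1 : forall i, cc i i = 1;
  ccM : forall i j k V (h : V `<=` opensI (At i) (At j)) (l : V `<=` opensI (At j) (At k))
    (m : V `<=` opensI (At i) (At k)), rres h (cc i j) * rres l (cc j k) = rres m (cc i k) }.

Definition pos_cocycle (n : nat) : cocycle.
Proof.
exists (fun i j => rres (@opensIl _ (At i) (At j)) (a_ i j) ^+ n).
- by move=> i; rewrite at_ratio1 rmorph1 expr1n.
- move=> i j k V h l m.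
  have hi := subset_trans h capl; have hj := subset_trans l capl.
  rewrite !rmorphXn (rres_comp _ _ hi) (rres_comp _ _ hj) (rres_comp _ _ hi) -exprMn.
  by rewrite at_ratioM.
Defined.

(** On the overlap a_ji is the inverse of a_ij, so this is the inverse of [pos_cocycle n], written
    without division. *)
Definition neg_cocycle (n : nat) : cocycle.
Proof.
exists (fun i j => rres (@opensIr _ (At i) (At j)) (a_ j i) ^+ n).
- by move=> i; rewrite at_ratio1 rmorph1 expr1n.
- move=> i j k V h l m.
  have hj := subset_trans h capr; have hk := subset_trans l capr.
  rewrite !rmorphXn (rres_comp _ _ hj) (rres_comp _ _ hk) (rres_comp _ _ hk) -exprMn.
  by rewrite mulrC at_ratioM.
Defined.

Lemma atlas_ext N V (m m' : msec N V) :
  (forall i W (k : W `<=` V), W `<=` At i -> mres N k m = mres N k m') -> m = m'.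
Proof.
move=> mm; apply: mres_ext => x Vx; have [i xi] := at_cover At x.
by exists (opensI V (At i)), capl; split=> //; apply: (mm i); exact: opensIr.
Qed.

Section TwistBy.
Variables (g : cocycle) (N : omod X).

(* Families of n_i on U_i with n_i = g_ij n_j.  With [pos_cocycle n] they are
   the coordinates of sections of N(n) relative to the n-th powers of the s_i. *)
Definition twist_sub : subsheaf (omod_prod (fun i : idx => omod_restrict (At i) N)).
Proof.
exists (fun U (n : forall i, msec N (opensI (At i) U)) => forall i j V
   (hi : V `<=` opensI (At i) U) (hj : V `<=` opensI (At j) U) (h : V `<=` opensI (At i) (At j)),
   mres N hi (n i) = rres h (g i j) *: mres N hj (n j)).
- move=> U i j V hi hj h.
  by rewrite [LHS](mres0 N) [X in _ *: X](mres0 N) scaler0.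
- move=> U a m n Hm Hn i j V hi hj h.
  have E k (hk : V `<=` opensI (At k) U) (hV : V `<=` U) :
      mres N hk ((a *: m + n : prod_sec _ _) k) = rres hV a *: mres N hk (m k) + mres N hk (n k).
    etransitivity; first exact: (mresP (o := N)).
    by rewrite (rres_comp _ _ hV).
  have hV := subset_trans hi capr.
  by rewrite !(E _ _ hV) (Hm i j V hi hj h) (Hn i j V hi hj h) scalerDr !scalerA mulrC.
- move=> U U' k n Hn i j V hi hj h.
  have E l (hl : V `<=` opensI (At l) U') (hl' : V `<=` opensI (At l) U) :
      mres N hl (mres (omod_restrict (At l) N) k (n l)) = mres N hl' (n l) by exact: mres_comp.
  have kk l : opensI (At l) U' `<=` opensI (At l) U by exact: setIS.
  rewrite (E i hi (hi >=> (kk i))) (E j hj (hj >=> (kk j))); exact: Hn.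
- move=> U n loc i j V hi hj h; apply: mres_ext => x Vx.
  have [_ Ux] := hi x Vx; have [W [k [Wx HW]]] := loc x Ux.
  pose P := opensI V W; have PV : P `<=` V := capl; have PW : P `<=` W := capr.
  have Pl l : V `<=` At l -> P `<=` opensI (At l) W by move=> Vl y [Vy Wy]; split=> //; exact: Vl.
  have Pi := Pl i (hi >=> capl); have Pj := Pl j (hj >=> capl).
  exists P, PV; split=> //.
  have E l (hl : V `<=` opensI (At l) U) (hl' : P `<=` opensI (At l) W) :
      mres N PV (mres N hl (n l)) = mres N hl' (mres (omod_restrict (At l) N) k (n l)).
    rewrite (mres_comp _ _ (PV >=> hl)); symmetry; exact: mres_comp.
  rewrite mresZ (E i hi Pi) (E j hj Pj) (rres_comp _ _ (PV >=> h)).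
  exact: (HW i j P Pi Pj (PV >=> h)).
Defined.

Definition twist : omod X := omod_sub twist_sub.

Lemma twist_in i V : V `<=` At i -> V `<=` opensI (At i) V.
Proof. by move=> h x Vx; split=> //; exact: h. Qed.

(* The coordinate of a section of the twist in the i-th trivialization. *)
Definition tco i V (h : V `<=` At i) (t : msec twist V) : msec N V :=
  mres N (twist_in h) (sval t i).

Lemma tcoP i V (h : V `<=` At i) a t u : tco h (a *: t + u) = a *: tco h t + tco h u.
Proof.
etransitivity; first exact: (mresP (o := N)).
by rewrite (rres_comp _ _ (@subset_refl _ V)) rres_id.
Qed.

Lemma tcoZ i V (h : V `<=` At i) a t : tco h (a *: t) = a *: tco h t.
Proof.
have t0 : tco h 0 = 0 by apply: (@addIr _ (tco h 0)); have := tcoP h 1 0 0; rewrite !scale1r !add0r.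
by rewrite -[a *: t]addr0 tcoP t0 addr0.
Qed.

Lemma tco0 i V (h : V `<=` At i) : tco h 0 = 0.
Proof. by rewrite -(scale0r (0 : msec twist V)) tcoZ scale0r. Qed.

Lemma tco_res i V W (h : V `<=` At i) (k : W `<=` V) (l : W `<=` At i) t :
  tco l (mres twist k t) = mres N k (tco h t).
Proof.
rewrite /tco (mres_comp _ _ (k >=> (twist_in h))); exact: (mres_comp (o := N)).
Qed.

Lemma tco_change i j V (hi : V `<=` At i) (hj : V `<=` At j) (h : V `<=` opensI (At i) (At j)) t :
  tco hi t = rres h (g i j) *: tco hj t.
Proof. exact: (svalP t). Qed.

Lemma tco_ext V (t u : msec twist V) :
  (forall i W (k : W `<=` V) (h : W `<=` At i), tco h (mres twist k t) = tco h (mres twist k u)) -> t = u.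
Proof.
move=> H; apply: sub_sec_eq; apply: prod_sec_eq => i.
have := H i (opensI (At i) V) capr capl.
have E (s : msec twist V) : tco (@opensIl _ (At i) V) (mres twist (@opensIr _ (At i) V) s) = sval s i.
  etransitivity; first exact: (mres_comp (o := N) _ _ (@subset_refl _ (opensI (At i) V))).
  exact: mres_id.
by rewrite !E.
Qed.

(** The cocycle gives all other coordinates as multiples of the i-th one. With [tco_surj], the twist
    is identified with N over U_i. *)
Lemma tco_inj i V (h : V `<=` At i) : injective (tco h).
Proof.
move=> t u e; apply: tco_ext => j W k hj.
have Wi := subset_trans k h.
have hji : W `<=` opensI (At j) (At i) by move=> x Wx; split; [exact: hj | exact: Wi].
by rewrite !(tco_change hj Wi hji) !(tco_res h) e.
Qed.

Lemma twist_glue V (n : forall i, msec N (opensI (At i) V)) :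
  (forall i j W (hi : W `<=` opensI (At i) V) (hj : W `<=` opensI (At j) V)
     (h : W `<=` opensI (At i) (At j)), mres N hi (n i) = rres h (g i j) *: mres N hj (n j)) ->
  exists t : msec twist V, forall i W (k : W `<=` V) (h : W `<=` At i) (l : W `<=` opensI (At i) V),
    tco h (mres twist k t) = mres N l (n i).
Proof.
move=> H; exists (exist _ n H) => i W k h l.
exact: (mres_comp (o := N)).
Qed.

Lemma tco_surj i V (h : V `<=` At i) (n : msec N V) : exists t, tco h t = n.
Proof.
have ji j : opensI (At j) V `<=` opensI (At j) (At i) by exact: setIS.
have [j k W hj hk hjk|t tP] := @twist_glue V (fun j => rres (ji j) (g j i) *: mres N capr n).
  have WV := subset_trans hj capr.
  have Wki := subset_trans hk (ji k); have Wji := subset_trans hj (ji j).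
  rewrite !mresZ (mres_comp _ _ WV) (mres_comp _ _ WV) (rres_comp _ _ Wji) (rres_comp _ _ Wki) scalerA.
  by rewrite (ccM g hjk Wki Wji).
exists t; have := tP i V sub_rfl h (twist_in h).
rewrite mres_id => ->; have Wii := subset_trans (twist_in h) (ji i).
by rewrite mresZ (rres_comp _ _ Wii) cc1 rmorph1 scale1r (mres_comp _ _ (@subset_refl _ V)) mres_id.
Qed.

Lemma twist_good i : good N (At i) -> good twist (At i).
Proof.
move=> gN b V h eV; split=> [t|t z].
  have [m0 [n e]] := good_lift gN h (tco h t) eV.
  have [t0 et0] := tco_surj (@subset_refl _ (At i)) m0.
  exists t0, n; apply: (@tco_inj i V h).
  by rewrite tcoZ e (tco_res (@subset_refl _ (At i))) et0.
have z1 : mres N h (tco (@subset_refl _ (At i)) t) = 0.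
  by rewrite -(tco_res (@subset_refl _ (At i)) h h) z tco0.
have [n en] := good_tors gN eV z1; exists n; apply: (@tco_inj i _ (@subset_refl _ (At i))).
by rewrite tcoZ en tco0.
Qed.

Lemma twist_qcoh : quasi_coherent N -> quasi_coherent twist.
Proof.
move=> /quasi_coherentP gN; apply: quasi_coherent_local => x; have [i xi] := at_cover At x.
exists (At i); split=> //; first exact: at_aff.
by apply: twist_good; apply: gN; exact: at_aff.
Qed.

End TwistBy.
Arguments tco {g N i V} h t.

Local Notation twist_pos n := (twist (pos_cocycle n)).
Local Notation twist_neg n := (twist (neg_cocycle n)).

Lemma tco_pos n N i j V (hi : V `<=` At i) (hj : V `<=` At j) (t : msec (twist_pos n N) V) :
  tco hi t = rres hi (a_ i j) ^+ n *: tco hj t.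
Proof.
have hij : V `<=` opensI (At i) (At j) by move=> x Vx; split; [exact: hi | exact: hj].
by rewrite (tco_change hi hj hij) /= rmorphXn (rres_comp _ _ hi).
Qed.

Lemma tco_neg n N i j V (hi : V `<=` At i) (hj : V `<=` At j) (t : msec (twist_neg n N) V) :
  tco hi t = rres hj (a_ j i) ^+ n *: tco hj t.
Proof.
have hij : V `<=` opensI (At i) (At j) by move=> x Vx; split; [exact: hi | exact: hj].
by rewrite (tco_change hi hj hij) /= rmorphXn (rres_comp _ _ hj).
Qed.

(* [f] is the multiplication by the n-th power of s_l, here and in
   [twist_mul_neg]. *)
Lemma twist_mul_pos n N l : exists f : ohom N (twist_pos n N),
  forall V (h : V `<=` At l) (t : msec (twist_pos n N) V), f V (tco h t) = t.
Proof.
have H V (m : msec N V) : {t : msec (twist_pos n N) V | forall i W (k : W `<=` V) (h : W `<=` At i),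
    tco h (mres _ k t) = rres h (a_ i l) ^+ n *: mres N k m}.
  apply: cid; have [i j W hi hj hij|t tP] := @twist_glue (pos_cocycle n) N V
     (fun i => rres (@opensIl _ (At i) V) (a_ i l) ^+ n *: mres N capr m).
    have Wi := subset_trans hi capl; have Wj := subset_trans hj capl.
    have WV := subset_trans hi capr.
    rewrite !mresZ !(mres_comp _ _ WV) !rmorphXn (rres_comp _ _ Wi) (rres_comp _ _ Wj) scalerA.
    by rewrite (rres_comp _ _ Wi) -exprMn at_ratioM.
  exists t => i W k h; have l' : W `<=` opensI (At i) V by move=> x Wx; split; [exact: h | exact: k].
  by rewrite (tP i W k h l') mresZ rmorphXn (rres_comp _ _ h) (mres_comp _ _ k).
pose f V m := sval (H V m).
have fP V m i W (k : W `<=` V) (h : W `<=` At i) :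
  tco h (mres _ k (f V m)) = rres h (a_ i l) ^+ n *: mres N k m := svalP (H V m) i W k h.
unshelve eexists.
  exists f => [V a m m'|V W h m]; apply: tco_ext => i S k hi.
    rewrite fP !mresP tcoP (fP V m) (fP V m') scalerDr !scalerA; congr (_ *: _ + _).
    exact: mulrC.
  rewrite fP (mres_comp _ _ (k >=> h)) -(fP V m); congr (tco _ _).
  symmetry; exact: mres_comp.
move=> V h t; apply: tco_ext => i W k hi; rewrite fP -(tco_res h k (k >=> h)).
by rewrite (tco_pos hi (k >=> h)).
Qed.

Lemma twist_mul_neg n N l : exists f : ohom (twist_neg n N) N,
  forall V (h : V `<=` At l) (t : msec (twist_neg n N) V), f V t = tco h t.
Proof.
have H V (t : msec (twist_neg n N) V) : {m : msec N V | forall i W (k : W `<=` V) (h : W `<=` At i),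
    mres N k m = rres h (a_ i l) ^+ n *: tco h (mres _ k t)}.
  apply: cid; have [|||m mP] := @mres_glue _ N V (fun W q => exists i (k : W `<=` V) (h : W `<=` At i),
     q = rres h (a_ i l) ^+ n *: tco h (mres _ k t)).
  - move=> W S h k q [i [h' [hi ->]]]; exists i, (k >=> h'), (k >=> hi).
    rewrite mresZ rmorphXn (rres_comp _ _ (k >=> hi)) -(tco_res hi k (k >=> hi)).
    by rewrite (mres_comp _ _ (k >=> h')).
  - move=> W h q q' [i [k [hi ->]]] [j [k' [hj ->]]].
    rewrite (Prop_irrelevance k' k) (tco_neg hi hj) scalerA -exprMn mulrC.
    by rewrite -(at_ratioM l hj hi).
  - move=> x Vx; have [i xi] := at_cover At x.
    exists (opensI V (At i)), capl.
    exists (rres (@opensIr _ V (At i)) (a_ i l) ^+ n *: tco (@opensIr _ V (At i)) (mres _ capl t)).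
    by split=> //; exists i, capl, capr.
  by exists m => i W k h; apply: mP; exists i, k, h.
pose f V t := sval (H V t).
have fP V t i W (k : W `<=` V) (h : W `<=` At i) :
  mres N k (f V t) = rres h (a_ i l) ^+ n *: tco h (mres _ k t) := svalP (H V t) i W k h.
unshelve eexists.
  exists f => [V a t u|V W h t]; apply: atlas_ext => i S k hi.
    rewrite (fP _ _ i S k hi) !mresP tcoP (fP V t i S k hi) (fP V u i S k hi) scalerDr !scalerA.
    by congr (_ *: _ + _); exact: mulrC.
  rewrite (fP _ _ i S k hi) [RHS](mres_comp _ _ (k >=> h)) (fP V t i S (k >=> h) hi).
  by rewrite (mres_comp (o := twist _ _) _ _ (k >=> h)).
move=> V h t; have := fP V t l V (@subset_refl _ V) h.
by rewrite !mres_id at_ratio1 rmorph1 expr1n scale1r.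
Qed.

(* [t] is the product of [n] by the [k]-th power of s_i. *)
Lemma twist_extend N (gN : forall U, aff U -> good N U) i (n : msec N (At i)) :
  exists k (t : msec (twist_pos k N) (opensT X)),
    forall V (h : V `<=` At i) (l : V `<=` opensT X), tco h (mres _ l t) = mres N h n.
Proof.
pose Vj j := nz (a_ j i).
have Vi j : Vj j `<=` At i by rewrite /Vj => x xj; have : oset (opensI (At j) (At i)) x by [rewrite at_inter]; case.
(* U_i meets U_j in D(a_ji), so that a power of a_ji times n extends to a section m_j over U_j. The
   atlas being finite, one exponent k serves for all j. *)
have [||k kP] := @seq_uniform _ (enum idx) (fun j k => exists m : msec N (At j),
    mres N (nzS (a_ j i)) m = rres (nzS (a_ j i)) (a_ j i) ^+ k *: mres N (Vi j) n).
- move=> j p q [m em] pq; exists (a_ j i ^+ (q - p) *: m).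
  by rewrite mresZ em rmorphXn scalerA -exprD subnK.
- move=> j _; have [m [k e]] := good_lift (gN _ (at_aff j)) (nzS (a_ j i)) (mres N (Vi j) n) erefl.
  by exists k, m.
have mE j : {m : msec N (At j) |
    mres N (nzS (a_ j i)) m = rres (nzS (a_ j i)) (a_ j i) ^+ k *: mres N (Vi j) n}.
  by apply: cid; apply: kP; rewrite mem_enum.
pose m j := sval (mE j).
have mP j : mres N (nzS (a_ j i)) (m j) = rres (nzS (a_ j i)) (a_ j i) ^+ k *: mres N (Vi j) n := svalP (mE j).
have Jr (j l : idx) : nz (a_ j l) `<=` At l.
  by move=> x xj; have : oset (opensI (At j) (At l)) x by [rewrite at_inter]; case.
(* The failure of the m_j to be the coordinates of a section of N(k). It vanishes on U_i, hence is
   killed by a power of a_ji; K is a common exponent. *)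
pose d j l := mres N (nzS (a_ j l)) (m j) - rres (nzS (a_ j l)) (a_ j l) ^+ k *: mres N (Jr j l) (m l).
have [p q s||K KP] := @seq_uniform _ (enum {: idx * idx}) (fun p K =>
    rres (nzS (a_ p.1 p.2)) (a_ p.1 i) ^+ K *: d p.1 p.2 = 0).
- exact: scalerX0.
- move=> [j l] _ /=.
  have gjl : good N (nz (a_ j l)).
    by apply: good_sub; [exact: aff_good (at_aff j) | exact: gN (at_aff j)].
  apply: (good_tors gjl (h := nzS _)) => //.
  set V := nz (rres _ _).
  have VU : V `<=` nz (a_ j l) by exact: nzS.
  have Vj' : V `<=` nz (a_ j i) by rewrite /V nz_res; exact: opensIr.
  have Vjj := subset_trans Vj' (nzS (a_ j i)).
  have Vll := subset_trans VU (Jr j l).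
  have Vii := subset_trans Vj' (Vi j).
  have Vli : V `<=` nz (a_ l i).
    by move=> x Vx; rewrite -at_inter; split; [exact: Vll | exact: Vii].
  rewrite mresB mresZ rmorphXn (rres_comp _ _ Vjj) !(mres_comp _ _ Vjj) !(mres_comp _ _ Vll).
  rewrite -(mres_comp (nzS (a_ j i)) Vj') mP -(mres_comp (nzS (a_ l i)) Vli) mP.
  rewrite !mresZ !rmorphXn (rres_comp _ _ Vjj) (rres_comp _ _ Vll) !(mres_comp _ _ Vii).
  by rewrite scalerA -exprMn at_ratioM subrr.
have dK j l : rres (nzS (a_ j l)) (a_ j i) ^+ K *: d j l = 0.
  by apply: (KP (j, l)); rewrite mem_enum.
(* The coordinates of t are a_ji^K *: m_j. As a_ji^K = a_jl^K * a_li^K, the extra factor raises the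
   twist by K. *)
exists (k + K)%N.
have [j l V hj hl hjl|t tP] := @twist_glue (pos_cocycle (k + K)) N (opensT X)
    (fun j => mres N capl (a_ j i ^+ K *: m j)).
  have Vj0 := subset_trans hj capl; have Vl0 := subset_trans hl capl.
  have VU : V `<=` nz (a_ j l) by move=> x Vx; rewrite -at_inter; exact: hjl.
  rewrite (mres_comp _ _ Vj0) (mres_comp _ _ Vl0) /= !mresZ !rmorphXn (rres_comp _ _ Vj0).
  have := congr1 (mres N VU) (dK j l).
  rewrite mres0 mresZ rmorphXn (rres_comp _ _ Vj0) mresB mresZ rmorphXn (rres_comp _ _ Vj0).
  rewrite (mres_comp _ _ Vj0) (mres_comp _ _ Vl0) scalerBr => /eqP; rewrite subr_eq0 => /eqP ->.
  rewrite !scalerA; congr (_ *: _).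
  by rewrite exprD -mulrA -exprMn at_ratioM mulrC.
exists t => V h l; have l' : V `<=` opensI (At i) (opensT X) by move=> x Vx; split=> //; exact: h.
rewrite (tP i V l h l') (mres_comp _ _ h) mresZ rmorphXn at_ratio1 rmorph1 expr1n scale1r.
have Vii : V `<=` nz (a_ i i) by rewrite at_ratio1 nz1.
rewrite -(mres_comp (nzS (a_ i i)) Vii) mP mresZ rmorphXn (rres_comp _ _ h).
by rewrite (mres_comp _ _ h) at_ratio1 rmorph1 expr1n scale1r.
Qed.

(** * The ideal of a closed subspace *)

Section ClosedSubspace.
Variable C : Qcoh X -> Prop.
Hypothesis closedC : closed_subspace C.

Lemma closed_sub (N M : Qcoh X) (f : Hom N M) : monic f -> C M -> C N.
Proof.
move=> mf CM; have [[H _] _] := closedC; apply: (H N M CM).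
exists N, f, (idm N); split=> // T u v; rewrite !cmpm1; exact.
Qed.

Lemma closed_quot (N M : Qcoh X) (f : Hom M N) : epic f -> C M -> C N.
Proof.
move=> ef CM; have [[H _] _] := closedC; apply: (H N M CM).
exists M, (idm M), f; split=> // T u v; rewrite !cmp1m; exact.
Qed.

Definition twist_q g (N : Qcoh X) : Qcoh X := qcoh_of (twist_qcoh g (svalP N)).

Lemma closed_twist_pos n (N : Qcoh X) : C N -> C (twist_q (pos_cocycle n) N).
Proof.
move=> CN; have [[_ /has_right_adjointP ra] _] := closedC.
have [R [eps [CR univ]]] := ra (twist_q (pos_cocycle n) N).
apply: (closed_quot (f := eps)) => //; apply: lsurj_epic => U t x Ux.
have [l xl] := at_cover At x; have [f fE] := twist_mul_pos n (sval N) l.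
have [f' [ff' _]] := univ N f CN.
exists (opensI U (At l)), capl.
exists (ohom_fun f' _ (tco (@opensIr _ U (At l)) (mres _ capl t))); split=> //.
rewrite -[RHS](fE _ (@opensIr _ U (At l))).
exact: (congr1 (fun g : ohom _ _ => g _ _) ff').
Qed.

Lemma closed_twist_neg n (N : Qcoh X) : C N -> C (twist_q (neg_cocycle n) N).
Proof.
move=> CN; have [_ /has_left_adjointP la] := closedC.
have [L [eta [CL univ]]] := la (twist_q (neg_cocycle n) N).
apply: (closed_sub (f := eta)) => //; apply: inj_monic => U t e.
apply: mres_ext => x Ux; have [l xl] := at_cover At x; have [f fE] := twist_mul_neg n (sval N) l.
have [f' [ff' _]] := univ N f CN.
exists (opensI U (At l)), capl; split=> //.
apply: (tco_inj (h := @opensIr _ U (At l))); rewrite mres0 tco0 -fE.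
rewrite -[f]ff'; transitivity (ohom_fun f' _ (ohom_fun eta _ (mres _ (@opensIl _ U (At l)) t))) => //.
by rewrite ohom_res e mres0 ohom0.
Qed.

(** The image K of the unit is quasi-coherent and lies in C, being a subobject of E. So the unit
    factors through K, and by uniqueness the identity of E factors through K too; hence K is all of
    E and the unit is locally surjective. *)
Lemma closed_unit : exists (E : Qcoh X) (p : ohom (omod_str X) (sval E)), [/\ C E, lsurj p &
  forall M : Qcoh X, C M -> forall f : ohom (omod_str X) (sval M), forall U a, p U a = 0 -> f U a = 0].
Proof.
have [_ /has_left_adjointP la] := closedC.
have [E [p [CE univ]]] := la (qcoh_of (@omod_str_qcoh X)).
exists E, p; split=> //; last first.
  move=> M CM f U a pa; have [f' [ff' _]] := univ M f CM.
  rewrite -[f]ff'; transitivity (ohom_fun f' U (ohom_fun p U a)) => //.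
  by rewrite pa ohom0.
have gE U := @qcoh_good X E U.
have P_lin U a m n : range (ohom_fun p U) m -> range (ohom_fun p U) n -> range (ohom_fun p U) (a *: m + n).
  move=> [b _ <-] [c _ <-]; exists (a *: (b : msec (omod_str X) U) + c) => //; exact: ohom_linear.
have P_res U V (h : V `<=` U) m : range (ohom_fun p U) m -> range (ohom_fun p V) (mres _ h m).
  by move=> [b _ <-]; exists (rres h b) => //; exact: (ohom_res p h b).
have P_0 U : range (ohom_fun p U) 0 by exists 0 => //; exact: ohom0.
pose K : subsheaf (sval E) := @subsheaf_locally X (sval E) (fun U => range (ohom_fun p U)) P_0 P_lin P_res.
(* Over an affine open set the sheafified image is the plain image, by clearing denominators. *)
have affK U (aU : aff U) e : K U e -> exists b, ohom_fun p U b = e.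
  move=> Ke; apply: (aff_local_mem (Q := [set e | exists b, ohom_fun p U b = e]) aU (gE U aU)).
  - by exists 0; rewrite ohom0.
  - by move=> a q r [b <-] [c <-]; exists (a *: b + c); rewrite ohom_linear.
  - move=> x Ux; have [W [h [Wx [a _ ea]]]] := Ke x Ux.
    have [g [gx gW]] := aff_basis aU Wx Ux.
    have [c0 [n ec]] := good_lift (aff_good aU) (nzS g) (rres gW a : msec (omod_str X) _) erefl.
    exists g, (ohom_fun p U c0); split=> //; first by exists c0.
    exists n; rewrite mresZ rmorphXn -ohom_res -ec ohomZ; congr (_ *: _).
    by rewrite -(mres_comp h gW) -ea; symmetry; exact: (ohom_res p gW a).
have pK U a : K U (ohom_fun p U a).
  by apply: subsheaf_locallyW; exists a.
have gK U : aff U -> good_sset K U.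
  move=> aU a V h m eV Km; have {}eV : V = nz a by exact: opens_eq.
  subst V; have [b eb] := affK _ (aff_sub a aU) m Km.
  have [b0 [n e]] := good_lift (aff_good aU) h (b : msec (omod_str X) _) erefl.
  by exists (ohom_fun p U b0), n; split=> //; rewrite -ohom_res -e ohomZ eb.
have qK : quasi_coherent (omod_sub K) by apply: omod_sub_qcoh => //; exact: svalP.
have CK : C (qcoh_of qK).
  apply: (closed_sub (N := qcoh_of qK) (f := sub_incl K : Hom (qcoh_of qK) E)) => //.
  by apply: inj_monic => U m e; exact: sub_sec_eq.
have @p' : ohom (omod_str X) (omod_sub K).
  exists (fun U a => exist _ (ohom_fun p U a) (pK U a)) => [U a m n|U V h m]; apply: sub_sec_eq.
    exact: ohom_linear.
  exact: ohom_res.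
have [k [kp _]] := univ (qcoh_of qK) p' CK.
have [k0 [_ u]] := univ E p CE.
have e1 : k0 = ohom_id (sval E) by apply: u; exact: ohom_eq.
have e2 : k0 = ohom_comp (sub_incl K) k.
  apply: u; apply: ohom_eq => U a; transitivity (sval (ohom_fun p' U a)) => //.
  by rewrite -[p']kp.
move=> U e x Ux.
have Ke : K U e.
  have -> : e = sval (ohom_fun k U e).
    exact: (congr1 (fun f : ohom (sval E) (sval E) => f U e) (etrans (esym e1) e2)).
  exact: svalP.
by have [V [h [Vx [a _ ea]]]] := Ke x Ux; exists V, h, a.
Qed.

Lemma section_ohom M (m : msec M (opensT X)) :
  {f : ohom (omod_str X) M | forall U (h : U `<=` opensT X) a, f U a = a *: mres M h m}.
Proof.
have T U : U `<=` opensT X by [].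
unshelve eexists.
  exists (fun U (a : sec X U) => a *: mres M (T U) m) => [U a b c|U V h b].
    by rewrite scalerDl -scalerA.
  by rewrite mresZ (mres_comp _ _ (T V)).
by move=> U h a /=; rewrite (Prop_irrelevance (T U) h).
Qed.

Lemma closed_kills (E : Qcoh X) (p : ohom (omod_str X) (sval E)) :
  (forall M : Qcoh X, C M -> forall f : ohom (omod_str X) (sval M),
     forall U a, p U a = 0 -> f U a = 0) ->
  forall N : Qcoh X, C N -> kills (ohom_ker p) (sval N).
Proof.
move=> pf N CN U a n pa; apply: mres_ext => x Ux; have [i xi] := at_cover At x.
have aU := at_aff i; have gN := @qcoh_good X N.
have [g [gx gU]] := aff_basis aU Ux xi.
have [n0 [j en]] := good_lift (gN _ aU) (nzS g) (mres _ gU n) erefl.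
have [k [t tP]] := twist_extend gN n0.
have [f fE] := section_ohom t.
have pa' : p _ (rres gU a) = 0 by have := ohom_res p gU a => /= ->; rewrite (pa : p U a = 0) mres0.
have := pf (twist_q (pos_cocycle k) N) (closed_twist_pos k CN) f _ _ pa'.
have T : nz g `<=` opensT X by [].
rewrite (fE _ T) => /(congr1 (tco (nzS g))); rewrite tcoZ tco0 tP -en => e0.
exists (nz g), gU; split=> //; rewrite mres0 mresZ.
apply: (is_unit_eq0 (is_unitX j (unit_nzS g))); rewrite -[RHS]e0 !scalerA; congr (_ *: _).
exact: mulrC.
Qed.

(** E is the quotient of O_X by an ideal that kills M, so over U_i the rule p a |-> a *: t is well
    defined on coordinates. It does not depend on i: the coordinate of e changes by a_ji^k, that of
    t by a_ij^k, and these factors are inverse to each other. *)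
Lemma kills_twist_map (E : Qcoh X) (p : ohom (omod_str X) (sval E)) (M : omod X) k
    (t : msec (twist_pos k M) (opensT X)) : lsurj p -> kills (ohom_ker p) M ->
  exists f : ohom (twist_neg k (sval E)) M,
    forall i V (h : V `<=` At i) (l : V `<=` opensT X) e (a : sec X V), tco h e = p V a ->
      f V e = a *: tco h (mres _ l t).
Proof.
move=> ps kM.
have T U : U `<=` opensT X by [].
have th_ex i : {th : forall V, V `<=` At i -> msec (sval E) V -> msec M V |
    [/\ forall V h a, th V h (p V a) = a *: tco h (mres _ (T V) t),
        forall V h, linear (th V h) &
        forall V W (h : V `<=` At i) (l : W `<=` V) (h' : W `<=` At i) e,
          th W h' (mres _ l e) = mres M l (th V h e)]}.
  apply: cid.
  (* The i-th coordinate of t exists over U_i only; as a global section of [omod_restrict] it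
     defines a map from O_X, to which [lsurj_factor] applies. *)
  pose s : msec (omod_restrict (At i) M) (opensT X) :=
    mres M (@opensIl _ (At i) (opensT X)) (tco (@subset_refl _ (At i)) (mres _ (T (At i)) t)).
  have [f fE] := section_ohom s.
  have [|g gE] := lsurj_factor (p := p) (f := f) ps.
    move=> U a pa; rewrite (fE U (T U)).
    apply: (kM _ (rres (@opensIr _ (At i) U) a)); exact: (ss_res (s := ohom_ker p) _ pa).
  exists (fun V h e => mres M (twist_in h) (g V e)); split.
  - move=> V h a; rewrite gE (fE V (T V)).
    etransitivity; first exact: (mresZ (M := M)).
    rewrite (rres_comp _ _ (@subset_refl _ V)) rres_id; congr (_ *: _).
    have P : V `<=` opensI (At i) (opensT X) := subset_trans (twist_in h) (omod_restrict_res (T V)).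
    rewrite omod_restrictE /s (mres_comp _ _ P).
    rewrite (mres_comp _ _ h) -(tco_res (@subset_refl _ (At i)) h h).
    by rewrite (mres_comp (o := twist _ _) _ _ (T V)).
  - move=> V h a m n; rewrite ohom_linear; etransitivity; first exact: (mresP (o := M)).
    by rewrite (rres_comp _ _ (@subset_refl _ V)) rres_id.
  - move=> V W h l h' e; rewrite ohom_res omod_restrictE.
    by rewrite !(mres_comp _ _ (l >=> (twist_in h))).
pose th i := sval (th_ex i).
have thp i V h a : th i V h (p V a) = a *: tco h (mres _ (T V) t) by case: (svalP (th_ex i)) => + _ _; exact.
have thl i V h : linear (th i V h) by case: (svalP (th_ex i)) => _ + _; exact.
have thr i V W (h : V `<=` At i) (l : W `<=` V) (h' : W `<=` At i) e :
  th i W h' (mres _ l e) = mres M l (th i V h e) by case: (svalP (th_ex i)) => _ _ +; exact.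
have compat i j V (hi : V `<=` At i) (hj : V `<=` At j) (e : msec (twist_neg k (sval E)) V) :
    th i V hi (tco hi e) = th j V hj (tco hj e).
  apply: mres_ext => x Vx; have [W [l [b [Wx eb]]]] := ps V (tco hj e) x Vx.
  have li := subset_trans l hi; have lj := subset_trans l hj.
  exists W, l; split=> //.
  rewrite -(thr i V W hi l li) -(thr j V W hj l lj) -eb thp (tco_neg hi hj) mresZ -eb.
  rewrite -(ohomZ p _ b) thp (tco_pos li lj) scalerA; congr (_ *: _).
  rewrite rmorphXn (rres_comp _ _ lj) /GRing.scale /= mulrAC -exprMn at_ratioM at_ratio1.
  by rewrite rmorph1 expr1n mul1r.
have H U (e : msec (twist_neg k (sval E)) U) : {m : msec M U |
    forall i V (l : V `<=` U) (h : V `<=` At i), mres M l m = th i V h (tco h (mres _ l e))}.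
  apply: cid; have [|||m mP] := @mres_glue _ M U (fun V q => exists i (l : V `<=` U) (h : V `<=` At i),
     q = th i V h (tco h (mres _ l e))).
  - move=> V W h l q [i [h' [hi ->]]]; exists i, (l >=> h'), (l >=> hi).
    rewrite -(thr i V W hi l (l >=> hi)) -(tco_res hi l (l >=> hi)).
    by rewrite (mres_comp _ _ (l >=> h')).
  - move=> V h q q' [i [l [hi ->]]] [j [l' [hj ->]]].
    by rewrite (Prop_irrelevance l' l); exact: compat.
  - move=> x Ux; have [i xi] := at_cover At x.
    exists (opensI U (At i)), capl.
    exists (th i _ (@opensIr _ U (At i)) (tco (@opensIr _ U (At i)) (mres _ capl e))).
    by split=> //; exists i, capl, capr.
  by exists m => i V l h; apply: mP; exists i, l, h.
pose f U e := sval (H U e).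
have fP U e i V (l : V `<=` U) (h : V `<=` At i) :
  mres M l (f U e) = th i V h (tco h (mres _ l e)) := svalP (H U e) i V l h.
unshelve eexists.
  exists f => [U a d e|U V h e]; apply: atlas_ext => i S l hi.
    by rewrite (fP _ _ i S l hi) !mresP tcoP thl (fP U d i S l hi) (fP U e i S l hi).
  rewrite (fP _ _ i S l hi) [RHS](mres_comp _ _ (l >=> h)) (fP U e i S (l >=> h) hi).
  by rewrite (mres_comp (o := twist _ _) _ _ (l >=> h)).
move=> i V h l e a ea; rewrite (Prop_irrelevance l (T V)) -thp -ea.
by have := fP V e i V (@subset_refl _ V) h; rewrite !mres_id.
Qed.

Lemma kills_closed (E : Qcoh X) (p : ohom (omod_str X) (sval E)) : C E -> lsurj p ->
  forall M : Qcoh X, kills (ohom_ker p) (sval M) -> C M.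
Proof.
move=> CE ps M kM; have [[_ /has_right_adjointP ra] _] := closedC.
have [R [eps [CR univ]]] := ra M.
apply: (closed_quot (f := eps)) => //; apply: lsurj_epic => U m x Ux.
have [i xi] := at_cover At x; have aU := at_aff i; have gM := @qcoh_good X M.
have [g [gx gU]] := aff_basis aU Ux xi.
have [m0 [j em]] := good_lift (gM _ aU) (nzS g) (mres _ gU m) erefl.
have [k [t tP]] := twist_extend gM m0.
have [f fE] := kills_twist_map t ps kM.
have [f' [ff' _]] := univ (twist_q (neg_cocycle k) E) f (closed_twist_neg k CE).
(* The section e of E(-k) with i-th coordinate p 1 is sent by f to the i-th coordinate of t, which
   is m0. *)
have [e ee] := tco_surj (neg_cocycle k) (@subset_refl _ (At i)) (p (At i) 1).
have em0 : ohom_fun eps _ (ohom_fun f' _ e) = m0.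
  transitivity (f (At i) e); first exact: (congr1 (fun h : ohom _ _ => h _ e) ff').
  have l : At i `<=` opensT X by [].
  by rewrite (fE i (At i) sub_rfl l e 1 ee) tP mres_id scale1r.
have [c ec] : is_unit (rres (nzS g) g ^+ j) by apply: is_unitX; exact: unit_nzS.
exists (nz g), gU, (c *: mres _ (nzS g) (ohom_fun f' _ e)); split=> //.
by rewrite ohomZ ohom_res em0 -em scalerA mulrC ec scale1r.
Qed.

Theorem closed_subspace_ideal : exists (E : Qcoh X) (p : ohom (omod_str X) (sval E)),
  lsurj p /\ forall N : Qcoh X, C N <-> kills (ohom_ker p) (sval N).
Proof.
have [E [p [CE ps pf]]] := closed_unit.
by exists E, p; split=> // N; split; [exact: closed_kills | exact: kills_closed].
Qed.

End ClosedSubspace.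

End Twist.

(* The three parts say that [qcoh_image] takes its values in the closed
   subspaces, is well defined and injective on closed subschemes, and is
   surjective. *)
Theorem theorem4p1 (X : scheme) (noethX : noetherian_scheme X)
    (ampleX : exists L : omod X, ample L) :
  [/\ forall Z : closed_subscheme X, closed_subspace (qcoh_image Z),
      forall Y Z : closed_subscheme X,
        same_subscheme Y Z <-> qcoh_image Y = qcoh_image Z
    & forall W : Qcoh X -> Prop, closed_subspace W ->
        exists Z : closed_subscheme X, qcoh_image Z = W].
Proof.
split.
- move=> Z; have -> : qcoh_image Z = fun N : Qcoh X => kills (sub_ideal Z) (sval N).
    by apply: funext => N; apply: propext; exact: qcoh_imageP.
  by apply: closed_of_ideal => // U; exact: sub_ideal_good.
- exact: same_subschemeP.
- move=> W cW; have [L aL] := ampleX; have [At] := ample_atlas_ex noethX aL.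
  have [E [p [ps WP]]] := closed_subspace_ideal At cW.
  have [Z ZP] := closed_subscheme_of_quotient ps (svalP E).
  exists Z; apply: funext => N; apply: propext; rewrite qcoh_imageP WP.
  by split=> k U a n /ZP; exact: k.
Qed.
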